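(* Let $d\geq 2$, $p\geq 1$, $q\geq 1$, $\tau\geq 1$, $0<a\leq 1$, and $\alpha,\beta,\gamma\in\mathbb{R}$. Define $\sigma\in\mathbb{R}$ by $\gamma=a\sigma+(1-a)\beta$. Assume $$\frac{1}{\tau}+\frac{\gamma}{d}=a\left(\frac{1}{p}+\frac{\alpha-1}{d}\right)+(1-a)\left(\frac{1}{q}+\frac{\beta}{d}\right)$$ and $$-(d-1)\leq\alpha-\sigma<0.$$ Then there exists a positive constant $C$, independent of $u$, such that: (i) if $\frac{1}{\tau}+\frac{\gamma}{d}>0$, then for all radial $u\in L^1_{loc}(\mathbb{R}^d\setminus\{0\})$ with compact support in $\mathbb{R}^d$, $$\left\||x|^\gamma u\right\|_{L^\tau(\mathbb{R}^d)}\leq C\left\||x|^\alpha\nabla u\right\|^a_{L^p(\mathbb{R}^d\setminus\{0\})}\left\||x|^\beta u\right\|^{1-a}_{L^q(\mathbb{R}^d)};$$ (ii) if $\frac{1}{\tau}+\frac{\gamma}{d}<0$, then the same inequality holds for all radial $u\in L^1_{loc}(\mathbb{R}^d\setminus\{0\})$ which is $0$ in a neighborhood of $0$.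
   Context: $\nabla u$ is the distributional gradient of $u$ on $\mathbb{R}^d\setminus\{0\}$; the quantity $\||x|^\alpha\nabla u\|_{L^p(\mathbb{R}^d\setminus\{0\})}$ is considered to be $+\infty$ if $\nabla u\notin[L^p_{loc}(\mathbb{R}^d\setminus\{0\})]^d$. The quantities in the inequality may be infinite; the conventions are $+\infty\cdot 0=0\cdot(+\infty)=0$, $(+\infty)^0=1$ (this corresponds to the case $a=1$), and $+\infty\leq+\infty$. *)

(* Defs.v *)
From HB Require Import structures.
From mathcomp Require Import all_boot all_order all_algebra.
From mathcomp Require Import all_classical all_reals all_analysis.
Set Implicit Arguments.
Unset Strict Implicit.
Unset Printing Implicit Defensive.
Import Order.TTheory GRing.Theory Num.Theory.
Import numFieldNormedType.Exports.
Local Open Scope classical_set_scope.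
Local Open Scope ring_scope.

Definition rV_display : measure_display.
Proof. exact: default_measure_display. Qed.

Section measurable_rV.
Context {R : realType} {n : nat}.

Let borel : set (set 'rV[R]_n) := <<s open >>.

Let borel0 : borel set0. Proof. exact: sigma_algebra0. Qed.

Let borelC A : borel A -> borel (~` A). Proof. exact: sigma_algebraC. Qed.

Let borel_bigcup (F : (set 'rV[R]_n)^nat) :
  (forall i, borel (F i)) -> borel (\bigcup_i (F i)).
Proof. exact: sigma_algebra_bigcup. Qed.

HB.instance Definition _ := @isMeasurable.Build rV_display
  'rV[R]_n borel borel0 borelC borel_bigcup.

Lemma measurable_coord (i : 'I_n) :
  measurable_fun [set: 'rV[R]_n] (fun x => x ord0 i : R).
Proof.
apply: (measurability _ (measurable_realfun.RGenOpens.measurableE R)) => _ [_ [a [b ->]] <-].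
rewrite setTI; apply: sub_sigma_algebra => /=.
have /continuousP : continuous (fun x : 'rV[R]_n => x ord0 i : R).
  exact: coord_continuous.
by apply; exact: interval_open.
Qed.

(* Every open set is a countable union of open boxes with rational corners, so
   the Borel sigma-algebra is generated by the coordinates. *)
Lemma measurable_fun_coordP d (T : measurableType d) (f : T -> 'rV[R]_n) :
  (forall i, measurable_fun [set: T] (fun t => f t ord0 i : R)) ->
  measurable_fun [set: T] f.
Proof.
move=> mf _ A mA; rewrite setTI.
suff : measurable `<=` [set B | measurable (f @^-1` B)] by apply.
apply: smallest_sub.
  split => /= [|B mB|F mF].
  - by rewrite preimage_set0.
  - by rewrite setTD -preimage_setC; exact: measurableC.
  - by rewrite preimage_bigcup; exact: bigcupT_measurable.
move=> U oU /=.
pose box (a : 'rV[rat]_n * 'rV[rat]_n) : set 'rV[R]_n :=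
  [set x | forall i, ratr (a.1 ord0 i) < x ord0 i < ratr (a.2 ord0 i)].
have -> : U = \bigcup_a (if `[< box a `<=` U >] then box a else set0).
  apply/seteqP; split => [x Ux|x [a _]]; last by case: asboolP => // + ?; apply.
  have /nbhs_ballP[e /= e0 xeU] := open_nbhs_nbhs (conj oU Ux).
  have rat_lt (y z : R) : y < z -> {q : rat | y < ratr q < z}.
    move=> yz; have /cid[q qyz] := rat_in_itvoo yz.
    by exists q; rewrite in_itv/= in qyz.
  have lo i : x ord0 i - e < x ord0 i by rewrite ltrBlDr ltrDl.
  have hi i : x ord0 i < x ord0 i + e by rewrite ltrDl.
  exists (\row_i sval (rat_lt _ _ (lo i)), \row_i sval (rat_lt _ _ (hi i))) => //.
  case: asboolP => [_ i|] /=.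
    rewrite !mxE; case: (rat_lt _ _ (lo i)) => q /= /andP[_ ->].
    by case: (rat_lt _ _ (hi i)) => r /= /andP[-> _].
  apply: contra_notP => _ y /= yB; apply: xeU; split=> // i j; rewrite (ord1 i).
  move: (yB j); rewrite !mxE.
  case: (rat_lt _ _ (lo j)) => q /= /andP[q1 q2].
  case: (rat_lt _ _ (hi j)) => r /= /andP[r1 r2] /andP[qy yr].
  rewrite /ball/= ltr_norml; apply/andP; split.
    by rewrite ltrBrDl ltrBlDr addrC (lt_trans yr)// addrC.
  by rewrite ltrBlDr -ltrBlDl (lt_trans q1).
rewrite preimage_bigcup.
apply: countable_bigcupT_measurable => // a; case: asboolP => _; last first.
  by rewrite preimage_set0.
rewrite [X in measurable X](_ : _ = \bigcap_(i in [set: 'I_n])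
    ((fun t => f t ord0 i) @^-1`
      `]ratr (a.1 ord0 i), ratr (a.2 ord0 i)[%classic)); last first.
  apply/seteqP; split => t /=; first by move=> H i _; rewrite /= in_itv/=.
  by move=> H i; have := H i I; rewrite /= in_itv.
apply: fin_bigcap_measurable => // i _.
by rewrite -[X in measurable X]setTI; exact: mf.
Qed.

End measurable_rV.

Section lebesgue_rV_cons.
Context {R : realType} {n : nat}.

Definition consrV (x : R * 'rV[R]_n) : 'rV[R]_n.+1 :=
  row_mx (x.1%:M : 'rV[R]_1) x.2.

Lemma consrV0 x : consrV x ord0 ord0 = x.1.
Proof.
have -> : (ord0 : 'I_n.+1) = lshift n (ord0 : 'I_1) by exact/val_inj.
by rewrite [LHS](@row_mxEl _ 1 1 n) mxE eqxx.
Qed.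

Lemma consrVS x i : consrV x ord0 (lift ord0 i) = x.2 ord0 i.
Proof.
have -> : lift ord0 i = rshift 1 i by exact/val_inj.
exact: (@row_mxEr _ 1 1 n).
Qed.

Lemma measurable_consrV : measurable_fun [set: R * 'rV[R]_n] consrV.
Proof.
apply: measurable_fun_coordP => i; case: (unliftP ord0 i) => [j|] ->.
  under eq_fun do rewrite consrVS.
  exact: measurableT_comp (measurable_coord j) measurable_snd.
by under eq_fun do rewrite consrV0; exact: measurable_fst.
Qed.

Variable mu : {sigma_finite_measure set 'rV[R]_n -> \bar R}.

Definition lebesgue_cons : set 'rV[R]_n.+1 -> \bar R :=
  pushforward (@lebesgue_measure R \x mu)%E consrV.

Let preimage_consrV A : measurable A -> measurable (consrV @^-1` A).
Proof.
by move=> mA; rewrite -[X in measurable X]setTI; exact: measurable_consrV.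
Qed.

Let lebesgue_cons0 : lebesgue_cons set0 = 0%E.
Proof. by rewrite /lebesgue_cons /pushforward preimage_set0 measure0. Qed.

Let lebesgue_cons_ge0 A : (0 <= lebesgue_cons A)%E.
Proof. by rewrite /lebesgue_cons /pushforward measure_ge0. Qed.

Let lebesgue_cons_sigma_additive : semi_sigma_additive lebesgue_cons.
Proof.
move=> F mF tF mUF; rewrite /lebesgue_cons /pushforward preimage_bigcup.
apply: measure_semi_sigma_additive.
- by move=> k; exact: preimage_consrV.
- apply/trivIsetP => /= i j _ _ ij; rewrite -preimage_setI.
  by move/trivIsetP : tF => /(_ _ _ _ _ ij) ->//; rewrite preimage_set0.
- by rewrite -preimage_bigcup; exact: preimage_consrV.
Qed.

HB.instance Definition _ := isMeasure.Build _ _ _ lebesgue_cons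
  lebesgue_cons0 lebesgue_cons_ge0 lebesgue_cons_sigma_additive.

Let lebesgue_cons_sigma_finite : sigma_finite setT lebesgue_cons.
Proof.
have /sigma_finiteP[F [UF ndF Foo]] := sigma_finiteT (@lebesgue_measure R).
have /sigma_finiteP[G [UG ndG Goo]] := sigma_finiteT mu.
pose psi (x : 'rV[R]_n.+1) : R * 'rV[R]_n :=
  (x ord0 ord0, \row_i x ord0 (lift ord0 i)).
have psiK : cancel consrV psi.
  move=> [t x]; rewrite /psi consrV0; congr pair.
  by apply/rowP => i; rewrite mxE consrVS.
have mpsi : measurable_fun setT psi.
  apply/measurable_fun_pairP; split => /=; first exact: measurable_coord.
  apply: measurable_fun_coordP => i /=.
  by under eq_fun do rewrite mxE; exact: measurable_coord.
exists (fun k => psi @^-1` (F k `*` G k)).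
  apply/seteqP; split => // x _.
  have [k _ Fk] : (\bigcup_k F k) (psi x).1 by rewrite -UF.
  have [l _ Gl] : (\bigcup_k G k) (psi x).2 by rewrite -UG.
  exists (maxn k l) => //; split.
    by move: Fk; exact/subsetPset/ndF/leq_maxl.
  by move: Gl; exact/subsetPset/ndG/leq_maxr.
move=> k; have [mFk Fkoo] := Foo k; have [mGk Gkoo] := Goo k; split.
  by rewrite -[X in measurable X]setTI; apply: mpsi => //; exact: measurableX.
rewrite /lebesgue_cons /pushforward -comp_preimage.
rewrite (_ : psi \o consrV = id); last exact/funext.
by rewrite preimage_id product_measure1E// lte_mul_pinfty// ge0_fin_numE.
Qed.

HB.instance Definition _ := Measure_isSigmaFinite.Build _ _ _ lebesgue_cons
  lebesgue_cons_sigma_finite.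

End lebesgue_rV_cons.

(* Lebesgue measure on R^n, built by adding one coordinate at a time. *)
Fixpoint lebesgue_rV {R : realType} (n : nat) :
    {sigma_finite_measure set 'rV[R]_n -> \bar R} :=
  if n is k.+1 then lebesgue_cons (lebesgue_rV k) else \d_(0 : 'rV[R]_0).

(* [lebesgue_rV n] is the measure which gives boxes their volume. *)
Lemma lebesgue_rV_box {R : realType} (n : nat) (a b : 'rV[R]_n) :
  (forall i, a ord0 i <= b ord0 i) ->
  lebesgue_rV n [set x : 'rV[R]_n | forall i, a ord0 i <= x ord0 i <= b ord0 i] =
  (\prod_i (b ord0 i - a ord0 i))%:E.
Proof.
elim: n a b => [|n ih] a b ab.
  by rewrite big_ord0 /= diracE mem_set//= => -[].
rewrite big_ord_recl EFinM.
pose tl (x : 'rV[R]_n.+1) : 'rV[R]_n := \row_i x ord0 (lift ord0 i).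
have boxE : consrV @^-1`
      [set x : 'rV[R]_n.+1 | forall i, a ord0 i <= x ord0 i <= b ord0 i] =
    `[a ord0 ord0, b ord0 ord0] `*`
    [set x : 'rV[R]_n | forall i, tl a ord0 i <= x ord0 i <= tl b ord0 i].
  apply/seteqP; split => -[t x] /=.
    move=> H; split => [|i]; first by have := H ord0; rewrite consrV0 in_itv.
    by have := H (lift ord0 i); rewrite consrVS !mxE.
  move=> [t01 H] i; case: (unliftP ord0 i) => [j|] ->.
    by have := H j; rewrite consrVS !mxE.
  by rewrite consrV0; rewrite in_itv/= in t01.
rewrite [LHS](_ : _ = (lebesgue_measure \x lebesgue_rV n)%E (consrV @^-1`
  [set x : 'rV[R]_n.+1 | forall i, a ord0 i <= x ord0 i <= b ord0 i]))//.
rewrite boxE product_measure1E//; last first.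
  rewrite [X in measurable X](_ : _ = \bigcap_(i in [set: 'I_n])
      ((fun x : 'rV[R]_n => x ord0 i) @^-1`
        `[tl a ord0 i, tl b ord0 i]%classic)); last first.
    apply/seteqP; split => x /=; first by move=> H i _; rewrite /= in_itv/=.
    by move=> H i; have := H i I; rewrite /= in_itv.
  apply: fin_bigcap_measurable => // i _.
  by rewrite -[X in measurable X]setTI; exact: measurable_coord.
rewrite [X in (X * _)%E]lebesgue_measure_itv/= lte_fin ih; last by move=> i; rewrite !mxE.
congr (_ * _)%E; last by congr EFin; apply: eq_bigr => i _; rewrite !mxE.
case: ltP => [|ba]; first by rewrite EFinB.
by have /eqP -> : b ord0 ord0 == a ord0 ord0; [rewrite eq_le ba ab|rewrite subrr].
Qed.

Section defs.
Context {R : realType} {d : nat}.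
Local Notation E := 'rV[R]_d.
Local Notation mu := (@lebesgue_rV R d).
Implicit Types (D : set E) (u : E -> R) (g : E -> E).

(* The library norm of ['rV[R]_d] is the sup norm. *)
Definition enorm (x : E) : R := Num.sqrt (\sum_i x ord0 i ^+ 2).

Definition punctured : set E := [set x | x != 0].

Definition basis_vec (i : 'I_d) : E := delta_mx ord0 i.

Definition iter_partial (s : seq 'I_d) (phi : E -> R) : E -> R :=
  foldr (fun i f => 'D_(basis_vec i) f) phi s.

(* Partial derivatives of all orders exist and are continuous. *)
Definition smooth (phi : E -> R) : Prop :=
  forall s, continuous (iter_partial s phi) /\
    forall i x, derivable (iter_partial s phi) x (basis_vec i).

Definition test_function D (phi : E -> R) : Prop :=
  let supp := closure [set x | phi x != 0] in
  [/\ smooth phi, compact supp & supp `<=` D].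

(* The analogue of the library's [locally_integrable]; measurability refers to
   Borel sets, and each class modulo equality almost everywhere has a Borel
   representative. *)
Definition Lp_loc (p : R) D u : Prop :=
  measurable_fun D u /\
  forall K, K `<=` D -> compact K ->
    (\int[mu]_(x in K) (`|u x| `^ p)%:E < +oo)%E.

Definition is_distr_gradient D u g : Prop :=
  (forall i, Lp_loc 1 D (fun x => g x ord0 i)) /\
  forall phi, test_function D phi -> forall i,
    (\int[mu]_(x in D) (u x * 'D_(basis_vec i) phi x)%:E =
     - \int[mu]_(x in D) (g x ord0 i * phi x)%:E)%E.

Definition weighted_norm (s p : R) D u : \bar R :=
  'N[mu]_p%:E[EFin \o ((fun x => (enorm x `^ s * u x)%R) \_ D)]%E.

(* The choice of [g] does not matter: a distributional gradient is unique up to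
   equality almost everywhere. *)
Definition weighted_grad_norm (s p : R) u : \bar R :=
  match pselect (exists g, is_distr_gradient punctured u g /\
                   forall i, Lp_loc p punctured (fun x => g x ord0 i)) with
  | left gradu => weighted_norm s p punctured (enorm \o sval (cid gradu))
  | right _ => +oo%E
  end.

Definition radial u : Prop :=
  exists f : R -> R, {ae mu, forall x, u x = f (enorm x)}.

(* The complement of the largest open set on which [u] vanishes almost
   everywhere. *)
Definition ess_support u : set E :=
  [set x | forall U, open U -> U x -> ~ {ae mu, forall y, U y -> u y = 0}].

Definition vanishes_near0 u : Prop :=
  exists2 U, nbhs (0 : E) U & {ae mu, forall x, U x -> u x = 0}.

End defs.

Arguments punctured {R} d.

(* Main.v *)
(* Put rho(x) = |x|^d, which pushes Lebesgue measure forward to a multiple of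
   Lebesgue measure on the half line, and write a radial u as F(rho). Testing the
   gradient g against the field x k(rho) / rho, whose divergence is d k'(rho), bounds
   |F(s) - F(t)| at Lebesgue points by an integral of |g| over the shell between s
   and t; so F is Hoelder of exponent 1 - 1/p on every dyadic shell. There |F| minus
   its infimum is interpolated between this bound and the L^q norm, while the
   infimum is controlled by the mean of |F|^tau over the adjacent shell. With
   T = 1/tau + gamma/d, the weighted masses w_i of the shells, numbered from the side
   where u vanishes, satisfy w_(i+1) <= 2^(-|T|) w_i + C x_i^s y_i^r with
   s = a tau / p, r = (1 - a) tau / q, and x_i, y_i the p-th and q-th powers of the
   weighted norms of g and u near the i-th shell. The balance condition together with
   the bounds on alpha - sigma gives s + r >= 1, so that
   sum x_i^s y_i^r <= (sum x_i)^s (sum y_i)^r. *)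

Require Import Defs.
From mathcomp Require Import all_boot all_order all_algebra.
From mathcomp Require Import all_classical all_reals all_analysis.
From mathcomp Require Import measurable_realfun ring lra.
Import Order.TTheory GRing.Theory Num.Theory.
Import numFieldNormedType.Exports.
Local Open Scope classical_set_scope.
Local Open Scope ring_scope.
Set Implicit Arguments.
Unset Strict Implicit.

(** * Lebesgue measure and the radius *)

(** The gradient controls [|F|] on a shell only up to a constant, so a constant has to be carried
    from shell to shell, and the proof lives on the decay of that constant. Between neighbouring
    shells the weighted mass of a constant changes by the factor [2^(T tau)] outwards and
    [2^(-T tau)] inwards, so the recursion runs inwards for [T > 0], outwards for [T < 0], and
    contracts in neither direction for [T = 0]. The support hypothesis makes the starting mass zero:
    compact support at the outer end, vanishing near 0 at the inner end. Separating the constant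
    from the deviation inside a [tau]-th power costs a factor above 1; splitting with weight
    [k = 2^(-|T|)] costs [k^(1 - tau)], and the product with [2^(-|T| tau)] is [k] again.

    Eliminating [gamma] gives [1/tau = a/p + (1-a)/q + a (alpha - sigma - 1)/d]. The two bounds on
    [alpha - sigma] then act separately: the upper one yields [s + r >= 1], the lower one keeps the
    power of [F] left over inside a shell within reach of its [L^q] norm.

    Measuring radii by volume replaces polar coordinates: shells become intervals with Lebesgue
    measure. *)

Section scaling.
Context {R : realType}.
Local Notation leb := (@lebesgue_measure R).

Lemma preimage_measurableT d1 d2 (T1 : measurableType d1) (T2 : measurableType d2)
    (f : T1 -> T2) (A : set T2) :
  measurable_fun setT f -> measurable A -> measurable (f @^-1` A).
Proof. by move=> mf mA; rewrite -[X in measurable X]setTI; exact: mf. Qed.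

(** The long name is the canonical measure structure on [pushforward m f], applied by hand because
    it depends on the proof [mf]. *)
Definition pushmeas d1 d2 (T1 : measurableType d1) (T2 : measurableType d2)
    (m : {measure set T1 -> \bar R}) (f : T1 -> T2) (mf : measurable_fun setT f) :
    {measure set T2 -> \bar R} := 
   measure_function_pushforward__canonical__measure_function_Measure m mf.

(** Uniqueness of Lebesgue measure: the right-hand side is a measure in [A] with the correct value
    on every half-open interval. *)
Lemma lebesgue_measure_scale (l : R) (A : set R) : 0 < l -> measurable A ->
  leb A = (l%:E * leb [set x | A (l * x)%R])%E.
Proof.
move=> l0 mA.
have mf : measurable_fun setT (fun x : R => l * x : measurableTypeR R).
  exact: measurable_funM.
pose m : {measure set measurableTypeR R -> \bar R} :=
   mscale (NngNum (ltW l0)) (pushmeas leb mf).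
rewrite (_ : (_ * _)%E = m A) //.
apply: lebesgue_measure_unique => // X [[a b] _ <-] /=.
rewrite /m/= /mscale /= /pushforward/=.
rewrite (_ : (fun x => l * x) @^-1` _ = `](a / l), (b / l)]%classic); last first.
  apply/seteqP; split => x /=; rewrite !in_itv/=.
    by rewrite ltr_pdivrMr// ler_pdivlMr// mulrC.
  by rewrite ltr_pdivrMr// ler_pdivlMr// mulrC.
rewrite !lebesgue_measure_itv/= !lte_fin ltr_pM2r ?invr_gt0//.
case: ifP => _; last by rewrite mule0.
by rewrite -!EFinD -EFinM -mulrBl mulrCA mulfV ?mulr1// gt_eqF.
Qed.

Lemma measurable_scale_rV (n : nat) (l : R) :
  measurable_fun setT (fun x : 'rV[R]_n => l *: x).
Proof.
apply: measurable_fun_coordP => i.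
under eq_fun do rewrite mxE.
by apply: measurable_funM => //; exact: measurable_coord.
Qed.

Lemma consrV_scale (n : nat) (l t : R) (x : 'rV[R]_n) :
  consrV (l * t, l *: x) = l *: consrV (t, x).
Proof.
have ZE (m : nat) (y : 'rV[R]_m) k : (l *: y) ord0 k = l * y ord0 k by rewrite mxE.
apply/rowP => i; rewrite ZE; case: (unliftP ord0 i) => [j|] ->.
  by rewrite !consrVS ZE.
by rewrite !consrV0.
Qed.

(** Induction on the dimension: a dilation acts on each factor of [consrV], so the rescaled measure
    agrees with the product measure on rectangles, which determine it. *)
Lemma lebesgue_rV_scale (n : nat) (l : R) (A : set 'rV[R]_n) : 0 < l -> measurable A ->
  lebesgue_rV n A = ((l ^+ n)%:E * lebesgue_rV n [set x | A (l *: x)])%E.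
Proof.
move=> l0; elim: n A => [|n ih] A mA.
  rewrite expr0 mul1e /= !diracE; congr (_%:R%:E).
  by apply: congr1; apply/idP/idP; rewrite !inE/= scaler0.
pose B := @consrV R n @^-1` A.
have mB : measurable B by apply: preimage_measurableT => //; exact: measurable_consrV.
have mf : measurable_fun setT (fun x : R => l * x : measurableTypeR R).
  exact: measurable_funM.
pose f (z : measurableTypeR R * 'rV[R]_n) : measurableTypeR R * 'rV[R]_n := (l * z.1, l *: z.2).
have mff : measurable_fun setT f.
  apply/measurable_fun_pairP; split => /=.
    exact: (measurableT_comp mf measurable_fst).
  exact: (measurableT_comp (@measurable_scale_rV n l) measurable_snd).
pose m : {measure set (measurableTypeR R * 'rV[R]_n) -> \bar R} :=
  mscale (NngNum (ltW (exprn_gt0 n.+1 l0)))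
    (pushmeas (leb \x lebesgue_rV n)%E mff).
transitivity ((leb \x lebesgue_rV n)%E B) => //.
transitivity (m B); last first.
  rewrite /m /= /mscale /= /pushforward /= /lebesgue_cons /pushforward.
  congr (_ * (leb \x lebesgue_rV n)%E _)%E.
  by apply/seteqP; split => -[t x]; rewrite /B /f /= consrV_scale.
apply: product_measure_unique => // X Y mX mY.
rewrite /m /= /mscale /= /pushforward /=.
rewrite (_ : f @^-1` _ = [set t | X (l * t)] `*` [set t | Y (l *: t)])//.
rewrite product_measure1E; last 2 first.
- exact: (preimage_measurableT mf mX).
- exact: (preimage_measurableT (@measurable_scale_rV n l) mY).
by rewrite exprS EFinM muleACA -lebesgue_measure_scale// -ih.
Qed.

End scaling.

Section radius.
Context {R : realType} {d : nat}.
Local Notation E := 'rV[R]_d.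
Local Notation mu := (@lebesgue_rV R d).
Local Notation leb := (@lebesgue_measure R).
Implicit Types x : E.

Definition rho x : R := enorm x ^+ d.

Lemma enorm_ge0 x : 0 <= enorm x. Proof. exact: sqrtr_ge0. Qed.

Lemma ler_enorm x i : `|x ord0 i| <= enorm x.
Proof.
rewrite -sqrtr_sqr ler_wsqrtr// (bigD1 i)//= lerDl.
by apply: sumr_ge0 => j _; exact: sqr_ge0.
Qed.

Lemma enorm0 : enorm (0 : E) = 0.
Proof. by rewrite /enorm big1 ?sqrtr0// => i _; rewrite mxE expr0n. Qed.

Lemma enorm_eq0 x : (enorm x == 0) = (x == 0).
Proof.
apply/eqP/eqP => [x0|->]; last exact: enorm0.
apply/rowP => i; rewrite mxE; apply/eqP; rewrite -normr_eq0 eq_le normr_ge0 andbT.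
by rewrite -x0 ler_enorm.
Qed.

Lemma enormZ l x : enorm (l *: x) = `|l| * enorm x.
Proof.
rewrite /enorm -sqrtr_sqr -sqrtrM ?sqr_ge0// mulr_sumr.
by congr Num.sqrt; apply: eq_bigr => i _; rewrite mxE exprMn.
Qed.

Lemma measurable_enorm : measurable_fun setT (enorm : E -> R).
Proof.
rewrite (_ : enorm = Num.sqrt \o (fun x : E => \sum_i x ord0 i ^+ 2))//.
apply: measurableT_comp.
  by apply: continuous_measurable_fun; exact: sqrt_continuous.
apply: measurable_sum => i; apply: measurable_funX; exact: measurable_coord.
Qed.

Lemma measurable_rho : measurable_fun setT (rho : E -> R).
Proof. by apply: measurable_funX; exact: measurable_enorm. Qed.

Lemma rho_ge0 x : 0 <= rho x. Proof. by rewrite exprn_ge0// enorm_ge0. Qed.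

Hypothesis d0 : (0 < d)%N.

Lemma rho_eq0 x : (rho x == 0) = (x == 0).
Proof. by rewrite /rho expf_eq0 d0 enorm_eq0. Qed.

Lemma rho_gt0 x : (0 < rho x) = (x != 0).
Proof. by rewrite lt_neqAle rho_ge0 andbT eq_sym rho_eq0. Qed.

Lemma rhoZ l x : 0 <= l -> rho (l *: x) = l ^+ d * rho x.
Proof. by move=> l0; rewrite /rho enormZ ger0_norm// exprMn. Qed.

Lemma mu_set0 : mu [set 0] = 0%E.
Proof.
have -> : [set 0] = [set x : E | forall i, (0 : E) ord0 i <= x ord0 i <= (0 : E) ord0 i].
  apply/seteqP; split => x /= => [-> i|H]; first by rewrite mxE lexx.
  by apply/rowP => i; apply/eqP; rewrite eq_sym eq_le; have := H i.
rewrite lebesgue_rV_box//; case: d d0 => // n _.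
by rewrite big_ord_recl subrr mul0r.
Qed.

Definition vball : R := fine (mu [set x | rho x <= 1]).

Lemma measurable_rho_preimage (A : set R) : measurable A -> measurable (@rho @^-1` A).
Proof. exact: (preimage_measurableT measurable_rho). Qed.

Lemma measurable_rho_le (t : R) : measurable [set x : E | rho x <= t].
Proof.
rewrite (_ : [set _ | _] = @rho @^-1` `]-oo, t]%classic).
  exact: measurable_rho_preimage.
by apply/seteqP; split => x /=; rewrite in_itv.
Qed.

Let box (r : R) : set E := [set x | forall i, (const_mx (- r) : E) ord0 i <= x ord0 i <= (const_mx r : E) ord0 i].

Let mu_box r : 0 <= r -> mu (box r) = ((r + r) ^+ d)%:E.
Proof.
move=> r0; rewrite lebesgue_rV_box; last by move=> i; rewrite !mxE; lra.
by under eq_bigr do rewrite !mxE opprK; rewrite prodr_const card_ord.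
Qed.

Let measurable_box r : measurable (box r).
Proof.
rewrite [X in measurable X](_ : _ = \bigcap_(i in [set: 'I_d])
      ((fun x : E => x ord0 i) @^-1` `[- r, r]%classic)); last first.
  apply/seteqP; split => x /=; first by move=> H i _; rewrite /= in_itv/=; have := H i; rewrite !mxE.
  by move=> H i; have := H i I; rewrite /= in_itv !mxE.
apply: fin_bigcap_measurable => // i _.
exact: (preimage_measurableT (measurable_coord i)).
Qed.

(** Finiteness comes from the enclosing cube of half-side 1. *)
Lemma vballE : mu [set x | rho x <= 1] = vball%:E.
Proof.
rewrite /vball fineK// ge0_fin_numE//.
apply: (@le_lt_trans _ _ (mu (box 1))); last by rewrite mu_box// ltry.
apply: le_measure; rewrite ?inE; [exact: measurable_rho_le|exact: measurable_box|].
move=> x /= x1 i; rewrite !mxE -ler_norml (le_trans (ler_enorm _ _))//.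
by rewrite -(@expr_le1 _ d)// enorm_ge0.
Qed.

(** The cube of half-side [1/d] lies in the unit ball, since each of the [d] squares is at most
    [1/d]. *)
Lemma vball_gt0 : 0 < vball.
Proof.
rewrite -lte_fin -vballE; pose r : R := d%:R^-1.
have r0 : 0 < r by rewrite invr_gt0 ltr0n.
apply: (@lt_le_trans _ _ (mu (box r))).
  by rewrite mu_box ?lte_fin ?exprn_gt0 ?addr_gt0// ltW.
apply: le_measure; rewrite ?inE; [exact: measurable_box|exact: measurable_rho_le|].
move=> x /= xr; rewrite /rho exprn_ile1 ?enorm_ge0// -(sqrtr1 R) ler_wsqrtr//.
apply: (@le_trans _ _ (\sum_(i < d) r)).
  apply: ler_sum => i _; have := xr i; rewrite !mxE -ler_norml => xir.
  rewrite -real_normK ?num_real// expr2 (le_trans (ler_pM _ _ xir xir))//.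
  have r1 : r <= 1 by rewrite /r invf_le1 ?ltr0n// ler1n.
  by rewrite ler_piMl// ltW.
by rewrite sumr_const card_ord -mulr_natr mulVf ?pnatr_eq0 -?lt0n// .
Qed.

(** Dilation by [t^(1/d)] reduces to the unit ball; for [t = 0] the set is the origin, which is
    null. *)
Lemma mu_rho_le t : 0 <= t -> mu [set x | rho x <= t] = (vball * t)%:E.
Proof.
rewrite le_eqVlt => /predU1P[<-|t0].
  transitivity (mu [set 0]); last by rewrite mu_set0 mulr0.
  congr (mu _); apply/seteqP; split => x /=.
    by move=> x0; apply/eqP; rewrite -rho_eq0 eq_le x0 rho_ge0.
  by move=> ->; rewrite le_eqVlt rho_eq0 eqxx.
have dR : (d%:R : R) != 0 by rewrite pnatr_eq0 -lt0n.
have tdK : (t `^ d%:R^-1) ^+ d = t.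
  by rewrite -powR_mulrn ?powR_ge0// -powRrM mulVf// powRr1// ltW.
rewrite (lebesgue_rV_scale (powR_gt0 d%:R^-1 t0) (measurable_rho_le t)) tdK.
rewrite mulrC EFinM -vballE; congr (_ * mu _)%E; apply/seteqP.
split => x /=; rewrite rhoZ ?powR_ge0// tdK; last by move=> x1; rewrite ler_piMr// ltW.
by rewrite -ler_pdivlMl// mulVf// gt_eqF.
Qed.

Lemma mu_rho_preimage (A : set R) : measurable A -> A `<=` `[0, +oo[%classic ->
  mu (@rho @^-1` A) = (vball%:E * leb A)%E.
Proof.
move=> mA A0; have c0 := vball_gt0; have cV : 0 <= vball^-1 by rewrite invr_ge0 ltW.
have mrho : measurable_fun setT (rho : E -> measurableTypeR R) by exact: measurable_rho.
pose mN : measurable (`]-oo, 0]%classic : set (measurableTypeR R)) := measurable_itv _.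
(* Uniqueness is available on the whole line while the image of [mu] under [rho] lives on the half
   line; Lebesgue measure on the negative half line is added to fill the gap. *)
pose m : {measure set measurableTypeR R -> \bar R} :=
  measure_add (mscale (NngNum cV) (pushmeas mu mrho)) (mrestr leb mN).
have mX X : m X = ((vball^-1)%:E * mu (@rho @^-1` X) + leb (X `&` `]-oo, 0%R]%classic))%E.
  exact: measure_addE.
have mE : forall X, measurable X -> leb X = m X.
  apply: lebesgue_measure_unique => X [[a b] _ <-]; rewrite mX /=.
  have [ab|ba] := ltP a b; last first.
    by rewrite set_itv_ge ?bnd_simp -?leNgt// preimage_set0 set0I !measure0 mule0 adde0.
  have [a0|a0] := leP 0 a.
    have -> : `]a, b] `&` `]-oo, 0] = set0 :> set R.
      apply/seteqP; split => x //= [] /=; rewrite !in_itv/= => /andP[ax _] x0.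
      by have := lt_le_trans (le_lt_trans a0 ax) x0; rewrite ltxx.
    rewrite measure0 adde0.
    have -> : @rho @^-1` `]a, b] = [set x | rho x <= b] `\` [set x | rho x <= a].
      apply/seteqP; split => x /=; rewrite in_itv/=; first by move=> /andP[ax xb]; split => //; apply/negP; rewrite -ltNge.
      by move=> [xb /negP]; rewrite -ltNge xb => ->.
    have b0 : 0 <= b by rewrite (le_trans a0)// ltW.
    have -> : mu ([set x | rho x <= b] `\` [set x | rho x <= a]) =
        ((vball * b)%:E - (vball * a)%:E)%E.
      have fin : (mu [set x | (rho x <= b)%R] < +oo)%E by rewrite mu_rho_le// ltry.
      rewrite -!mu_rho_le// -[in X in (_ - X)%E](@setIidr _ [set x | rho x <= b] [set x | rho x <= a]).
        by apply: measureD => //; exact: measurable_rho_le.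
      by move=> x /= /le_trans; apply; exact: ltW.
    rewrite lebesgue_measure_itv/= lte_fin ab.
    by rewrite -!EFinB -EFinM -mulrBr mulKf ?gt_eqF.
  have [b0|b0] := leP 0 b.
    have -> : `]a, b] `&` `]-oo, 0] = `]a, 0]%classic :> set R.
      apply/seteqP; split => x /=; rewrite !in_itv/=; first by move=> [/andP[-> _] ->].
      by move=> /andP[-> x0]; rewrite (le_trans x0).
    have -> : @rho @^-1` `]a, b] = [set x | rho x <= b].
      apply/seteqP; split => x /=; rewrite in_itv/=; first by move=> /andP[].
      by move=> ->; rewrite (lt_le_trans a0) ?rho_ge0.
    rewrite [X in (_ * X)%E]mu_rho_le// !lebesgue_measure_itv/= !lte_fin ab a0.
    by rewrite -!EFinB -EFinM -EFinD mulKf ?gt_eqF// sub0r.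
  have -> : `]a, b] `&` `]-oo, 0] = `]a, b]%classic :> set R.
    by apply/setIidl => x /=; rewrite !in_itv/= => /andP[_ /le_trans]; apply; exact: ltW.
  have -> : @rho @^-1` `]a, b] = set0.
    apply/seteqP; split => x //=; rewrite in_itv/= => /andP[_ xb].
    by have := le_lt_trans xb b0; rewrite ltNge rho_ge0.
  by rewrite measure0 mule0 add0e.
have := mE A mA; rewrite mX.
have -> : leb (A `&` `]-oo, 0]) = 0%E.
  apply/eqP; rewrite eq_le measure_ge0 andbT -(lebesgue_measure_set1 (0 : R)).
  apply: le_measure; rewrite ?inE//=; first exact: measurableI.
  move=> x [/A0] /=; rewrite !in_itv/= andbT => x0 x1.
  by apply/eqP; rewrite eq_le x0 x1.
by rewrite adde0 => ->; rewrite muleA -EFinM divff ?gt_eqF// mul1e.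
Qed.

Lemma ge0_integral_rho (D : set R) (w : R -> \bar R) : measurable D ->
  D `<=` `[0, +oo[%classic -> measurable_fun D w -> (forall t, D t -> 0 <= w t)%E ->
  (\int[mu]_(x in @rho @^-1` D) w (rho x) = vball%:E * \int[leb]_(t in D) w t)%E.
Proof.
move=> mD D0 mw w0; have c0 := ltW vball_gt0.
have mrho : measurable_fun setT (rho : E -> measurableTypeR R) by exact: measurable_rho.
rewrite -[vball]/((NngNum c0)%:num) -(ge0_integral_mscale leb mD (NngNum c0) mw)//.
rewrite -(@ge0_integral_pushforward _ _ _ _ _ _ mrho mu D w)//; last first.
  by move=> t; rewrite inE; exact: w0.
apply: (eq_measure_integral (mscale (NngNum c0) leb)) => A mA AD.
exact: (mu_rho_preimage mA (subset_trans AD D0)).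
Qed.

Lemma integral_rho (D : set R) (w : R -> R) : measurable D ->
  D `<=` `[0, +oo[%classic -> leb.-integrable D (EFin \o w) ->
  (\int[mu]_(x in @rho @^-1` D) (w (rho x))%:E = vball%:E * \int[leb]_(t in D) (w t)%:E)%E.
Proof.
move=> mD D0 iw; have c0 := ltW vball_gt0.
rewrite integralE [in RHS]integralE muleBr//; last first.
  by apply: integrable_add_def => //.
have /integrableP[mw _] := iw.
congr (_ - _)%E.
  rewrite -(ge0_integral_rho mD D0)//.
    by apply: eq_integral => x _; rewrite !funeposE.
  exact: measurable_funepos.
rewrite -(ge0_integral_rho mD D0)//.
  by apply: eq_integral => x _; rewrite !funenegE.
exact: measurable_funeneg.
Qed.

End radius.

(** * Cut-off functions and radial test fields *)

Section smooth_order.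
Context {R : realType} {V : normedModType R} {I : Type} (e : I -> V).
Implicit Types (f g : V -> R) (D : set V) (k : R -> R).

(** Truncating at a finite order turns the product and chain rules into inductions on [n];
    localising to [D] admits powers, which are smooth only on the positive half line. The directions
    [e] cover both the basis of the space and, with a single direction 1, the real line. *)
Fixpoint smooth_upto (n : nat) D f : Prop :=
  (forall x, D x -> {for x, continuous f}) /\
  if n is m.+1 then
    (forall i x, D x -> derivable f x (e i)) /\
    (forall i, smooth_upto m D ('D_(e i) f))
  else True.

Lemma smooth_upto_ext n D f g : open D -> (forall x, D x -> f x = g x) ->
  smooth_upto n D f -> smooth_upto n D g.
Proof.
move=> oD; have near_D x : D x -> \forall y \near x, D y.
  by move=> Dx; apply: open_nbhs_nbhs; split.
have cont f' g' : (forall x, D x -> f' x = g' x) ->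
    (forall x, D x -> {for x, continuous f'}) -> forall x, D x -> {for x, continuous g'}.
  move=> fg cf x Dx; rewrite /prop_for /continuous_at -fg//.
  apply: cvg_trans (cf x Dx); apply: near_eq_cvg.
  by near=> y; apply: fg; near: y; exact: near_D.
elim: n f g => [|n ih] f g fg /=; first by move=> [cf _]; split => //; exact: cont cf.
have nfg x : D x -> \forall y \near x, f y = g y.
  by move=> Dx; near=> y; apply: fg; near: y; exact: near_D.
move=> [cf [df sf]]; split; first exact: cont cf.
split=> [i x Dx|i].
  by apply: near_eq_derivable (df i x Dx); exact: nfg.
apply: ih (sf i) => x Dx; apply: near_eq_derive; exact: nfg.
Unshelve. all: by end_near. Qed.

Lemma smooth_uptoW n D f : smooth_upto n.+1 D f -> smooth_upto n D f.
Proof.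
elim: n f => [|n ih] f; first by move=> [].
move=> [cf [df sf]]; split => //; split => // i; exact/ih/sf.
Qed.

Lemma smooth_upto_cst n D (c : R) : smooth_upto n D (cst c).
Proof.
elim: n c => [|n ih] c /=; first by split => // x _; exact: cst_continuous.
split; first by move=> x _; exact: cst_continuous.
split=> // i; rewrite (_ : 'D_(e i) _ = cst 0); first exact: ih.
by apply/funext => x; rewrite derive_cst.
Qed.

Lemma smooth_uptoD n D f g : open D ->
  smooth_upto n D f -> smooth_upto n D g -> smooth_upto n D (f \+ g).
Proof.
move=> oD; elim: n f g => [|n ih] f g.
  move=> [cf _] [cg _]; split => // x Dx; apply: continuousD; [exact: cf|exact: cg].
move=> [cf [df sf]] [cg [dg sg]]; split.
  by move=> x Dx; apply: continuousD; [exact: cf|exact: cg].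
split=> [i x Dx|i]; first by apply: derivableD; [exact: df|exact: dg].
apply: (@smooth_upto_ext _ _ ('D_(e i) f \+ 'D_(e i) g)) => //; last exact: ih _ _ (sf i) (sg i).
by move=> x Dx; rewrite /= -deriveD//; [exact: df|exact: dg].
Qed.

Lemma smooth_uptoM n D f g : open D ->
  smooth_upto n D f -> smooth_upto n D g -> smooth_upto n D (f \* g).
Proof.
move=> oD; elim: n f g => [|n ih] f g.
  move=> [cf _] [cg _]; split => // x Dx; apply: continuousM; [exact: cf|exact: cg].
move=> F G; have [cf [df sf]] := F; have [cg [dg sg]] := G; split.
  by move=> x Dx; apply: continuousM; [exact: cf|exact: cg].
split=> [i x Dx|i]; first by apply: derivableM; [exact: df|exact: dg].
apply: (@smooth_upto_ext _ _ ((f \* 'D_(e i) g) \+ (g \* 'D_(e i) f))) => //.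
  move=> x Dx; rewrite (_ : f \* g = f * g)// deriveM//; [exact: df|exact: dg].
apply: smooth_uptoD => //; apply: ih.
- exact: smooth_uptoW F.
- exact: sg i.
- exact: smooth_uptoW G.
- exact: sf i.
Qed.

Lemma smooth_uptoU n D1 D2 f :
  smooth_upto n D1 f -> smooth_upto n D2 f -> smooth_upto n (D1 `|` D2) f.
Proof.
elim: n f => [|n ih] f.
  by move=> [c1 _] [c2 _]; split => // x [/c1|/c2].
move=> [c1 [d1 s1]] [c2 [d2 s2]]; split; first by move=> x [/c1|/c2].
by split=> [i x [/d1|/d2]|i] //; exact: ih _ (s1 i) (s2 i).
Qed.

End smooth_order.

Section smooth_order1.
Context {R : realType}.
Implicit Types (k : R -> R).

Definition smooth_upto1 : nat -> set R -> (R -> R) -> Prop :=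
  @smooth_upto R R^o unit (fun=> 1).

Context {V : normedModType R}.

(** Only a directional derivative of [f] is at hand, so the one-variable chain rule is applied along
    the line [h] to [f (h *: v + x)]. *)
Lemma is_derive_comp1 (f : V -> R) k (x v : V) : derivable f x v ->
  derivable k (f x) 1 -> is_derive x v (k \o f) ((derive1 k) (f x) * 'D_v f x).
Proof.
move=> df dk.
pose F (h : R) := f (h *: v + x).
have F0 : F 0 = f x by rewrite /F scale0r add0r.
have dF : derivable F 0 1 := iffLR (derivable1P f x v) df.
have dE (g : V -> R) : 'D_v g x = derive1 (fun h : R => g (h *: v + x)) 0.
  rewrite /derive /derive1; set u := (fun _ : R => _); set w := (fun _ : R => _).
  suff -> : u = w by []; apply/funext => h.
  by rewrite /u /w /= addr0 scale0r add0r.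
have dkF : is_derive (0 : R) 1 (k \o F) (derive1 k (F 0) * 'D_1 F 0).
  apply: is_derive1_comp; split.
  - by rewrite F0.
  - by rewrite derive1E.
  - exact: dF.
  - by [].
split; first by apply/derivable1P; have [] := dkF.
rewrite dE derive1E; transitivity ('D_1 (k \o F) 0) => //.
have [_ ->] := dkF; rewrite F0; congr (_ * _).
by rewrite dE derive1E.
Qed.

Lemma smooth_upto_comp (I : Type) (e : I -> V) n (D : set V) (D' : set R) (f : V -> R) k :
  open D -> open D' -> (forall x, D x -> D' (f x)) ->
  smooth_upto e n D f -> smooth_upto1 n D' k -> smooth_upto e n D (k \o f).
Proof.
move=> oD oD' fD; elim: n k => [|n ih] k.
  move=> [cf _] [ck _]; split => // x Dx.
  by apply: continuous_comp; [exact: cf|exact/ck/fD].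
move=> F K; have [cf [df sf]] := F; have [ck [dk sk]] := K; split.
  by move=> x Dx; apply: continuous_comp; [exact: cf|exact/ck/fD].
have isd i x : D x -> is_derive x (e i) (k \o f) ((derive1 k) (f x) * 'D_(e i) f x).
  by move=> Dx; apply: is_derive_comp1; [exact: df|exact: (dk tt _ (fD _ Dx))].
split=> [i x /(isd i)[] //|i].
apply: (@smooth_upto_ext _ _ _ _ _ _ (((derive1 k) \o f) \* 'D_(e i) f)) => //.
  by move=> x Dx; have [_ ->] := isd i _ Dx.
apply: smooth_uptoM => //; last exact: sf i.
apply: ih; first exact: smooth_uptoW F.
rewrite (_ : (derive1 k) = 'D_1 k); first exact: (sk tt).
by apply/funext => x; rewrite derive1E.
Qed.

End smooth_order1.

Section smooth_real.
Context {R : realType}.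
Implicit Types (k : R -> R).

Lemma smooth_upto1_powR n (a : R) : smooth_upto1 n `]0, +oo[ (@powR R ^~ a).
Proof.
have O : open (`]0, +oo[%classic : set R) by exact: interval_open.
have D (b x : R) : 0 < x -> is_derive x 1 (@powR R ^~ b) (b * x `^ (b - 1)).
  exact: is_derive1_powR.
have C (b x : R) : 0 < x -> {for x, continuous (@powR R ^~ b)}.
  move=> x0; apply: differentiable_continuous; apply/derivable1_diffP.
  by have [] := D b x x0.
elim: n a => [|n ih] a.
  by split => // x /=; rewrite in_itv/= andbT => /C.
split; first by move=> x /=; rewrite in_itv/= andbT => /C.
split=> [i x /=|i]; first by rewrite in_itv/= andbT => /(D a)[].
apply: (@smooth_upto_ext _ _ _ _ _ _ (cst a \* (@powR R ^~ (a - 1)))) => //.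
  by move=> x /=; rewrite in_itv/= andbT => /(D a)[_ ->].
by apply: smooth_uptoM => //; [exact: smooth_upto_cst|exact: ih].
Qed.

Lemma smooth_upto1_id n (D : set R) : smooth_upto1 n D id.
Proof.
case: n => [|n]; first by split => // x _; exact: cvg_id.
split; first by move=> x _; exact: cvg_id.
split=> // i; rewrite (_ : 'D_(1 : R^o) (id : R^o -> R) = cst 1); first exact: smooth_upto_cst.
by apply/funext => x; rewrite derive_id.
Qed.

Lemma smooth_upto1_affine n (D : set R) (a b : R) : open D ->
  smooth_upto1 n D (fun t => a * t + b).
Proof.
move=> oD; apply: (@smooth_uptoD _ _ _ _ _ _ (fun t => a * t) (cst b)) => //.
  apply: (@smooth_uptoM _ _ _ _ _ _ (cst a) id) => //.
    exact: smooth_upto_cst.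
  exact: smooth_upto1_id.
exact: smooth_upto_cst.
Qed.

(* Derivatives of [exp (- 1 / t)] are combinations of these functions. *)
Definition flat_exp (n : nat) (t : R) : R :=
  if 0 < t then t^-1 ^+ n * expR (- t^-1) else 0.

(** A single term of the series, [t^-(n+2) / (n+2)! <= exp (1/t)], beats the power in front; a
    quadratic bound is what differentiability at 0 with derivative 0 asks for. *)
Lemma flat_exp_le n t : `|flat_exp n t| <= n.+2`!%:R * t ^+ 2.
Proof.
rewrite /flat_exp; case: ifPn => t0; last by rewrite normr0 mulr_ge0// sqr_ge0.
have tV : 0 < t^-1 by rewrite invr_gt0.
rewrite ger0_norm ?mulr_ge0 ?exprn_ge0 ?expR_ge0 ?(ltW tV)//.
rewrite expRN ler_pdivrMr ?expR_gt0//.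
have f0 : 0 < n.+2`!%:R :> R by rewrite ltr0n fact_gt0.
have := @expR_ge1Dxn R t^-1 n.+1 (ltW tV) => H.
have {}H : t^-1 ^+ n.+2 / n.+2`!%:R <= expR t^-1 by apply: le_trans H; rewrite lerDr.
rewrite ler_pdivrMr// in H.
have -> : t^-1 ^+ n = t^-1 ^+ n.+2 * t ^+ 2.
  by rewrite -addn2 exprD -mulrA -exprMn mulVf ?gt_eqF// expr1n mulr1.
by rewrite [leRHS]mulrAC ler_pM2r ?exprn_gt0// mulrC.
Qed.

Lemma is_derive_0 (f : R -> R) (C : R) : f 0 = 0 ->
  (forall t, `|f t| <= C * t ^+ 2) -> is_derive (0 : R) 1 f 0.
Proof.
move=> f0 fC.
have H : (fun h => h^-1 *: (f (h *: 1 + 0) - f 0)) @ 0^' --> (0 : R).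
  have C0 : 0 <= C by have := fC 1; rewrite expr1n mulr1; apply: le_trans.
  apply/cvgr0Pnorm_le => eps eps0; near=> h.
  rewrite f0 subr0 addr0 normrZ normfV.
  have h0 : h != 0 by near: h; exact: nbhs_dnbhs_neq.
  rewrite ler_pdivrMl ?normr_gt0// [h *: 1]mulr1 (le_trans (fC h))//.
  rewrite -real_normK ?num_real// expr2 mulrCA ler_pM2l ?normr_gt0//.
  rewrite (@le_trans _ _ ((C + 1) * `|h|))// ?ler_wpM2r// ?lerDl//.
  rewrite -ler_pdivlMl ?ltr_wpDl//; apply/ltW.
  near: h; apply: dnbhs0_lt; rewrite mulr_gt0// invr_gt0 ltr_wpDl//.
by split; [apply/cvg_ex; exists 0|apply: cvg_lim].
Unshelve. all: by end_near. Qed.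

Lemma is_derive_flat_exp n (t : R) :
  is_derive t 1 (flat_exp n) (flat_exp n.+2 t - n%:R * flat_exp n.+1 t).
Proof.
have [t0|t0|->] := ltgtP t 0; last 1 first.
- have E0 m : flat_exp m 0 = 0 by rewrite /flat_exp ltxx.
  rewrite !E0 mulr0 subr0; apply: is_derive_0 => //; exact: flat_exp_le.
- have E0 m : flat_exp m t = 0 by rewrite /flat_exp ltNge ltW.
  rewrite !E0 mulr0 subr0.
  apply: (@near_eq_is_derive _ _ _ (cst 0 : R -> R)).
    near=> s; rewrite /flat_exp ifF//; apply/negbTE; rewrite -leNgt ltW//.
    by near: s; exact: lt_nbhsl.
- apply: (@near_eq_is_derive _ _ _ (fun t : R => t^-1 ^+ n * expR (- t^-1))).
    by near=> s; rewrite /flat_exp ifT//; near: s; exact: lt_nbhsr.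
  have tn0 : t != 0 by rewrite gt_eqF.
  have dV : is_derive t 1 (fun t : R => t^-1) (- t ^- 2).
    have := @is_deriveV R id t 1 1 tn0 (is_derive_id _ _).
    by rewrite scaler1.
  have dE : is_derive t 1 (expR \o (fun t : R => - t^-1)) (expR (- t^-1) * t ^- 2).
    apply: is_derive1_comp; rewrite -[t ^- 2]opprK; exact: is_deriveN dV.
  have := is_deriveM (is_deriveX n dV) dE.
  rewrite (_ : _ * _ = (fun t : R => t^-1 ^+ n * expR (- t^-1))); last by apply/funext => s; rewrite !fctE.
  rewrite (_ : _ + _ = flat_exp n.+2 t - n%:R * flat_exp n.+1 t)// /flat_exp t0.
  rewrite /GRing.scale /= fctE.
  (* The truncated predecessor [m.-1] is correct only through the factor [m], hence the separate
     case [m = 0]. *)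
  have key (y z : R) m : z ^+ m * (y * z ^+ 2) + y * (m%:R * z ^+ m.-1 * - z ^+ 2) =
      z ^+ m.+2 * y - m%:R * (z ^+ m.+1 * y).
    case: m => [|m]; first by rewrite mulr0n !mul0r mulr0; ring.
    by rewrite -[m.+1.-1]/m !exprS -natr1; ring.
  by have := key (expR (- t^-1)) t^-1 n; rewrite (exprVn t 2).
Unshelve. all: by end_near. Qed.

Lemma smooth_upto1_flat_exp m n : smooth_upto1 m setT (flat_exp n).
Proof.
have C (k : nat) (x : R) : {for x, continuous (flat_exp k)}.
  apply: differentiable_continuous; apply/derivable1_diffP.
  by have [] := is_derive_flat_exp k x.
elim: m n => [|m ih] n; first by split => // x _; exact: C.
split; first by move=> x _; exact: C.
split=> [i x _|i]; first by have [] := is_derive_flat_exp n x.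
rewrite (_ : 'D_(1 : R^o) (flat_exp n : R^o -> R) = (flat_exp n.+2 \+ (cst (- n%:R) \* flat_exp n.+1))).
  apply: smooth_uptoD; [exact: openT|exact: ih|apply: smooth_uptoM].
  - exact: openT.
  - exact: smooth_upto_cst.
  - exact: ih.
by apply/funext => x; have [_ ->] := is_derive_flat_exp n x; rewrite /= mulNr.
Qed.

(** The usual quotient of [exp (-1/t)] by [exp (-1/t) + exp (-1/(1-t))]. The inverse is written as a
    power and [1 - t] as an affine map so that smoothness follows from the composition lemmas. *)
Definition smooth_step (t : R) : R :=
  flat_exp 0 t * (flat_exp 0 t + flat_exp 0 (- 1 * t + 1)) `^ (- 1).

Lemma flat_exp0_ge0 t : 0 <= flat_exp 0 t.
Proof. by rewrite /flat_exp; case: ifP => // _; rewrite mul1r expR_ge0. Qed.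

Lemma flat_exp0_gt0 t : 0 < t -> 0 < flat_exp 0 t.
Proof. by move=> t0; rewrite /flat_exp t0 mul1r expR_gt0. Qed.

Let den_gt0 t : 0 < flat_exp 0 t + flat_exp 0 (- 1 * t + 1).
Proof.
have [t0|t0] := ltP 0 t; first by rewrite ltr_pwDl ?flat_exp0_gt0 ?flat_exp0_ge0.
by rewrite ltr_wpDl ?flat_exp0_gt0 ?flat_exp0_ge0//; lra.
Qed.

Lemma smooth_step0 t : t <= 0 -> smooth_step t = 0.
Proof. by move=> t0; rewrite /smooth_step /flat_exp ltNge t0 mul0r. Qed.

Lemma smooth_step1 t : 1 <= t -> smooth_step t = 1.
Proof.
move=> t1; have := den_gt0 t; rewrite /smooth_step.
have -> : flat_exp 0 (- 1 * t + 1) = 0.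
  by rewrite /flat_exp ifF//; apply/negbTE; rewrite -leNgt; lra.
by rewrite addr0 => f0; rewrite powR_inv1 ?ltW// mulfV// gt_eqF.
Qed.

Lemma smooth_step_ge0 t : 0 <= smooth_step t.
Proof. by rewrite mulr_ge0 ?flat_exp0_ge0 ?powR_ge0. Qed.

Lemma smooth_step_le1 t : smooth_step t <= 1.
Proof.
rewrite /smooth_step powR_inv1; last exact: ltW (den_gt0 t).
rewrite ler_pdivrMr; last exact: den_gt0.
rewrite mul1r lerDl.
exact: flat_exp0_ge0.
Qed.

Lemma smooth_upto1_step n : smooth_upto1 n setT smooth_step.
Proof.
have oT : open [set: R^o] by exact: openT.
have O : open (`]0, +oo[%classic : set R) by exact: interval_open.
apply: (@smooth_uptoM _ _ _ _ _ _ (flat_exp 0)) => //.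
  exact: smooth_upto1_flat_exp.
apply: (@smooth_upto_comp R R^o unit (fun=> 1) _ _ `]0, +oo[ (fun t => flat_exp 0 t + flat_exp 0 (- 1 * t + 1)) (@powR R ^~ (- 1))) => //.
- by move=> x _; rewrite /= in_itv/= andbT.
- apply: (@smooth_uptoD _ _ _ _ _ _ (flat_exp 0)) => //.
    exact: smooth_upto1_flat_exp.
  apply: (@smooth_upto_comp R R^o unit (fun=> 1) _ _ setT (fun t => - 1 * t + 1) (flat_exp 0)) => //.
  + exact: smooth_upto1_affine.
  + exact: smooth_upto1_flat_exp.
- exact: smooth_upto1_powR.
Qed.

End smooth_real.

Section radial_field.
Context {R : realType} {d : nat}.
Local Notation E := 'rV[R]_d.
Implicit Types (x : E) (k : R -> R).
Hypothesis d0 : (0 < d)%N.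

Definition sqn x : R := \sum_i x ord0 i ^+ 2.

Lemma sqn_ge0 x : 0 <= sqn x. Proof. by apply: sumr_ge0 => i _; exact: sqr_ge0. Qed.

Lemma sqn_gt0 x : (0 < sqn x) = (x != 0).
Proof.
rewrite -enorm_eq0 /enorm -/(sqn x) lt_neqAle sqn_ge0 andbT eq_sym.
by rewrite sqrtr_eq0 eq_le sqn_ge0 andbT.
Qed.

Lemma rho_sqn x : rho x = sqn x `^ (d%:R / 2).
Proof.
rewrite /rho /enorm -/(sqn x) -powR12_sqrt ?sqn_ge0// -powR_mulrn ?powR_ge0//.
by rewrite -powRrM mulrC.
Qed.

Lemma is_derive_coord x v i : is_derive x v (fun y : E => y ord0 i : R) (v ord0 i).
Proof.
have H : (fun h : R => h^-1 *: ((h *: v + x) ord0 i - x ord0 i)) @ 0^' --> v ord0 i.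
  apply: cvg_near_cst; near=> h.
  have h0 : h != 0 by near: h; exact: nbhs_dnbhs_neq.
  by rewrite !mxE addrK /GRing.scale /= mulKf.
by split; [apply/cvg_ex; exists (v ord0 i)|exact: cvg_lim].
Unshelve. all: by end_near. Qed.

Lemma smooth_upto_coord n (D : set E) i :
  smooth_upto (@basis_vec R d) n D (fun x => x ord0 i).
Proof.
case: n => [|n]; first by split => // x _; exact: coord_continuous.
split; first by move=> x _; exact: coord_continuous.
split=> [j x _|j]; first by have [] := is_derive_coord x (basis_vec j) i.
rewrite (_ : 'D__ _ = cst ((basis_vec j : E) ord0 i)); first exact: smooth_upto_cst.
by apply/funext => x; have [_ ->] := is_derive_coord x (basis_vec j) i.
Qed.

Lemma smooth_upto_sqn n (D : set E) : open D -> smooth_upto (@basis_vec R d) n D sqn.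
Proof.
move=> oD; rewrite /sqn.
elim: (index_enum _) => [|i s ih].
  rewrite (_ : (fun _ => _) = cst 0); first exact: smooth_upto_cst.
  by apply/funext => x; rewrite big_nil.
rewrite (_ : (fun _ => _) = (fun x : E => x ord0 i) \* (fun x : E => x ord0 i) \+
    (fun x : E => \sum_(i <- s) x ord0 i ^+ 2)); last first.
  by apply/funext => x; rewrite big_cons expr2.
apply: smooth_uptoD => //; apply: smooth_uptoM => //; exact: smooth_upto_coord.
Qed.

Lemma is_derive_sqn x i : is_derive x (basis_vec i) (sqn : E -> R) (2 * x ord0 i).
Proof.
rewrite (_ : sqn = \sum_j (fun y : E => y ord0 j : R) ^+ 2); last first.
  by apply/funext => y; rewrite /sqn fct_sumE; apply: eq_bigr => j _; rewrite fctE.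
rewrite (_ : 2 * x ord0 i = \sum_j (2%:R * x ord0 j ^+ 1) *: (basis_vec i : E) ord0 j).
  apply: is_derive_sum => j.
  by have := is_deriveX 2 (is_derive_coord x (basis_vec i) j).
rewrite (bigD1 i)//= big1 ?addr0 => [|j ji].
  by rewrite /basis_vec mxE !eqxx /GRing.scale /= mulr1 expr1.
by rewrite /basis_vec mxE (negbTE ji) andbF /GRing.scale /= mulr0.
Qed.

(* [rho x] is a power of [sqn x], which unlike [enorm] is smooth at every point. *)
Definition profile k (s : R) : R := k (s `^ (d%:R / 2)) * s `^ (- (d%:R / 2)).

Definition radial_field k (i : 'I_d) x : R := x ord0 i * profile k (sqn x).

Lemma radial_fieldE k i x : radial_field k i x = x ord0 i * (k (rho x) / rho x).
Proof. by rewrite /radial_field /profile -rho_sqn powRN -rho_sqn. Qed.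

Lemma smooth_upto1_profile n k : smooth_upto1 n setT k -> smooth_upto1 n `]0, +oo[ (profile k).
Proof.
move=> sk.
have O : open (`]0, +oo[%classic : set R) by exact: interval_open.
apply: smooth_uptoM => //; last exact: smooth_upto1_powR.
apply: (@smooth_upto_comp R R^o unit (fun=> 1) _ _ setT (@powR R ^~ (d%:R / 2)) k) => //.
- exact: openT.
- exact: smooth_upto1_powR.
Qed.

Lemma is_derive_profile k (s : R) : 0 < s -> derivable k (s `^ (d%:R / 2)) 1 ->
  is_derive s 1 (profile k)
   ((d%:R / 2) * (derive1 k (s `^ (d%:R / 2)) - k (s `^ (d%:R / 2)) / s `^ (d%:R / 2)) / s).
Proof.
move=> s0 dk; pose e : R := d%:R / 2; rewrite -/e in dk *.
have d1 : is_derive s 1 (k \o (@powR R ^~ e)) (derive1 k (s `^ e) * (e * s `^ (e - 1))).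
  have dk' : is_derive (s `^ e) 1 k (derive1 k (s `^ e)) by split => //; rewrite derive1E.
  have dp : is_derive s 1 (@powR R ^~ e) (e * s `^ (e - 1)) := is_derive1_powR e s0.
  exact: (@is_derive1_comp R k (@powR R ^~ e) s _ _ dk' dp).
have := is_deriveM d1 (is_derive1_powR (- e) s0).
rewrite (_ : _ * _ = profile k); last by apply/funext => y; rewrite fctE.
rewrite (_ : _ + _ = e * (derive1 k (s `^ e) - k (s `^ e) / s `^ e) / s)//.
have P (b : R) : s `^ (b - 1) = s `^ b / s.
  rewrite powRD; last by rewrite (gt_eqF s0) implybT.
  by rewrite powR_inv1// ltW.
rewrite /GRing.scale /= !P powRN.
have se : s `^ e != 0 by rewrite gt_eqF// powR_gt0.
by field; rewrite se gt_eqF.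
Qed.

(** Off the origin [x / rho x] is divergence free, and [rho] is homogeneous of degree [d], so the
    derivative of [rho] in direction [x] is [d] times [rho]: only the derivative of [k] survives. *)
Lemma divergence_radial_field k x : x != 0 -> smooth_upto1 1 setT k ->
  \sum_i 'D_(basis_vec i) (radial_field k i) x = d%:R * derive1 k (rho x).
Proof.
move=> x0 [_ [dk _]].
have Q0 : 0 < sqn x by rewrite sqn_gt0.
have dkx : derivable k (sqn x `^ (d%:R / 2)) 1 by apply: (dk tt).
have [dW WE] := is_derive_profile Q0 dkx.
have dWQ i : is_derive x (basis_vec i) (profile k \o sqn)
    (derive1 (profile k) (sqn x) * (2 * x ord0 i)).
  have [dQ QE] := is_derive_sqn x i.
  by rewrite -QE; apply: is_derive_comp1.
have dF i : 'D_(basis_vec i) (radial_field k i) x =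
   profile k (sqn x) + 2 * derive1 (profile k) (sqn x) * x ord0 i ^+ 2.
  have [_] := is_deriveM (is_derive_coord x (basis_vec i) i) (dWQ i).
  rewrite (_ : _ * _ = radial_field k i); last by apply/funext => y; rewrite fctE.
  move=> ->; rewrite /basis_vec mxE !eqxx /GRing.scale /=; ring.
under eq_bigr do rewrite dF.
rewrite big_split/= sumr_const card_ord -mulr_sumr -/(sqn x).
rewrite derive1E WE -rho_sqn /profile powRN -rho_sqn -mulr_natl.
have r0 : rho x != 0 by rewrite gt_eqF// rho_gt0.
by field; rewrite r0 gt_eqF.
Qed.

Lemma continuous_rho : continuous (rho : E -> R).
Proof.
have cQ : continuous (sqn : E -> R).
  by move=> x; have [c _] := @smooth_upto_sqn 0 setT openT; exact: c.
have cE : continuous (enorm : E -> R).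
  by move=> x; apply: (@continuous_comp _ _ _ sqn Num.sqrt); [exact: cQ|exact: sqrt_continuous].
by move=> x; apply: (@continuous_comp _ _ _ enorm (fun r => r ^+ d)); [exact: cE|exact: exprn_continuous].
Qed.

Lemma smooth_upto_radial_field n k (a : R) i : 0 < a -> (forall t, t <= a -> k t = 0) ->
  smooth_upto1 n setT k -> smooth_upto (@basis_vec R d) n setT (radial_field k i).
Proof.
move=> a0 ka sk.
have O : open (`]0, +oo[%classic : set R) by exact: interval_open.
have o1 : open [set x : E | 0 < sqn x].
  rewrite (_ : [set _ | _] = sqn @^-1` `]0, +oo[); last first.
    by apply/seteqP; split => x /=; rewrite in_itv/= andbT.
  apply: open_comp; last exact: interval_open.
  by move=> x _; have [c _] := @smooth_upto_sqn 0 setT openT; exact: c.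
have o2 : open [set x : E | rho x < a].
  rewrite (_ : [set _ | _] = (@rho R d) @^-1` `]-oo, a[); last first.
    by apply/seteqP; split => x /=; rewrite in_itv/=.
  by apply: open_comp; [move=> x _; exact: continuous_rho|exact: interval_open].
(* [profile k] is handled only at positive arguments; near the origin the field vanishes because [k]
   does below [a]. *)
have -> : [set: E] = [set x | 0 < sqn x] `|` [set x | rho x < a].
  apply/seteqP; split => // x _ /=.
  have [->|x0] := eqVneq x 0; last by left; rewrite sqn_gt0.
  by right; rewrite (_ : rho 0 = 0)//; apply/eqP; rewrite rho_eq0.
apply: smooth_uptoU.
  apply: smooth_uptoM => //; first exact: smooth_upto_coord.
  apply: (@smooth_upto_comp R E 'I_d (@basis_vec R d) n _ `]0, +oo[ sqn (profile k)) => //.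
  - by move=> x /=; rewrite in_itv/= andbT.
  - exact: smooth_upto_sqn.
  - exact: smooth_upto1_profile.
apply: (@smooth_upto_ext _ _ _ _ _ _ (cst 0)) => //; last exact: smooth_upto_cst.
by move=> x /= xa; rewrite radial_fieldE ka ?mul0r ?mulr0// ltW.
Qed.

Lemma smooth_upto_iter_partial s n D (phi : E -> R) :
  smooth_upto (@basis_vec R d) (size s + n) D phi ->
  smooth_upto (@basis_vec R d) n D (iter_partial s phi).
Proof.
elim/last_ind: s phi => [//|s i ih] phi; rewrite size_rcons addSn => -[_ [_ sphi]].
by rewrite /iter_partial foldr_rcons; apply: ih; exact: sphi i.
Qed.

Lemma smooth_upto_smooth (phi : E -> R) :
  (forall n, smooth_upto (@basis_vec R d) n setT phi) -> smooth phi.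
Proof.
move=> sphi s; have [c [df _]] := smooth_upto_iter_partial (sphi (size s + 1)%N).
by split=> [x|i x]; [exact: c|exact: df].
Qed.

Lemma compact_annulus (a b : R) : compact [set x : E | a <= rho x <= b].
Proof.
apply: bounded_closed_compact; last first.
  rewrite (_ : [set _ | _] = (@rho R d) @^-1` `[a, b]); last first.
    by apply/seteqP; split => x /=; rewrite in_itv/=.
  apply: preimage_closed; first by move=> x _; exact: continuous_rho.
  exact: itv_closed.
exists (1 + `|b|); split; first exact: num_real.
move=> M bM x /= /andP[_ xb].
have xM : enorm x <= M.
  (* A radius above 1 is at most its [d]-th power, so a radius above [1 + |b|] already forces
     [rho x > b]. *)
  apply: le_trans (ltW bM); rewrite leNgt; apply/negP => b1.
  suff : b < rho x by rewrite ltNge xb.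
  rewrite (@lt_le_trans _ _ (1 + `|b|))//; first by rewrite ltr_pwDl// ler_norm.
  rewrite (le_trans (ltW b1))// ler_eXnr//.
  by rewrite (le_trans _ (ltW b1))// lerDl.
change (mx_norm x <= M).
have [->|/mx_norm_neq0[[i j] /= ->]] := eqVneq (mx_norm x) 0.
  by rewrite (le_trans _ xM)// enorm_ge0.
by rewrite (ord1 i) (le_trans _ xM)// ler_enorm.
Qed.

Lemma test_function_radial_field k (a b : R) i : 0 < a ->
  (forall t, t <= a -> k t = 0) -> (forall t, b <= t -> k t = 0) ->
  (forall n, smooth_upto1 n setT k) ->
  test_function (punctured d) (radial_field k i).
Proof.
move=> a0 ka kb sk.
have S : closure [set x | radial_field k i x != 0] `<=` [set x : E | a <= rho x <= b].
  have cl : closed [set x : E | a <= rho x <= b].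
    by apply: compact_closed; [exact: norm_hausdorff|exact: compact_annulus].
  rewrite [X in _ `<=` X]((closure_id _).1 cl).
  apply: closureS => x /=; apply: contra_neqP => /negP.
  rewrite negb_and -!ltNge radial_fieldE => /orP[/ltW/ka ->|/ltW/kb ->];
    by rewrite mul0r mulr0.
split.
- apply: smooth_upto_smooth => n; exact: (smooth_upto_radial_field _ a0).
- apply: subclosed_compact S; [exact: closed_closure|exact: compact_annulus].
- by apply: subset_trans S _ => x /= /andP[ax _]; rewrite /punctured /= -rho_gt0// (lt_le_trans a0).
Qed.

End radial_field.

(** * Oscillation of the radial profile *)

Section radial_profile.
Context {R : realType} {d : nat}.
Local Notation E := 'rV[R]_d.
Local Notation mu := (@lebesgue_rV R d).
Local Notation leb := (@lebesgue_measure R).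
Hypothesis d0 : (0 < d)%N.

Lemma continuous_measurable_rV (f : E -> R) : continuous f -> measurable_fun setT f.
Proof.
move=> cf; apply: (measurability _ (measurable_realfun.RGenOpens.measurableE R)) => _ [_ [a [b ->]] <-].
rewrite setTI; apply: sub_sigma_algebra => /=.
by move/continuousP : cf; apply; exact: interval_open.
Qed.

Lemma measurable_punctured : measurable (punctured d : set E).
Proof.
rewrite (_ : punctured d = (@rho R d) @^-1` `]0, +oo[).
  exact: (preimage_measurableT measurable_rho).
by apply/seteqP; split => x /=; rewrite in_itv/= andbT /punctured/= rho_gt0.
Qed.

Lemma punctured_ae (P : E -> Prop) : {ae mu, forall x, punctured d x -> P x} -> {ae mu, forall x, P x}.
Proof.
move=> aeP; have ae0 : {ae mu, forall x : E, x != 0}.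
  exists [set 0]; split; last by move=> x /= /negP/negPn/eqP.
    rewrite (_ : [set 0] = ~` punctured d).
      by apply: measurableC; exact: measurable_punctured.
    apply/seteqP; split => x /=; first by move=> ->; rewrite /punctured /= eqxx.
    by move/negP/negPn/eqP.
  exact: mu_set0.
by apply: filterS2 aeP ae0 => x; exact.
Qed.

(** [radial] supplies a function with no measurability, so the profile is read off [u] along one
    ray. A badly chosen ray could meet the exceptional null set in too many points; Tonelli provides
    one that meets it only at a null set of radii, and such radii fill a null set of the space. *)
Lemma radial_profile (u : E -> R) : measurable_fun (punctured d) u -> radial u ->
  exists F : R -> R, measurable_fun setT F /\ {ae mu, forall x, u x = F (rho x)}.
Proof.
move=> mu_ [f [N [mN N0 fN]]].
have dR : (d%:R : R) != 0 by rewrite pnatr_eq0 -lt0n.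
have rootK (t : R) : 0 <= t -> (t `^ d%:R^-1) ^+ d = t.
  by move=> t0; rewrite -powR_mulrn ?powR_ge0// -powRrM mulVf// powRr1.
pose v : E -> R := u \_ (punctured d).
have mv : measurable_fun setT v.
  exact: (iffLR (measurable_restrictT _ measurable_punctured)).
(* Pairs [(t, x)] whose dilate [t^(1/d) x] falls in [N]. Every [t]-section is a dilate of [N], hence
   null, so almost every [x]-section is null. *)
pose S : set (measurableTypeR R * E) := [set z | 0 < z.1 /\ N (z.1 `^ d%:R^-1 *: z.2)].
have mS : measurable S.
  rewrite (_ : S = (fst @^-1` `]0, +oo[) `&` ((fun z => z.1 `^ d%:R^-1 *: z.2) @^-1` N)); last first.
    by apply/seteqP; split => z /=; rewrite in_itv/= andbT.
  apply: measurableI.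
    by apply: (preimage_measurableT measurable_fst); exact: measurable_itv.
  apply: preimage_measurableT mN.
  apply: measurable_fun_coordP => i.
  under eq_fun do rewrite mxE.
  apply: measurable_funM.
    exact: (measurableT_comp (measurable_powR _) measurable_fst).
  exact: (measurableT_comp (measurable_coord i) measurable_snd).
have xS (t : R) : mu (xsection S t) = 0%E.
  have [t0|t0] := ltP 0 t; last first.
    rewrite (_ : xsection S t = set0) ?measure0//.
    by apply/seteqP; split => x //=; rewrite /xsection/= inE/= => -[]; rewrite ltNge t0.
  rewrite (_ : xsection S t = [set x | N (t `^ d%:R^-1 *: x)]); last first.
    by apply/seteqP; split => x /=; rewrite /xsection/= inE/= => // -[].
  have := lebesgue_rV_scale (powR_gt0 d%:R^-1 t0) mN.
  rewrite rootK ?ltW// [LHS]N0 => /esym/eqP; rewrite mule_eq0 eqe gt_eqF//=.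
  by move=> /eqP.
have : (\int[mu]_x leb (ysection S x) = 0)%E.
  transitivity (\int[mu]_x fubini_G leb (EFin \o (\1_S : _ -> R)) x)%E.
    by rewrite (indic_fubini_tonelli_GE leb mS).
  rewrite -(indic_fubini_tonelli leb mu mS) (indic_fubini_tonelli_FE mu mS).
  by apply: integral0_eq => t _ /=; exact: xS.
move=> I0.
have aeS : {ae mu, forall x, leb (ysection S x) = 0%E}.
  have := @ae_eq_integral_abs _ _ _ mu setT measurableT (fun x => leb (ysection S x))
     (measurable_fun_ysection leb mS).
  move=> [+ _]; under eq_integral do rewrite gee0_abs//.
  by move=> /(_ I0); apply: filterS => x; apply.
(* Otherwise the whole space would be null, against the positive volume of the unit ball. *)
have [x0 x00 Sx0] : exists2 x0 : E, x0 != 0 & leb (ysection S x0) = 0%E.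
  apply: contrapT => nex.
  have : {ae mu, forall x : E, False}.
    apply: punctured_ae; apply: filterS aeS => x Sx x0; apply: nex; exists x => //.
  move=> [A [mA A0 TA]].
  have B0 : mu [set x : E | rho x <= 1] = 0%E.
    apply: (subset_measure0 _ mA _ A0) => //; first exact: measurable_rho_le.
    by move=> x _; apply: TA => /=.
  have /eqP := etrans (esym B0) (vballE d0).
  by rewrite eqe eq_sym gt_eqF// vball_gt0.
have r0 : 0 < rho x0 by rewrite rho_gt0.
(* Parametrised so that [rho (ray t) = t]. *)
pose ray (t : R) : E := (t / rho x0) `^ d%:R^-1 *: x0.
have rho_ray t : 0 < t -> rho (ray t) = t.
  move=> t0; rewrite /ray rhoZ ?powR_ge0// rootK; last by rewrite divr_ge0 ?ltW.
  by rewrite divfK ?gt_eqF.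
have mray : measurable_fun setT ray.
  apply: measurable_fun_coordP => i; rewrite /ray.
  under eq_fun do rewrite mxE.
  apply: measurable_funM => //.
  apply: (measurableT_comp (measurable_powR _)).
  exact: measurable_funM.
exists (v \o ray); split; first exact: measurableT_comp.
pose Z := [set t : R | ysection S x0 ((rho x0)^-1 * t)].
have mZ : measurable Z.
  apply: (@preimage_measurableT _ _ _ _ (fun t : R => (rho x0)^-1 * t : measurableTypeR R)).
    exact: measurable_funM.
  exact: measurable_ysection.
have Z0 : leb Z = 0%E.
  have rV : 0 < (rho x0)^-1 by rewrite invr_gt0.
  have := lebesgue_measure_scale rV (measurable_ysection x0 mS).
  rewrite [LHS]Sx0 => /esym/eqP; rewrite mule_eq0 eqe (gt_eqF rV)/=.
  by move=> /eqP.
have Zpos t : Z t -> 0 < t.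
  by rewrite /Z /ysection /= inE /= => -[]; rewrite pmulr_rgt0// invr_gt0.
have aeZ : {ae mu, forall x, ~ Z (rho x)}.
  exists (@rho R d @^-1` Z); split; first exact: measurable_rho_preimage.
    rewrite [LHS](mu_rho_preimage d0 mZ) ?Z0 ?mule0// => t /Zpos.
    by rewrite /= in_itv/= andbT => /ltW.
  by move=> x /= /contrapT.
apply: punctured_ae.
have aeN : {ae mu, forall x, ~ N x} by exists N; split => // x /= /contrapT.
apply: filterS2 aeZ aeN => y Zy Ny y0.
have ry : 0 < rho y by rewrite rho_gt0.
have nz : ray (rho y) != 0 by rewrite -rho_gt0// rho_ray.
have Nr : ~ N (ray (rho y)).
  move=> Nry; apply: Zy; rewrite /Z /ysection /= inE /S /= pmulr_rgt0 ?invr_gt0//.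
  by split=> //; rewrite mulrC.
rewrite /= /v patchE mem_set//.
have uf x : ~ N x -> u x = f (enorm x).
  by move=> Nx; apply: contrapT => /fN.
rewrite (uf _ Ny) (uf _ Nr); congr f.
have := rho_ray _ ry; rewrite /rho => /eqP.
by rewrite eqrXn2 ?enorm_ge0// => /eqP.
Qed.

End radial_profile.

Opaque smooth_step.

(** * Bumps and averages at Lebesgue points *)

Section step_average.
Context {R : realType}.
Local Notation leb := (@lebesgue_measure R).
Local Notation step := (@smooth_step R).
Implicit Types (w : R -> R).

Lemma derivable_step t : derivable step t 1.
Proof. by have [_ [ds _]] := @smooth_upto1_step R 1; exact: (ds tt). Qed.

Lemma continuous_step' : continuous (derive1 step).
Proof.
have [_ [_ ds]] := @smooth_upto1_step R 1; have [c _] := ds tt.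
rewrite (_ : derive1 step = 'D_1 step); first by move=> x; exact: c.
by apply/funext => x; rewrite derive1E.
Qed.

(** The step attains its minimum at every [t <= 0] and its maximum at every [t >= 1], so the
    derivative vanishes by Fermat's rule, endpoints included. *)
Lemma step'_eq0 t : (t <= 0) || (1 <= t) -> derive1 step t = 0.
Proof.
have tt1 : t - 1 <= t + 1 by lra.
have tI : t \in `](t - 1), (t + 1)[ by rewrite in_itv/=; apply/andP; split; lra.
have dI s : s \in `](t - 1), (t + 1)[ -> derivable step s 1 by move=> _; exact: derivable_step.
move=> t01; rewrite derive1E; suff : is_derive t 1 step 0 by case.
case/orP: t01 => t01.
  apply: (derive1_at_min tt1 dI tI) => s _.
  by rewrite (smooth_step0 t01); exact: smooth_step_ge0.
apply: (derive1_at_max tt1 dI tI) => s _.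
by rewrite (smooth_step1 t01); exact: smooth_step_le1.
Qed.

Lemma step'_bounded : exists2 B, 0 < B & forall t, `|derive1 step t| <= B.
Proof.
have c : {within `[0, 1]%classic, continuous (fun t => `|derive1 step t|)}.
  apply: continuous_subspaceT => x; apply: continuous_comp; first exact: continuous_step'.
  exact: norm_continuous.
have [t0 _ tmax] := EVT_max (@ler01 R) c.
exists (`|derive1 step t0| + 1) => [|t]; first by rewrite ltr_wpDl.
have [t01|] := boolP (t \in `[0, 1]).
  by rewrite (le_trans (tmax _ t01))// lerDl.
rewrite in_itv/= negb_and -!ltNge => H.
have H' : (t <= 0) || (1 <= t) by case/orP: H => /ltW ->; rewrite ?orbT.
by rewrite (step'_eq0 H') normr0 addr_ge0.
Qed.

Lemma is_derive_step_scaled (r s c t : R) :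
  is_derive t 1 (fun y => step ((y - s) / r + c)) (r^-1 * derive1 step ((t - s) / r + c)).
Proof.
have da : is_derive t 1 (fun y : R => (y - s) / r + c) r^-1.
  rewrite (_ : (fun _ => _) = (r^-1 \*: id) + cst (c - s / r)); last first.
    apply/funext => y; rewrite [X in _ = X](_ : _ = r^-1 * y + (c - s / r))//; ring.
  rewrite -[X in is_derive _ _ _ X]addr0 -[X in X + 0]mulr1.
  exact: (is_deriveD (is_deriveZ r^-1 (is_derive_id t 1)) (is_derive_cst (c - s / r) t 1)).
have ds : is_derive ((t - s) / r + c) 1 step (derive1 step ((t - s) / r + c)).
  by split; [exact: derivable_step|rewrite derive1E].
have := @is_derive1_comp R step (fun y : R => (y - s) / r + c) t _ _ ds da.
by rewrite mulrC.
Qed.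

(* For [c = 0] the mass sits just after [s], for [c = 1] just before. *)
Definition bump (r s c y : R) : R := r^-1 * derive1 step ((y - s) / r + c).

Lemma derive1_sub (f1 f2 : R -> R) (x a b : R) : is_derive x 1 f1 a -> is_derive x 1 f2 b ->
  derive1 (fun z => f1 z - f2 z) x = a - b.
Proof.
move=> [d1 <-] [d2 <-]; rewrite derive1E -deriveB//.
Qed.

Lemma derive1_step_diff (r s t y : R) :
  derive1 (fun z => step ((z - s) / r + 0) - step ((z - t) / r + 1)) y =
  bump r s 0 y - bump r t 1 y.
Proof.
exact: (derive1_sub (is_derive_step_scaled r s 0 y) (is_derive_step_scaled r t 1 y)).
Qed.

Lemma continuous_bump r s c : continuous (bump r s c).
Proof.
move=> y; rewrite /bump; apply: cvgM; first exact: cvg_cst.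
apply: (@continuous_comp _ _ _ (fun y : R => (y - s) / r + c) (derive1 step)); last exact: continuous_step'.
apply: cvgD; last exact: cvg_cst.
apply: cvgM; last exact: cvg_cst.
by apply: cvgB; [exact: cvg_id|exact: cvg_cst].
Qed.

Lemma bump_eq0 (r s c y : R) : 0 < r -> (c == 0) || (c == 1) -> ~~ (s - r < y < s + r) -> bump r s c y = 0.
Proof.
move=> r0 c01 H; rewrite /bump step'_eq0 ?mulr0//.
move: H; rewrite negb_and -!leNgt => /orP[H|H].
  have : (y - s) / r <= -1 by rewrite ler_pdivrMr//; lra.
  by case/orP: c01 => /eqP -> ?; apply/orP; left; lra.
have : 1 <= (y - s) / r by rewrite ler_pdivlMr//; lra.
by case/orP: c01 => /eqP -> ?; apply/orP; right; lra.
Qed.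

Lemma integral_bump (r s c : R) : 0 < r -> (c == 0) || (c == 1) ->
  (\int[leb]_(y in `[(s - r)%R, (s + r)%R]) (bump r s c y)%:E = 1)%E.
Proof.
move=> r0 c01.
have sr : s - r < s + r by lra.
rewrite (@continuous_FTC2 R _ (fun y => step ((y - s) / r + c)))//.
- rewrite (_ : (s + r - s) / r = 1); last by field; rewrite gt_eqF.
  rewrite (_ : (s - r - s) / r = -1); last by field; rewrite gt_eqF.
  rewrite -EFinB; congr EFin.
  by case/orP: c01 => /eqP ->; rewrite smooth_step1 ?smooth_step0 ?subr0//; lra.
- by apply: continuous_subspaceT; exact: continuous_bump.
- have D y := is_derive_step_scaled r s c y.
  have C : continuous (fun y : R => step ((y - s) / r + c)).
    move=> y; apply: differentiable_continuous; apply/derivable1_diffP.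
    by have [] := D y.
  split.
  + by move=> y _; have [] := D y.
  + by apply: cvg_at_right_filter; exact: C.
  + by apply: cvg_at_left_filter; exact: C.
- by move=> y _; rewrite derive1E; have [_ ->] := is_derive_step_scaled r s c y.
Qed.

(** The bump has integral 1, so the difference is the integral of [(w y - w s)] against it; the bump
    is at most [B / r] on a ball of length [2 r], which leaves [2 B] times the mean deviation. *)
Lemma bump_average_le w (B r s c : R) (D : set R) : (forall t, `|derive1 step t| <= B) ->
  (c == 0) || (c == 1) -> 0 < r -> measurable D -> leb.-integrable D (EFin \o w) ->
  `[s - r, s + r]%classic `<=` D ->
  (`|Rintegral leb D (fun y => w y * bump r s c y) - w s|%:E <= (2 * B)%:E * davg w s r)%E.
Proof.
move=> stepB c01 r0 mD iw rD; pose Bl : set R := ball s r.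
have mBl : measurable Bl by exact: measurable_ball.
have BlE : Bl = `]s - r, s + r[%classic by rewrite /Bl ball_itv.
have BlD : Bl `<=` D.
  by apply: subset_trans rD; rewrite BlE; exact: subset_itv_oo_cc.
have nBl y : ~ Bl y -> bump r s c y = 0.
  by rewrite BlE /= in_itv/= => /negP; exact: bump_eq0.
have muBl : (leb Bl < +oo)%E by rewrite lebesgue_measure_ball ?ltry// ltW.
have bB y : `|bump r s c y| <= B / r.
  by rewrite /bump normrM gtr0_norm ?invr_gt0// mulrC ler_wpM2r// invr_ge0 ltW.
have mb (D' : set R) : measurable_fun D' (bump r s c).
  by apply: measurable_funTS; apply: continuous_measurable_fun; exact: continuous_bump.
have bb : [bounded bump r s c y | y in Bl].
  by exists (B / r); split; [exact: num_real|move=> x /ltW Bx y _; exact: le_trans (bB y) Bx].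
have iwB : leb.-integrable Bl (EFin \o w) by exact: integrableS iw.
have i1 : leb.-integrable Bl (EFin \o (fun y => w y * bump r s c y)).
  have := @integrableMl _ _ _ leb Bl mBl _ _ iwB (mb _) bb.
  by apply: eq_integrable.
have ib : leb.-integrable Bl (EFin \o bump r s c).
  exact: (@measurable_bounded_integrable _ _ _ leb (bump r s c) Bl mBl muBl (mb _) bb).
have i2 : leb.-integrable Bl (EFin \o (fun y => w s * bump r s c y)).
  have := @integrableZl _ _ _ leb Bl mBl (w s) _ ib.
  by apply: eq_integrable.
have E1 : Rintegral leb D (fun y => w y * bump r s c y) =
          Rintegral leb Bl (fun y => w y * bump r s c y).
  rewrite Rintegral_mkcond [in RHS]Rintegral_mkcond; congr Rintegral; apply/funext => y.
  rewrite !patchE; case: ifPn => yD; case: ifPn => yB //.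
    by rewrite nBl ?mulr0// => yBl; move/negP: yB; apply; rewrite inE.
  by exfalso; move/negP: yD; apply; move: yB; rewrite !inE; exact: BlD.
have E2 : w s = Rintegral leb Bl (fun y => w s * bump r s c y).
  rewrite RintegralZl// (_ : Rintegral _ _ _ = 1) ?mulr1//.
  rewrite /Rintegral -[RHS]/(fine 1%:E) -(integral_bump s r0 c01); congr fine.
  rewrite integral_mkcond [in RHS]integral_mkcond; apply: eq_integral => y _.
  rewrite !patchE; case: ifPn => yB; case: ifPn => // yI.
    by exfalso; move/negP: yI; apply; move: yB; rewrite !inE BlE; exact: subset_itv_oo_cc.
  by rewrite nBl// => yBl; move/negP: yB; apply; rewrite inE.
rewrite [in X in (_ - X)%R]E2 E1 -RintegralB//.
have i3 : leb.-integrable Bl (fun y => ((w y - w s) * bump r s c y)%:E).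
  have := @integrableB _ _ _ leb Bl mBl _ _ i1 i2.
  by apply: eq_integrable => // y _; rewrite /= -EFinB mulrBl.
rewrite (_ : Rintegral _ _ _ = fine (\int[leb]_(y in Bl) ((w y - w s) * bump r s c y)%:E)%E); last first.
  by congr fine; apply: eq_integral => y _; rewrite mulrBl.
rewrite -fine_abse ?integrable_fin_num// fineK; last first.
  by rewrite abse_fin_num integrable_fin_num.
have mi3 := measurable_int leb i3.
apply: (le_trans (@le_abse_integral _ _ _ leb Bl _ mBl mi3)).
have mw : measurable_fun Bl (fun y => `|(w y - w s)%:E|%E).
  apply: measurableT_comp => //; apply/measurable_EFinP; apply: measurable_funB => //.
  by have /measurable_EFinP := measurable_int leb iwB.
apply: (@le_trans _ _ (\int[leb]_(y in Bl) ((B / r)%:E * `|(w y - w s)%:E|))%E).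
  apply: (@ge0_le_integral _ _ _ leb Bl mBl) => //.
  - exact: measurableT_comp.
  - exact: measurable_funeM.
  - move=> y _; rewrite -EFinM lee_fin normrM mulrC ler_wpM2r//.
have B0 : 0 <= B / r by apply: le_trans (bB s).
rewrite (@ge0_integralZl_EFin _ _ _ leb Bl mBl)//.
rewrite /davg /iavg (lebesgue_measure_ball _ (ltW r0)) inver mulrn_eq0/= (gt_eqF r0).
rewrite muleA -EFinM (_ : 2 * B * _ = B / r)//.
by rewrite -mulr_natr; field; rewrite gt_eqF.
Qed.

End step_average.

(** * Testing the gradient against radial fields *)

Section gradient_identity.
Context {R : realType} {d : nat}.
Local Notation E := 'rV[R]_d.
Local Notation mu := (@lebesgue_rV R d).
Local Notation leb := (@lebesgue_measure R).
Local Notation cb := (@vball R d).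
Local Notation step := (@smooth_step R).
Hypothesis d0 : (0 < d)%N.
Implicit Types (u w psi : E -> R) (g : E -> E).

(* The radii are measured by [rho], not by [enorm]. *)
Definition annulus (a b : R) : set E := @rho R d @^-1` `[a, b]%classic.

Lemma annulusE a b : annulus a b = [set x : E | a <= rho x <= b].
Proof. by apply/seteqP; split => x; rewrite /annulus /= in_itv. Qed.

Lemma measurable_rhoV : measurable_fun setT (fun x : E => (rho x)^-1).
Proof.
under eq_fun do rewrite -powR_inv1 ?rho_ge0//.
exact: measurableT_comp (measurable_powR _) measurable_rho.
Qed.

Lemma measurable_annulus a b : measurable (annulus a b).
Proof. by apply: measurable_rho_preimage; exact: measurable_itv. Qed.

Lemma annulus_punctured a b : 0 < a -> annulus a b `<=` punctured d.
Proof.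
by move=> a0 x; rewrite annulusE => /= /andP[ax _]; rewrite /punctured /= -rho_gt0// (lt_le_trans a0).
Qed.

Lemma Lp_loc1_integrable w a b : 0 < a -> Lp_loc 1 (punctured d) w ->
  mu.-integrable (annulus a b) (EFin \o w).
Proof.
move=> a0 [mw iw]; apply/integrableP; split.
  apply/measurable_EFinP; apply: measurable_funS mw.
    exact: measurable_punctured.
  exact: annulus_punctured.
have cA : compact (annulus a b) by rewrite annulusE; exact: compact_annulus.
have := iw (annulus a b) (annulus_punctured a0) cA.
by under eq_integral do rewrite powRr1//.
Qed.

Lemma Lp_loc1M_integrable w psi a b : 0 < a -> Lp_loc 1 (punctured d) w ->
  continuous psi -> mu.-integrable (annulus a b) (fun x => (w x * psi x)%:E).
Proof.
move=> a0 lw cpsi.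
have mA := measurable_annulus a b.
have := @integrableMl _ _ _ mu _ mA _ psi (Lp_loc1_integrable b a0 lw).
move=> H; apply: (eq_integrable mA _ _ _ (H _ _)) => //.
  by apply: measurable_funTS; exact: continuous_measurable_rV.
have cA : compact (annulus a b) by rewrite annulusE; exact: compact_annulus.
have /compact_bounded[M [_ Mb]] := continuous_compact (continuous_subspaceT cpsi) cA.
by exists M; split; [exact: num_real|move=> y My x Ax; apply: Mb => //; exists x].
Qed.

Lemma Lp_loc1M_extend w psi a b : 0 < a -> Lp_loc 1 (punctured d) w ->
  continuous psi -> (forall x, ~ annulus a b x -> psi x = 0) ->
  mu.-integrable (punctured d) (fun x => (w x * psi x)%:E) /\
  (\int[mu]_(x in punctured d) (w x * psi x)%:E = \int[mu]_(x in annulus a b) (w x * psi x)%:E)%E.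
Proof.
move=> a0 lw cpsi psi0.
have mA := measurable_annulus a b.
have mP := @measurable_punctured R d d0.
have i1 := Lp_loc1M_integrable b a0 lw cpsi.
pose f x := (w x * psi x)%:E.
have fA x : f x = (f \_ (annulus a b)) x.
  rewrite patchE; case: ifPn => // /negP xA.
  by rewrite /f psi0 ?mulr0// => Ax; apply: xA; rewrite inE.
split.
  apply: (eq_integrable mP (f \_ (annulus a b))); first by move=> x _; rewrite -fA.
  apply/(@integrable_restrict _ _ _ mu (annulus a b) mA (punctured d) mP f).1.
  by rewrite (setIidr (annulus_punctured a0)).
rewrite integral_mkcond [in RHS]integral_mkcond; apply: eq_integral => x _.
rewrite -fA patchE; case: ifPn => // xP; rewrite -/(f x) fA patchE ifF//.
apply/negbTE; apply: contra xP; rewrite !inE; exact: annulus_punctured.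
Qed.

Lemma sum_gradient_identity u g (k : R -> R) (a b : R) : 0 < a ->
  Lp_loc 1 (punctured d) u -> is_distr_gradient (punctured d) u g ->
  (forall n, smooth_upto1 n setT k) ->
  (forall t, t <= a -> k t = 0) -> (forall t, b <= t -> k t = 0) ->
  (\int[mu]_(x in annulus a b) (u x * (d%:R * derive1 k (rho x)))%:E =
   - \int[mu]_(x in annulus a b) ((\sum_i g x ord0 i * x ord0 i) * (k (rho x) / rho x))%:E)%E.
Proof.
move=> a0 lu [lg ug] sk ka kb.
have tf i := test_function_radial_field d0 i a0 ka kb sk.
pose phi (i : 'I_d) : E -> R := radial_field k i.
have kA x : ~ annulus a b x -> k (rho x) = 0.
  rewrite annulusE /= => /negP; rewrite negb_and -!ltNge => /orP[/ltW/ka|/ltW/kb] //.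
have phiA i x : ~ annulus a b x -> phi i x = 0.
  by move=> xA; rewrite /phi radial_fieldE kA// mul0r mulr0.
have cphi i : continuous (phi i).
  by have [] := (tf i) => /(_ [::])[].
have cDphi i : continuous ('D_(basis_vec i) (phi i)).
  by have [] := (tf i) => /(_ [:: i])[].
have oA : open (~` annulus a b).
  apply: closed_openC; apply: compact_closed; first exact: norm_hausdorff.
  by rewrite annulusE; exact: compact_annulus.
have DphiA i x : ~ annulus a b x -> 'D_(basis_vec i) (phi i) x = 0.
  move=> xA; rewrite (@near_eq_derive _ _ _ _ (cst 0)) ?derive_cst//.
  have := open_nbhs_nbhs (conj oA xA : open_nbhs x (~` annulus a b)).
  by apply: filterS => y; exact: phiA.
have iu i := Lp_loc1M_extend a0 lu (@cDphi i) (@DphiA i).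
have ig i := Lp_loc1M_extend a0 (lg i) (@cphi i) (@phiA i).
have mA := measurable_annulus a b.
have EL : (\int[mu]_(x in annulus a b) (u x * (d%:R * derive1 k (rho x)))%:E =
    \sum_i \int[mu]_(x in annulus a b) (u x * 'D_(basis_vec i) (phi i) x)%:E)%E.
  rewrite -(integral_sum mA) => [|i]; last exact: Lp_loc1M_integrable.
  apply: eq_integral => x /[!inE] Ax; rewrite sumEFin -mulr_sumr; congr (_ * _)%:E.
  by rewrite divergence_radial_field//; exact: annulus_punctured Ax.
have ER : (\int[mu]_(x in annulus a b) ((\sum_i g x ord0 i * x ord0 i) * (k (rho x) / rho x))%:E =
    \sum_i \int[mu]_(x in annulus a b) (g x ord0 i * phi i x)%:E)%E.
  rewrite -(integral_sum mA) => [|i]; last exact: Lp_loc1M_integrable.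
  apply: eq_integral => x _; rewrite sumEFin mulr_suml; congr (_%:E).
  by apply: eq_bigr => i _; rewrite /phi radial_fieldE -mulrA.
have fg i : (\int[mu]_(x in annulus a b) (g x ord0 i * phi i x)%:E)%E \is a fin_num.
  by apply: integrable_fin_num => //; exact: Lp_loc1M_integrable.
rewrite EL ER.
(* In the extended reals the sign passes through the sum only once the summands are known to be
   finite. *)
transitivity (\sum_i (- fine (\int[mu]_(x in annulus a b) (g x ord0 i * phi i x)%:E))%:E)%E.
  apply: eq_bigr => i _; rewrite EFinN fineK//.
  by rewrite -(iu i).2 -(ig i).2 ug.
rewrite sumEFin sumrN EFinN -sumEFin; congr (- _)%E.
by apply: eq_bigr => i _; rewrite fineK.
Qed.

Lemma ler_dist01 (x y : R) : 0 <= x -> x <= 1 -> 0 <= y -> y <= 1 -> `|x - y| <= 1.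
Proof. by move=> *; rewrite ler_norml; apply/andP; split; lra. Qed.

Lemma ler_dist_approx (x y i j K eps : R) : `|i - j| <= K ->
  `|i - x| <= eps / 2 -> `|j - y| <= eps / 2 -> `|x - y| <= K + eps.
Proof.
move=> ij ix jy; have h1 := ler_distD i x y; have h2 := ler_distD j i y.
by rewrite (distrC x i) in h1; lra.
Qed.

Section radial_test.
Variables (u : E -> R) (g : E -> E) (F : R -> R).
Hypotheses (lu : Lp_loc 1 (punctured d) u) (ug : is_distr_gradient (punctured d) u g).
Hypotheses (mF : measurable_fun setT F) (uF : {ae mu, forall x, u x = F (rho x)}).

Lemma profile_integrable a b : 0 < a -> leb.-integrable `[a, b] (EFin \o F).
Proof.
move=> a0; apply/integrableP; split; first by apply/measurable_EFinP; exact: measurable_funTS.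
have mA := measurable_annulus a b.
have ab0 : (`[a, b]%classic : set R) `<=` `[0, +oo[%classic.
  by move=> t /=; rewrite !in_itv/= andbT => /andP[/(le_trans (ltW a0))].
have mI : measurable (`[a, b]%classic : set (measurableTypeR R)) by exact: measurable_itv.
have maF : measurable_fun (`[a, b]%classic : set R) (fun t => `|(F t)%:E|%E).
  by apply: measurableT_comp => //; apply/measurable_EFinP; exact: measurable_funTS.
have /integrableP[mu_ iu] := Lp_loc1_integrable b a0 lu.
have := ge0_integral_rho d0 mI ab0 maF (fun t _ => abse_ge0 _).
rewrite [LHS](_ : _ = \int[mu]_(x in annulus a b) `|(u x)%:E|)%E; last first.
  apply: ae_eq_integral => //.
  - have := measurable_comp mI _ maF (@measurable_funTS _ _ _ _ (@rho R d @^-1` `[a, b]%classic) _ measurable_rho).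
    by apply; move=> _ /= [x xD <-].
  - exact: measurableT_comp.
  - by apply: filterS uF => x -> _.
move=> H; rewrite H in iu; move: iu.
have v0 : 0 < cb := vball_gt0 d0.
by rewrite -[X in (_ < X)%E](@gt0_muley _ (cb%:E)) ?lte_fin// lte_pmul2l// lte_fin.
Qed.

Lemma measurable_enorm_gradient a b : 0 < a ->
  measurable_fun (annulus a b) (fun x => enorm (g x)).
Proof.
move=> a0; have [lg _] := ug.
rewrite (_ : (fun _ => _) = Num.sqrt \o (fun x : E => \sum_i g x ord0 i ^+ 2))//.
apply: measurableT_comp.
  by apply: continuous_measurable_fun; exact: sqrt_continuous.
apply: measurable_sum => i; apply: measurable_funX.
apply: measurable_funS (lg i).1; first exact: measurable_punctured.
exact: annulus_punctured.
Qed.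

(** Two intervals, because the profile is integrated over a fixed [[a0, b0]] while the gradient is
    to be charged only where [k] lives. *)
Lemma radial_test_bound (k : R -> R) (a0 a b b0 : R) : 0 < a0 -> a0 <= a -> b <= b0 ->
  (forall n, smooth_upto1 n setT k) ->
  (forall t, t <= a -> k t = 0) -> (forall t, b <= t -> k t = 0) ->
  (forall t, `|k t| <= 1) ->
  ((cb * `|Rintegral leb `[a0, b0] (fun t => (F t * derive1 k t)%R)|)%:E <=
  \int[mu]_(x in annulus a b) (enorm (g x) * (enorm x / rho x))%:E)%E.
Proof.
move=> a00 a0a bb0 sk ka kb k1; have [lg _] := ug.
have ka0 t : t <= a0 -> k t = 0 by move=> /le_trans/(_ a0a)/ka.
have kb0 t : b0 <= t -> k t = 0 by move=> /(le_trans bb0)/kb.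
have v0 : 0 < cb := vball_gt0 d0.
have dR : 0 < d%:R :> R by rewrite ltr0n.
have a1 : 0 < a by exact: lt_le_trans a0a.
have ck : continuous k by move=> t; have [c _] := sk 0%N; exact: c.
have ck' : continuous (derive1 k).
  have [_ [_ ds]] := sk 1%N; have [c _] := ds tt.
  rewrite (_ : derive1 k = 'D_1 k); first by move=> x; exact: c.
  by apply/funext => x; rewrite derive1E.
have mk' : measurable_fun setT (derive1 k) by exact: continuous_measurable_fun.
have mk : measurable_fun setT k by exact: continuous_measurable_fun.
have mI : measurable (`[a0, b0]%classic : set (measurableTypeR R)) by exact: measurable_itv.
have mA := measurable_annulus a0 b0.
have mAab := measurable_annulus a b.
have AA : annulus a b `<=` annulus a0 b0.
  by move=> x; rewrite !annulusE /= => /andP[/(le_trans a0a) -> /le_trans ->].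
have I0 : (`[a0, b0]%classic : set R) `<=` `[0, +oo[%classic.
  by move=> t /=; rewrite !in_itv/= andbT => /andP[/(le_trans (ltW a00))].
have iFk : leb.-integrable `[a0, b0] (EFin \o (fun t => F t * derive1 k t)).
  have := @integrableMl _ _ _ leb _ mI _ (derive1 k) (profile_integrable b0 a00).
  move=> H; apply: (eq_integrable mI _ _ _ (H _ _)) => //.
    exact: measurable_funTS.
  have /compact_bounded[M [_ Mb]] :=
    continuous_compact (continuous_subspaceT ck') (@segment_compact R a0 b0).
  by exists M; split; [exact: num_real|move=> y My x Ax; apply: Mb => //; exists x].
have := sum_gradient_identity a00 lu ug sk ka0 kb0.
have -> : (\int[mu]_(x in annulus a0 b0) (u x * (d%:R * derive1 k (rho x)))%:E =
    (cb * d%:R * Rintegral leb `[a0, b0] (fun t => (F t * derive1 k t)%R))%:E)%E.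
  transitivity (\int[mu]_(x in annulus a0 b0) (d%:R * (F (rho x) * derive1 k (rho x)))%:E)%E.
    apply: ae_eq_integral => //.
    - apply/measurable_EFinP; apply: measurable_funM.
        by apply/measurable_EFinP; exact: measurable_int (Lp_loc1_integrable b0 a00 lu).
      apply: measurable_funM => //.
      by apply: measurable_funTS; exact: measurableT_comp mk' measurable_rho.
    - apply/measurable_EFinP; apply: measurable_funM => //.
      apply: measurable_funTS; apply: measurable_funM.
        exact: measurableT_comp mF measurable_rho.
      exact: measurableT_comp mk' measurable_rho.
    - by apply: filterS uF => x -> _; congr EFin; ring.
  have iFkd : leb.-integrable `[a0, b0] (EFin \o (fun t => d%:R * (F t * derive1 k t))).
    have H := @integrableZl _ _ _ leb _ mI d%:R _ iFk.
    exact: (eq_integrable mI _ _ _ H).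
  rewrite [LHS](integral_rho d0 mI I0 iFkd).
  rewrite -mulrA EFinM; congr (_ * _)%E.
  rewrite -(@RintegralZl _ _ _ leb)// /Rintegral fineK//.
  exact: (@integrable_fin_num _ _ _ leb _ mI).
set I := Rintegral _ _ _ => HI.
have HI' : ((cb * d%:R * `|I|)%:E = `| \int[mu]_(x in annulus a0 b0)
    ((\sum_i g x ord0 i * x ord0 i) * (k (rho x) / rho x))%:E |)%E.
  by rewrite -abseN -HI /= normrM (gtr0_norm (mulr_gt0 v0 dR)).
rewrite -(@lee_pmul2l _ d%:R%:E) ?lte_fin//.
rewrite -EFinM mulrA (mulrC d%:R) HI'.
have mh (A : set E) : A `<=` annulus a0 b0 -> measurable_fun A
    (fun x => ((\sum_i g x ord0 i * x ord0 i) * (k (rho x) / rho x))%:E).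
  move=> AA0; apply/measurable_EFinP; apply: measurable_funM.
    apply: measurable_sum => i; apply: measurable_funM.
      apply: measurable_funS (lg i).1; first exact: measurable_punctured.
      by apply: subset_trans AA0 _; exact: annulus_punctured.
    by apply: measurable_funTS; exact: measurable_coord.
  apply: measurable_funTS; apply: measurable_funM.
    exact: measurableT_comp mk measurable_rho.
  exact: measurable_rhoV.
apply: (le_trans (@le_abse_integral _ _ _ mu _ _ mA (mh _ _))) => //.
rewrite [leLHS](_ : _ = \int[mu]_(x in annulus a b) `|((\sum_i g x ord0 i * x ord0 i) * (k (rho x) / rho x))%:E|)%E; last first.
  rewrite integral_mkcond [in RHS]integral_mkcond; apply: eq_integral => x _.
  rewrite !patchE; case: ifPn => x0; case: ifPn => x1 //.
    move: x1; rewrite notin_setE annulusE /= => /negP; rewrite negb_and -!ltNge.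
    by move=> /orP[/ltW/ka|/ltW/kb] ->; rewrite mul0r mulr0 normr0.
  by exfalso; move/negP: x0; apply; move: x1; rewrite !inE; exact: AA.
have mR : measurable_fun (annulus a b) (fun x => (enorm (g x) * (enorm x / rho x))%:E).
  apply/measurable_EFinP; apply: measurable_funM; first exact: measurable_enorm_gradient.
  apply: measurable_funTS; apply: measurable_funM; first exact: measurable_enorm.
  exact: measurable_rhoV.
rewrite -(@ge0_integralZl_EFin _ _ _ mu _ mAab)//; last first.
  by move=> x _; rewrite lee_fin !mulr_ge0 ?enorm_ge0 ?invr_ge0 ?rho_ge0.
apply: (@ge0_le_integral _ _ _ mu _ mAab) => //.
- by apply: measurableT_comp => //; apply: mh.
- exact: measurable_funeM.
- move=> x _; rewrite -EFinM lee_fin normrM normrM normfV (ger0_norm (rho_ge0 x)).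
  (* Bounding coordinate by coordinate costs a factor [d], which cancels the [d] produced by the
     divergence. *)
  have S : `|\sum_i g x ord0 i * x ord0 i| <= d%:R * (enorm (g x) * enorm x).
    apply: le_trans (ler_norm_sum _ _ _) _.
    rewrite -[X in X%:R]card_ord mulr_natl -sumr_const; apply: ler_sum => i _.
    by rewrite normrM ler_pM// ler_enorm.
  rewrite [leRHS](_ : _ = d%:R * (enorm (g x) * enorm x) / rho x); last by rewrite !mulrA.
  rewrite [leLHS]mulrA ler_wpM2r ?invr_ge0 ?rho_ge0//.
  by rewrite -[leRHS]mulr1 ler_pM.
Qed.

(** The test profile is a plateau close to the indicator of [[s, t]]. Its derivative is a bump just
    after [s] minus a bump just before [t], so [F] integrated against it tends to [F s - F t] at
    Lebesgue points. Cutting [F] off outside [[a0, b0]] makes it integrable on the line, where the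
    differentiation theorem is applied. *)
Lemma profile_oscillation (a0 b0 : R) : 0 < a0 ->
  {ae leb, forall s, a0 < s < b0 -> lebesgue_pt (F \_ `[a0, b0]) s} /\
  forall s t, lebesgue_pt (F \_ `[a0, b0]) s -> lebesgue_pt (F \_ `[a0, b0]) t ->
    a0 < s -> s < t -> t < b0 ->
  ((cb * `|F s - F t|)%:E <=
    \int[mu]_(x in annulus s t) (enorm (g x) * (enorm x / rho x))%:E)%E.
Proof.
move=> a00; set w := F \_ `[a0, b0].
have mI : measurable (`[a0, b0]%classic : set (measurableTypeR R)) by exact: measurable_itv.
have iF := profile_integrable b0 a00.
have iw : leb.-integrable setT (EFin \o w).
  have := (@integrable_mkcond _ _ _ leb _ (EFin \o F) mI).1 iF.
  by rewrite restrict_EFin.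
have v0 : 0 < cb := vball_gt0 d0.
split.
  have lw : locally_integrable setT w.
    apply: integrable_locally => //; exact: openT.
  have [N [mN N0 sN]] := lebesgue_differentiation lw.
  by exists N; split => // s /= H; apply: sN => /= ls; apply: H.
move=> s t ps pt a0s st tb0.
set X := integral _ _ _.
have X0 : (0 <= X)%E.
  by apply: integral_ge0 => x _; rewrite lee_fin !mulr_ge0 ?enorm_ge0 ?invr_ge0 ?rho_ge0.
have [->|Xoo] := eqVneq X +oo%E; first by rewrite leey.
have fX : X \is a fin_num by rewrite ge0_fin_numE// ltey.
rewrite -(fineK fX) lee_fin -ler_pdivlMl// mulrC.
have [B B0 stepB] := @step'_bounded R.
apply/ler_addgt0Pr => eps eps0.
(* There are two averages, each with an error of at most [2 * B * e = eps / 2]. *)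
pose e := eps / (4 * B).
have e0 : 0 < e by rewrite divr_gt0// mulr_gt0.
have lpt z : lebesgue_pt w z -> \forall r \near (0 : R)^'+, (davg w z r < e%:E)%E.
  move=> lz; apply: (lz [set y | (y < e%:E)%E]).
  have : \forall y \near (0 : R), y < e by exact: lt_nbhsl.
  by apply: filterS => y; rewrite /= lte_fin.
have sub z : a0 < z < b0 -> \forall r \near (0 : R)^'+, `[z - r, z + r]%classic `<=` `[a0, b0]%classic.
  move=> /andP[az zb]; near=> r.
  have r1 : r <= z - a0 by near: r; apply: nbhs_right_le; rewrite subr_gt0.
  have r2 : r <= b0 - z by near: r; apply: nbhs_right_le; rewrite subr_gt0.
  by move=> y /=; rewrite !in_itv/= => /andP[y1 y2]; apply/andP; split; lra.
have sab : a0 < s < b0 by rewrite a0s (lt_trans st).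
have tab : a0 < t < b0 by rewrite tb0 (lt_trans a0s).
have [r [r0 rst [ds dt] [Is It]]] : exists r, [/\ 0 < r, r < t - s,
    (davg w s r < e%:E)%E /\ (davg w t r < e%:E)%E &
    `[s - r, s + r]%classic `<=` `[a0, b0]%classic /\ `[t - r, t + r]%classic `<=` `[a0, b0]%classic].
  apply: (@filter_ex _ (0 : R)^'+); near=> r; split.
  - by [].
  - by near: r; apply: nbhs_right_lt; rewrite subr_gt0.
  - by split; near: r; exact: lpt.
  - by split; near: r; exact: sub.
have iwD : leb.-integrable `[a0, b0] (EFin \o w).
  exact: (@integrableS _ _ _ leb setT).
have avg z c : lebesgue_pt w z -> a0 < z < b0 -> (c == 0) || (c == 1) ->
    `[z - r, z + r]%classic `<=` `[a0, b0]%classic -> (davg w z r < e%:E)%E ->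
    `|Rintegral leb `[a0, b0] (fun y => F y * bump r z c y) - F z| <= eps / 2.
  move=> lz zab c01 zI dz.
  have := bump_average_le stepB c01 r0 mI iwD zI.
  rewrite (_ : w z = F z); last by rewrite /w patchE mem_set//= in_itv/=; case/andP: zab => /ltW -> /ltW ->.
  rewrite (@eq_Rintegral _ _ _ leb _ (fun y => F y * bump r z c y)); last first.
    by move=> y yI; rewrite /w patchE yI.
  move=> H; rewrite -lee_fin; apply: (le_trans H).
  rewrite (@le_trans _ _ ((2 * B)%:E * e%:E)%E)//.
    by rewrite lee_pmul2l ?lte_fin ?mulr_gt0// ltW.
  by rewrite -EFinM lee_fin /e le_eqVlt; apply/orP; left; apply/eqP; field; rewrite gt_eqF.
have A1 : `|Rintegral leb `[a0, b0] (fun y => F y * bump r s 0 y) - F s| <= eps / 2.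
  by apply: avg => //; rewrite eqxx.
have A2 : `|Rintegral leb `[a0, b0] (fun y => F y * bump r t 1 y) - F t| <= eps / 2.
  by apply: avg => //; rewrite eqxx orbT.
(* Since [r < t - s], both steps are 0 to the left of [s] and 1 to the right of [t], so [k] is
   supported in [[s, t]]. *)
pose k (y : R) := step ((y - s) / r + 0) - step ((y - t) / r + 1).
have oT : open [set: R] by exact: openT.
have sk n : smooth_upto1 n setT k.
  have S z c : smooth_upto1 n setT (fun y => step ((y - z) / r + c)).
    apply: (@smooth_upto_comp R R^o unit (fun=> 1) _ _ setT (fun y => (y - z) / r + c) step) => //.
      rewrite (_ : (fun _ => _) = (fun y => r^-1 * y + (c - z / r))).
        exact: smooth_upto1_affine.
      by apply/funext => y; ring.
    exact: smooth_upto1_step.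
  rewrite (_ : k = (fun y => step ((y - s) / r + 0)) \+ (cst (-1) \* (fun y => step ((y - t) / r + 1)))).
    apply: smooth_uptoD; [exact: oT|exact: S|].
    by apply: smooth_uptoM; [exact: oT|exact: smooth_upto_cst|exact: S].
  by apply/funext => y; rewrite /k /= mulN1r.
have ka y : y <= s -> k y = 0.
  move=> ys; rewrite /k !smooth_step0 ?subrr//.
    have : (y - t) / r <= -1 by rewrite ler_pdivrMr//; lra.
    by lra.
  have : (y - s) / r <= 0 by rewrite ler_pdivrMr//; lra.
  by lra.
have kb y : t <= y -> k y = 0.
  move=> ys; rewrite /k !smooth_step1 ?subrr//.
    have : 0 <= (y - t) / r by rewrite ler_pdivlMr//; lra.
    by lra.
  have : 1 <= (y - s) / r by rewrite ler_pdivlMr//; lra.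
  by lra.
have k1 y : `|k y| <= 1.
  by apply: ler_dist01; rewrite ?smooth_step_ge0 ?smooth_step_le1.
have := radial_test_bound a00 (ltW a0s) (ltW tb0) sk ka kb k1.
have ib z c : leb.-integrable `[a0, b0] (EFin \o (fun y => F y * bump r z c y)).
  have := @integrableMl _ _ _ leb _ mI _ (bump r z c) iF.
  move=> H; apply: (eq_integrable mI _ _ _ (H _ _)) => //.
    by apply: measurable_funTS; apply: continuous_measurable_fun; exact: continuous_bump.
  have /compact_bounded[M [_ Mb]] :=
    continuous_compact (continuous_subspaceT (@continuous_bump R r z c)) (@segment_compact R a0 b0).
  by exists M; split; [exact: num_real|move=> y My x Ax; apply: Mb => //; exists x].
rewrite (@eq_Rintegral _ _ _ leb _ (fun y => F y * bump r s 0 y - F y * bump r t 1 y)); last first.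
  by move=> y _; rewrite -mulrBr derive1_step_diff.
rewrite RintegralB// -/X -(fineK fX) lee_fin -ler_pdivlMl// mulrC => H.
exact: (ler_dist_approx H A1 A2).
Unshelve. all: by end_near. Qed.

End radial_test.
End gradient_identity.

(** * Interpolation on an interval *)

Section real_inequalities.
Context {R : realType}.
Implicit Types (x y s r : R).

Lemma le_powRl r x y : 0 <= r -> 0 <= x -> x <= y -> x `^ r <= y `^ r.
Proof.
by move=> r0 x0 xy; apply: ge0_ler_powR => //; rewrite nnegrE//; exact: le_trans xy.
Qed.

Lemma powR_young1 x s : 0 <= x -> 0 < s -> s <= 1 -> x `^ s <= s * x + (1 - s).
Proof.
move=> x0 s0; rewrite le_eqVlt => /predU1P[->|s1].
  by rewrite powRr1// mul1r subrr addr0.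
have s1' : 0 < 1 - s by rewrite subr_gt0.
have := @conjugate_powR R (x `^ s) 1 s^-1 (1 - s)^-1 (powR_ge0 _ _) ler01.
rewrite !invr_gt0 s0 s1' !invrK addrC subrK mulr1 => /(_ isT isT erefl).
by rewrite -powRrM mulfV ?gt_eqF// powRr1// powR1 mul1r mulrC.
Qed.

Lemma powR_le_self x s : 0 <= x -> x <= 1 -> 1 <= s -> x `^ s <= x.
Proof.
move=> x0 x1 s1; have [->|xn0] := eqVneq x 0; first by rewrite powR0// gt_eqF// (lt_le_trans _ s1).
by rewrite -[leRHS]powRr1//; apply: ger_powR => //; rewrite x1 lt0r xn0 x0.
Qed.

(** With [S = s + r] the product is the [S]-th power of [x^(s/S) y^(r/S)]. This base lies in
    [[0, 1]], where an exponent [S >= 1] only decreases it, and Young's inequality bounds the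
    base. *)
Lemma powR_young2 x y s r : 0 <= x -> x <= 1 -> 0 <= y -> y <= 1 -> 0 < s -> 0 <= r ->
  1 <= s + r -> x `^ s * y `^ r <= (s * x + r * y) / (s + r).
Proof.
move=> x0 x1 y0 y1 s0; rewrite le_eqVlt => /predU1P[<-|r0] sr1.
  rewrite powRr0 mulr1 mul0r !addr0 mulrAC mulfV ?gt_eqF// mul1r.
  by apply: powR_le_self => //; rewrite addr0 in sr1.
set S := s + r; have S0 : 0 < S by rewrite addr_gt0.
have E : x `^ s * y `^ r = (x `^ (s / S) * y `^ (r / S)) `^ S.
  by rewrite powRM ?powR_ge0// -!powRrM !divfK ?gt_eqF.
have p0 : 0 < S / s by rewrite divr_gt0.
have q0 : 0 < S / r by rewrite divr_gt0.
have pq : (S / s)^-1 + (S / r)^-1 = 1 by rewrite !invf_div -mulrDl mulfV// gt_eqF.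
have := @conjugate_powR R (x `^ (s / S)) (y `^ (r / S)) _ _ (powR_ge0 _ _) (powR_ge0 _ _) p0 q0 pq.
rewrite -!powRrM !invf_div (_ : s / S * (S / s) = 1); last by field; rewrite !gt_eqF.
rewrite (_ : r / S * (S / r) = 1); last by field; rewrite !gt_eqF.
rewrite !powRr1// => H.
set z := x `^ (s / S) * y `^ (r / S) in E H.
have z0 : 0 <= z by rewrite mulr_ge0 ?powR_ge0.
have z1 : z <= 1.
  have h (b c : R) : 0 <= b -> b <= 1 -> 0 < c -> b `^ (c / S) <= 1.
    move=> b0 b1 c0; have := le_powRl (divr_ge0 (ltW c0) (ltW S0)) b0 b1.
    by rewrite powR1.
  by rewrite /z mulr_ile1 ?powR_ge0 ?h.
have zS : z `^ S <= z.
  exact: powR_le_self.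
rewrite E (le_trans zS)// (le_trans H)// le_eqVlt; apply/orP; left; apply/eqP.
by field; rewrite gt_eqF.
Qed.

(** Hölder's inequality when [s + r = 1]. In general the terms are divided by their totals, which
    puts them in [[0, 1]], and [powR_young2] is summed; the right-hand sides add up to at most 1. *)
Lemma sum_powRM_le (n : nat) (x y : nat -> R) s r :
  (forall i, 0 <= x i) -> (forall i, 0 <= y i) -> 0 < s -> 0 <= r -> 1 <= s + r ->
  \sum_(i < n) x i `^ s * y i `^ r <=
    (\sum_(i < n) x i) `^ s * (\sum_(i < n) y i) `^ r.
Proof.
move=> x0 y0 s0 r0 sr1; set X := \sum_(i < n) x i; set Y := \sum_(i < n) y i.
have X0 : 0 <= X by apply: sumr_ge0.
have Y0 : 0 <= Y by apply: sumr_ge0.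
have S0 : 0 < s + r by rewrite (lt_le_trans _ sr1).
have xX (i : 'I_n) : x i <= X by rewrite /X (bigD1 i)//= lerDl sumr_ge0.
have yY (i : 'I_n) : y i <= Y by rewrite /Y (bigD1 i)//= lerDl sumr_ge0.
have [Xe|Xn] := eqVneq X 0.
  rewrite big1 ?mulr_ge0 ?powR_ge0// => i _.
  have -> : x i = 0 by apply/eqP; rewrite eq_le x0 andbT -Xe xX.
  by rewrite powR0 ?gt_eqF// mul0r.
have Xp : 0 < X by rewrite lt0r Xn.
(* Since 0 to the power 0 is 1, a zero total kills the terms only when [r > 0]; for [r = 0] the
   second factor is constantly 1. *)
have [/andP[/eqP Ye rp]|H] := boolP ((Y == 0) && (0 < r)).
  rewrite big1 ?mulr_ge0 ?powR_ge0// => i _.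
  have -> : y i = 0 by apply/eqP; rewrite eq_le y0 andbT -Ye yY.
  by rewrite (powR0 (x := r)) ?gt_eqF// mulr0.
have yE (i : 'I_n) : y i `^ r = Y `^ r * (y i / Y) `^ r.
  move: H; rewrite negb_and -leNgt => /orP[Yn|rn].
    by rewrite -powRM ?divr_ge0// mulrC divfK.
  by have -> : r = 0; [apply/eqP; rewrite eq_le r0 rn|rewrite !powRr0 mulr1].
have xE (i : 'I_n) : x i `^ s = X `^ s * (x i / X) `^ s.
  by rewrite -powRM ?divr_ge0// mulrC divfK.
under eq_bigr do rewrite xE yE mulrACA.
rewrite -mulr_sumr -[leRHS]mulr1 ler_wpM2l ?mulr_ge0 ?powR_ge0//.
have yY1 (i : 'I_n) : y i / Y <= 1.
  have [->|Yn] := eqVneq Y 0; first by rewrite invr0 mulr0.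
  by rewrite ler_pdivrMr ?mul1r// lt0r Yn.
apply: (@le_trans _ _ (\sum_(i < n) (s * (x i / X) + r * (y i / Y)) / (s + r))).
  apply: ler_sum => i _; apply: powR_young2 => //; rewrite ?divr_ge0//.
  by rewrite ler_pdivrMr ?mul1r.
rewrite -mulr_suml big_split/= -!mulr_sumr -!mulr_suml -/X -/Y mulfV// mulr1.
rewrite ler_pdivrMr// mul1r lerD2l ler_piMr//.
by have [->|Yn] := eqVneq Y 0; [rewrite mul0r|rewrite mulfV].
Qed.

End real_inequalities.

Section power_mean.
Context d (T : measurableType d) {R : realType} (mu : {measure set T -> \bar R}).
Local Open Scope ereal_scope.

(** Jensen's inequality by a tangent line: [powR_young1] is applied to [h^q / A] with [A = Y / l],
    the bound for the average of [h^q], and integrated. For [Y = 0] there is no such normalisation,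
    but then [h] vanishes almost everywhere. *)
Lemma power_mean (D : set T) (h : T -> R) (k q l Y : R) : measurable D ->
  measurable_fun D h -> (forall x, D x -> (0 <= h x)%R) -> (0 < k)%R -> (k <= q)%R ->
  (0 < l)%R -> (0 <= Y)%R -> mu D <= l%:E ->
  \int[mu]_(x in D) ((h x `^ q)%R)%:E <= Y%:E ->
  \int[mu]_(x in D) ((h x `^ k)%R)%:E <= ((l `^ (1 - k / q) * Y `^ (k / q))%R)%:E.
Proof.
move=> mD mh h0 k0 kq l0 Y0 Dl hY.
have q0 : (0 < q)%R by exact: lt_le_trans kq.
have mp (r : R) : measurable_fun D (fun x => ((h x `^ r)%R)%:E).
  by apply/measurable_EFinP; exact: measurableT_comp (measurable_powR _) mh.
have kq1 : (k / q <= 1)%R by rewrite ler_pdivrMr// mul1r.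
have kq0 : (0 < k / q)%R by rewrite divr_gt0.
have [Ye|Yn] := eqVneq Y 0%R.
  have I0 : \int[mu]_(x in D) ((h x `^ q)%R)%:E = 0.
    apply/eqP; rewrite eq_le integral_ge0 ?andbT ?(le_trans hY) ?Ye// => x _.
    by rewrite lee_fin powR_ge0.
  have ae0 : ae_eq mu D (fun x => ((h x `^ q)%R)%:E) (cst 0).
    apply/(ae_eq_integral_abs mu mD (mp q)).
    by under eq_integral do rewrite gee0_abs ?lee_fin ?powR_ge0//.
  rewrite (_ : \int[mu]_(x in D) _ = 0) ?lee_fin ?mulr_ge0 ?powR_ge0//.
  rewrite (@ae_eq_integral _ _ _ mu D (cst 0))//; first by rewrite integral0.
  apply: filterS ae0 => x hx Dx; have := hx Dx => /= -[] /powR_eq0_eq0 ->.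
  by rewrite powR0// gt_eqF.
have Yp : (0 < Y)%R by rewrite lt0r Yn.
pose A := (Y / l)%R; have A0 : (0 < A)%R by rewrite divr_gt0.
apply: (@le_trans _ _ (\int[mu]_(x in D)
   ((A `^ (k / q) * (k / q / A))%:E * ((h x `^ q)%R)%:E + (A `^ (k / q) * (1 - k / q))%:E))).
  apply: ge0_le_integral => //.
  - by move=> x _; rewrite lee_fin powR_ge0.
  - by apply: emeasurable_funD => //; exact: measurable_funeM.
  - move=> x Dx; rewrite -EFinM -EFinD lee_fin.
    have hq0 : (0 <= h x `^ q / A)%R by rewrite divr_ge0 ?powR_ge0// ltW.
    have hE : (h x `^ k = A `^ (k / q) * (h x `^ q / A) `^ (k / q))%R.
      rewrite -powRM ?(ltW A0)// mulrC divfK ?gt_eqF// -powRrM.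
      by rewrite mulrC divfK ?gt_eqF.
    rewrite hE (le_trans (ler_wpM2l (powR_ge0 _ _) (powR_young1 hq0 kq0 kq1)))//.
    by rewrite le_eqVlt; apply/orP; left; apply/eqP; ring.
rewrite ge0_integralD//; last 3 first.
- by move=> x _; rewrite -EFinM lee_fin !mulr_ge0 ?powR_ge0 ?invr_ge0 ?ltW.
- exact: measurable_funeM.
- by move=> x _; rewrite lee_fin mulr_ge0 ?powR_ge0// subr_ge0.
rewrite ge0_integralZl_EFin//; last 2 first.
- by move=> x _; rewrite lee_fin powR_ge0.
- by rewrite !mulr_ge0 ?powR_ge0 ?invr_ge0 ?ltW.
rewrite integral_cst//.
apply: (@le_trans _ _ ((A `^ (k / q) * (k / q / A))%:E * Y%:E + (A `^ (k / q) * (1 - k / q))%:E * l%:E)).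
  apply: leeD.
    by apply: lee_wpmul2l => //; rewrite lee_fin !mulr_ge0 ?powR_ge0 ?invr_ge0 ?ltW.
  by apply: lee_wpmul2l => //; rewrite lee_fin mulr_ge0 ?powR_ge0// subr_ge0.
rewrite -!EFinM -EFinD lee_fin.
have -> : (A `^ (k / q) * (k / q / A) * Y + A `^ (k / q) * (1 - k / q) * l = A `^ (k / q) * l)%R.
  by rewrite /A; field; rewrite !gt_eqF.
rewrite /A powRM ?invr_ge0 ?(ltW Yp) ?(ltW l0)// -[(l^-1)%R]powR_inv1 ?(ltW l0)// -powRrM.
rewrite powRB ?(gt_eqF l0) ?implybT// powRr1 ?(ltW l0)// mulN1r powRN.
by rewrite le_eqVlt; apply/orP; left; apply/eqP; ring.
Qed.

End power_mean.

Section local_interpolation.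
Context {R : realType}.
Local Notation leb := (@lebesgue_measure R).
Variables (F : R -> R) (a0 b0 D th q Y : R) (L : set R).
Hypotheses (ab : a0 < b0) (D0 : 0 <= D) (th0 : 0 <= th) (q1 : 1 <= q) (Y0 : 0 <= Y).
Hypotheses (mF : measurable_fun setT F) (LJ : forall t, L t -> a0 < t < b0).
Hypothesis aeL : {ae leb, forall t, a0 < t < b0 -> L t}.
Hypothesis osc : forall s t, L s -> L t -> `|F s - F t| <= D * `|s - t| `^ th.
Hypothesis hY : (\int[leb]_(t in `]a0, b0[) (`|F t| `^ q)%:E <= Y%:E)%E.

Lemma full_measure_point c e : c < e -> a0 <= c -> e <= b0 -> exists2 t, L t & c < t < e.
Proof.
move=> ce ac eb; apply: contrapT => nex.
have [N [mN N0 LN]] := aeL.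
have sub : `]c, e[%classic `<=` N.
  move=> t /=; rewrite in_itv/= => /andP[ct te]; apply: LN => /= H.
  apply: nex; exists t; last by rewrite ct te.
  by apply: H; rewrite (le_lt_trans ac ct) (lt_le_trans te eb).
have mce : measurable (`]c, e[%classic : set (measurableTypeR R)) by exact: measurable_itv.
have E : leb `]c, e[%classic = (e - c)%:E by rewrite lebesgue_measure_itv/= lte_fin ce EFinB.
have /eqP := etrans (esym E) (@subset_measure0 _ _ _ leb _ _ mce mN sub N0).
by rewrite eqe subr_eq0 gt_eqF.
Qed.

(** Taken over [L] and not over the interval, because the Hölder bound says nothing about values off
    [L]. *)
Definition absinf : R := inf [set `|F t| | t in L].

Lemma has_inf_absF : has_inf [set `|F t| | t in L].
Proof.
have [t Lt _] := full_measure_point ab (lexx _) (lexx _).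
by split; [exists (`|F t|), t|exists 0 => _ [s _ <-]].
Qed.

Lemma absinf_ge0 : 0 <= absinf.
Proof. by apply: lb_le_inf => [|_ [s _ <-]//]; exact: has_inf_absF.1. Qed.

Lemma absinf_le t : L t -> absinf <= `|F t|.
Proof. by move=> Lt; apply: ge_inf; [exact: has_inf_absF.2|exists t]. Qed.

Lemma absinf_near e : 0 < e -> exists2 t, L t & `|F t| < absinf + e.
Proof. by move=> /(inf_adherent)/(_ has_inf_absF)[_ [t Lt <-]]; exists t. Qed.

Lemma oscillation_le t : L t -> (`|F t| - absinf) <= D * (b0 - a0) `^ th.
Proof.
move=> Lt; apply/ler_addgt0Pr => e e0; have [s Ls Fs] := absinf_near e0.
have st : `|t - s| <= b0 - a0.
  by have := LJ Ls; have := LJ Lt; rewrite ler_norml => /andP[? ?] /andP[? ?]; apply/andP; split; lra.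
have H1 := osc Lt Ls; have H2 := lerB_dist (F t) (F s).
have H3 : D * `|t - s| `^ th <= D * (b0 - a0) `^ th by rewrite ler_wpM2l// le_powRl.
lra.
Qed.

(** If [|F t|] exceeds the infimum by [M], Hölder continuity keeps [|F|] above [M / 2] on an
    interval of length [(M / (2 D))^(1/th)], so [(M / 2)^q] times that length is at most [Y].
    Raising this to the power [th] gives the claim. For [th = 0] the oscillation bound alone
    suffices. *)
Lemma oscillation_powR_le t : L t ->
  ((`|F t| - absinf) / 2) `^ (q * th + 1) <= D * Y `^ th.
Proof.
move=> Lt1; set M := `|F t| - absinf.
have q0 : 0 < q by rewrite (lt_le_trans ltr01).
have e0 : 0 < q * th + 1 by rewrite ltr_wpDl// mulr_ge0// ltW.
have M0 : 0 <= M by rewrite subr_ge0 absinf_le.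
have [Me|Mn] := eqVneq M 0.
  by rewrite Me mul0r powR0 ?gt_eqF// mulr_ge0 ?powR_ge0.
have Mp : 0 < M by rewrite lt0r Mn.
(* A point where [|F|] is nearly minimal: [|F|] drops by more than [M / 2] on the way from [t] to
   [s], so [s] is too far from [t] to cut the interval short. *)
have [s Ls Fs] : exists2 s, L s & `|F s| < absinf + M / 4 by apply: absinf_near; rewrite divr_gt0.
have mM : absinf = `|F t| - M by rewrite /M; ring.
have M2 : M / 2 < D * `|t - s| `^ th.
  by have := osc Lt1 Ls; have := lerB_dist (F t) (F s); move: Fs; rewrite mM; lra.
have Dp : 0 < D.
  rewrite lt0r D0 andbT; apply/eqP => De; move: M2; rewrite De mul0r; lra.
have [the|thn] := eqVneq th 0.
  rewrite the mulr0 add0r powRr1 ?powRr0; last by lra.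
  by move: M2; rewrite the powRr0 => /ltW.
have thp : 0 < th by rewrite lt0r thn.
(* [|F|] is at least [M / 2] within [dl] of [t], and an interval of length [dl]
   on one side of [t] fits between [a0] and [b0] since [dl < |t - s|]. *)
pose dl := (M / (2 * D)) `^ th^-1.
have MD : 0 < M / (2 * D) by rewrite divr_gt0// mulr_gt0.
have dl0 : 0 < dl by rewrite powR_gt0.
have dlE : dl `^ th = M / (2 * D) by rewrite /dl -powRrM mulVf// powRr1// ltW.
have dst : dl < `|t - s|.
  rewrite ltNge; apply/negP => H.
  have := le_powRl th0 (normr_ge0 _) H; rewrite dlE => H'.
  have := ler_wpM2l D0 H'; rewrite (_ : D * (M / (2 * D)) = M / 2); last by field; rewrite gt_eqF.
  by move: M2; lra.
have [c [e [ce ec ac eb near_t]]] : exists c e, [/\ c < e, e - c = dl, a0 <= c, e <= b0 &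
    forall y, c < y < e -> `|y - t| <= dl].
  have /andP[at_ tb] := LJ Lt1; have /andP[as_ sb] := LJ Ls.
  have [ts|st] := leP t s.
    exists t, (t + dl); rewrite ler0_norm ?subr_le0// in dst.
    split; [lra|lra|lra|lra|] => y /andP[ty yt].
    by rewrite ger0_norm; lra.
  exists (t - dl), t; rewrite gtr0_norm ?subr_gt0// in dst.
  split; [lra|lra|lra|lra|] => y /andP[ty yt].
  by rewrite ler0_norm; lra.
have mce : measurable (`]c, e[%classic : set (measurableTypeR R)) by exact: measurable_itv.
have mab : measurable (`]a0, b0[%classic : set (measurableTypeR R)) by exact: measurable_itv.
have sub : `]c, e[%classic `<=` (`]a0, b0[%classic : set R).
  by move=> y /=; rewrite !in_itv/= => /andP[y1 y2]; rewrite (le_lt_trans ac y1) (lt_le_trans y2 eb).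
have mFq (A : set R) : measurable_fun A (fun y => (`|F y| `^ q)%:E).
  apply/measurable_EFinP; apply: measurable_funTS.
  apply: (measurableT_comp (measurable_powR _)).
  exact: measurableT_comp.
have I1 : (((M / 2) `^ q * dl)%:E <= Y%:E)%E.
  apply: le_trans hY.
  apply: (@le_trans _ _ (\int[leb]_(y in `]c, e[) (`|F y| `^ q)%:E)%E); last first.
    apply: (@ge0_subset_integral _ _ _ leb _ _ mce mab _ (mFq _) _ sub) => y _.
    by rewrite lee_fin powR_ge0.
  apply: (@le_trans _ _ (\int[leb]_(y in `]c, e[) ((M / 2) `^ q)%:E)%E).
    have E : leb `]c, e[%classic = dl%:E by rewrite lebesgue_measure_itv/= lte_fin ce -EFinB ec.
    by rewrite (@integral_cst _ _ _ leb _ mce) [X in (_ <= _ * X)%E]E EFinM.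
  apply: (@ae_ge0_le_integral _ _ _ leb _ mce).
  - by move=> y _; rewrite lee_fin powR_ge0.
  - exact: measurable_cst.
  - by move=> y _; rewrite lee_fin powR_ge0.
  - exact: mFq.
  - have [N [mN N0 LN]] := aeL; exists N; split => // y /= H; apply: LN => /= Ly.
    apply: H; rewrite in_itv/= => cye; rewrite lee_fin le_powRl ?(ltW q0) ?divr_ge0//.
    have {}Ly : L y.
      by apply: Ly; case/andP: cye => y1 y2; rewrite (le_lt_trans ac y1) (lt_le_trans y2 eb).
    have H1 := osc Lt1 Ly; have H2 := lerB_dist (F t) (F y).
    have H3 : `|t - y| `^ th <= dl `^ th by rewrite le_powRl// distrC near_t.
    have := ler_wpM2l D0 H3; rewrite dlE (_ : D * (M / (2 * D)) = M / 2); last by field; rewrite gt_eqF.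
    by have := absinf_ge0; rewrite mM; lra.
rewrite lee_fin in I1.
have M20 : 0 < M / 2 by rewrite divr_gt0.
have := le_powRl th0 (mulr_ge0 (powR_ge0 _ _) (ltW dl0)) I1.
rewrite powRM ?powR_ge0 ?(ltW dl0)// dlE -powRrM => H.
rewrite powRD ?gt_eqF ?implybT// powRr1 ?(ltW M20)//.
apply: le_trans (ler_wpM2l D0 H); rewrite le_eqVlt; apply/orP; left; apply/eqP.
by field; rewrite gt_eqF.
Qed.

(** Half the deviation, [x], satisfies [x <= D l^th] and [x^(q th + 1) <= D Y^th]. If
    [a (1 + q th) >= 1], a geometric mean of the two bounds [x] pointwise with [D] to the power [a].
    Otherwise the second bound alone uses up [D^(a tau)], and the remaining power of [|F|] is
    integrated by [power_mean]; the last hypothesis says that this power is at most [q]. The factor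
    [2^tau] undoes the halving. *)
Lemma local_interpolation (a tau : R) : 0 < a -> a <= 1 -> 1 <= tau ->
  tau * (1 - a - a * q * th) <= q ->
  (\int[leb]_(t in `]a0, b0[) (`| `|F t| - absinf | `^ tau)%:E <=
   (2 `^ tau * (b0 - a0) `^ (1 + a * th * tau - (1 - a) * tau / q) *
    D `^ (a * tau) * Y `^ ((1 - a) * tau / q))%:E)%E.
Proof.
move=> ap a1 tau1 hk; set l := b0 - a0.
have q0 : 0 < q by rewrite (lt_le_trans ltr01).
have tau0 : 0 < tau by rewrite (lt_le_trans ltr01).
have l0 : 0 < l by rewrite subr_gt0.
have mab : measurable (`]a0, b0[%classic : set (measurableTypeR R)) by exact: measurable_itv.
have lab : leb `]a0, b0[%classic = l%:E by rewrite lebesgue_measure_itv/= lte_fin ab EFinB.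
have mp (r : R) (A : set R) : measurable_fun A (fun y => (`|F y| `^ r)%:E).
  apply/measurable_EFinP; apply: measurable_funTS.
  by apply: (measurableT_comp (measurable_powR _)); exact: measurableT_comp.
have mG (A : set R) : measurable_fun A (fun y => (`| `|F y| - absinf | `^ tau)%:E).
  apply/measurable_EFinP; apply: measurable_funTS.
  apply: (measurableT_comp (measurable_powR _)); apply: measurableT_comp => //.
  by apply: measurable_funB => //; exact: measurableT_comp.
have P2 t : L t -> (`|F t| - absinf) / 2 <= D * l `^ th.
  move=> Lt; have := oscillation_le Lt; have := absinf_le Lt; rewrite -/l; lra.
have x0 t : L t -> 0 <= (`|F t| - absinf) / 2.
  by move=> Lt; rewrite divr_ge0// subr_ge0 absinf_le.
have GE t : L t -> `| `|F t| - absinf | `^ tau = 2 `^ tau * ((`|F t| - absinf) / 2) `^ tau.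
  move=> Lt; rewrite ger0_norm ?subr_ge0 ?absinf_le// -powRM ?x0//.
  by rewrite mulrC divfK.
have ae_int (h : R -> \bar R) : measurable_fun (`]a0, b0[%classic : set R) h ->
    (forall t, 0 <= h t)%E ->
    (forall t, L t -> (`| `|F t| - absinf | `^ tau)%:E <= h t)%E ->
    (\int[leb]_(t in `]a0, b0[) (`| `|F t| - absinf | `^ tau)%:E <= \int[leb]_(t in `]a0, b0[) h t)%E.
  move=> mh h0 Gh; apply: (@ae_ge0_le_integral _ _ _ leb _ mab).
  - by move=> y _; rewrite lee_fin powR_ge0.
  - exact: mG.
  - by move=> y _.
  - exact: mh.
  - have [N [mN N0 LN]] := aeL; exists N; split => // y /= H; apply: LN => /= Ly.
    by apply: H; rewrite in_itv/= => /Ly/Gh.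
have [caseA|caseB] := leP 1 (a * (1 + q * th)).
  pose B := D `^ a * Y `^ ((1 - a) / q) * l `^ (a * th - (1 - a) / q).
  have B0 : 0 <= B by rewrite !mulr_ge0 ?powR_ge0.
  have xB t : L t -> (`|F t| - absinf) / 2 <= B.
    move=> Lt; have {}x0 := x0 _ Lt; have H1 := oscillation_powR_le Lt; have {}H2 := P2 _ Lt.
    move: x0 H1 H2; set x := _ / 2 => x0 H1 H2.
    have [the|thn] := eqVneq th 0.
      have ae : a = 1 by apply/eqP; rewrite eq_le a1; rewrite the mulr0 addr0 mulr1 in caseA.
      by rewrite /B ae the subrr !mul0r !powRr0 mulr0 subr0 powRr0 !mulr1 powRr1//; rewrite the powRr0 mulr1 in H2.
    have thp : 0 < th by rewrite lt0r thn.
    (* Forced by the exponents: [x] must come out with exponent 1 and [D] with exponent [a]. The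
       case assumption is exactly [w <= a]. *)
    pose w := (1 - a) / (q * th).
    have w0 : 0 <= w by rewrite divr_ge0 ?subr_ge0// mulr_ge0// ltW.
    have wa : 0 <= a - w.
      by rewrite subr_ge0 /w ler_pdivrMr ?mulr_gt0//; lra.
    have E : w * (q * th + 1) + (a - w) = 1 by rewrite /w; field; rewrite !gt_eqF.
    have -> : x = (x `^ (q * th + 1)) `^ w * x `^ (a - w).
      by rewrite -powRrM (mulrC _ w) -powRD ?E ?oner_eq0// powRr1.
    apply: le_trans (ler_pM (powR_ge0 _ _) (powR_ge0 _ _) (le_powRl w0 (powR_ge0 _ _) H1) (le_powRl wa x0 H2)) _.
    rewrite !powRM ?powR_ge0// -!powRrM.
    have -> : th * w = (1 - a) / q by rewrite /w; field; rewrite !gt_eqF.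
    have -> : th * (a - w) = a * th - (1 - a) / q by rewrite /w; field; rewrite !gt_eqF.
    rewrite /B mulrACA -powRD; last by rewrite addrC subrK gt_eqF.
    by rewrite [w + _]addrC subrK mulrA.
  apply: (@le_trans _ _ (\int[leb]_(t in `]a0, b0[) (2 `^ tau * B `^ tau)%:E)%E).
    apply: ae_int => //.
      by move=> t; rewrite lee_fin mulr_ge0 ?powR_ge0.
    move=> t Lt; rewrite lee_fin GE// ler_wpM2l ?powR_ge0// le_powRl ?(ltW tau0)//.
    + exact: x0.
    + exact: xB.
  rewrite (@integral_cst _ _ _ leb _ mab) [X in (_ * X)%E]lab -EFinM lee_fin /B.
  rewrite !powRM ?mulr_ge0 ?powR_ge0// -!powRrM.
  rewrite (_ : 1 + _ - _ = (a * th - (1 - a) / q) * tau + 1); last by field; rewrite gt_eqF.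
  have -> : l `^ ((a * th - (1 - a) / q) * tau + 1) = l `^ ((a * th - (1 - a) / q) * tau) * l.
    by rewrite powRD ?(gt_eqF l0) ?implybT// powRr1// ltW.
  rewrite (_ : (1 - a) / q * tau = (1 - a) * tau / q); last by rewrite mulrAC.
  by rewrite le_eqVlt; apply/orP; left; apply/eqP; ring.
(* The exponent left when [x^((q th + 1) a tau)] is split off from [x^tau]. *)
pose k := tau * (1 - a - a * q * th).
have aqt : 0 <= a * (q * th) by rewrite !mulr_ge0// ltW.
have aL1 : a < 1 by lra.
have k0 : 0 < k by rewrite /k mulr_gt0//; lra.
apply: (@le_trans _ _ (\int[leb]_(t in `]a0, b0[)
    ((2 `^ tau * (D * Y `^ th) `^ (a * tau))%:E * (`|F t| `^ k)%:E))%E).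
  apply: ae_int.
  - exact: measurable_funeM.
  - by move=> t; rewrite -EFinM lee_fin !mulr_ge0 ?powR_ge0.
  - move=> t Lt; rewrite -EFinM lee_fin GE// -mulrA ler_wpM2l ?powR_ge0//.
    have {}x0 := x0 _ Lt; have H1 := oscillation_powR_le Lt.
    have xF : (`|F t| - absinf) / 2 <= `|F t| by have := absinf_ge0; have := normr_ge0 (F t); lra.
    move: x0 H1 xF; set x := _ / 2 => x0 H1 xF.
    have E : (q * th + 1) * (a * tau) + k = tau by rewrite /k; ring.
    rewrite -{1}E powRD; last by rewrite E gt_eqF.
    rewrite powRrM ler_pM ?powR_ge0//.
      by rewrite le_powRl ?powR_ge0// mulr_ge0 ?(ltW ap) ?(ltW tau0).
    by rewrite le_powRl// (ltW k0).
rewrite (@ge0_integralZl_EFin _ _ _ leb _ mab)//; last 2 first.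
- exact: mp.
- by rewrite mulr_ge0 ?powR_ge0.
have mFn : measurable_fun (`]a0, b0[%classic : set R) (fun y => `|F y|).
  by apply: measurable_funTS; exact: measurableT_comp.
have := @power_mean _ _ _ leb _ (fun y => `|F y|) k q l Y mab mFn (fun _ _ => normr_ge0 _) k0 hk l0 Y0.
rewrite [X in (X <= _)%E -> _]lab lexx => /(_ isT hY) H.
apply: le_trans (lee_wpmul2l _ H) _; first by rewrite lee_fin mulr_ge0 ?powR_ge0.
rewrite -EFinM lee_fin powRM ?powR_ge0// -powRrM.
have -> : 1 - k / q = 1 + a * th * tau - (1 - a) * tau / q by rewrite /k; field; rewrite gt_eqF.
have -> : Y `^ ((1 - a) * tau / q) = Y `^ (th * (a * tau)) * Y `^ (k / q).
  have Ek : (1 - a) * tau / q = th * (a * tau) + k / q by rewrite /k; field; rewrite gt_eqF.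
  by rewrite -powRD -?Ek// gt_eqF// divr_gt0// mulr_gt0// subr_gt0.
by rewrite le_eqVlt; apply/orP; left; apply/eqP; ring.
Qed.

End local_interpolation.

(** * Transfer of the infimum between neighbouring intervals *)

Section adjacent_averages.
Context {R : realType}.
Local Notation leb := (@lebesgue_measure R).

(** Convexity of the power at [x / k] and [y / (1 - k)] with weights [k] and [1 - k]. The weight
    stays free so that the coefficient of [x] can be matched to the contraction between shells. *)
Lemma powRD_le (x y k r : R) : 0 <= x -> 0 <= y -> 0 < k -> k < 1 -> 1 <= r ->
  (x + y) `^ r <= k `^ (1 - r) * x `^ r + (1 - k) `^ (1 - r) * y `^ r.
Proof.
move=> x0 y0 k0 k1 r1; have k1' : 0 < 1 - k by rewrite subr_gt0.
pose k01 : {i01 R} := Itv01 (ltW k0) (ltW k1).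
have xk : 0 <= x / k by rewrite divr_ge0// ltW.
have yk : 0 <= y / (1 - k) by rewrite divr_ge0// ltW.
have := @convex_powR R r r1 k01 (x / k) (y / (1 - k)).
rewrite !inE/= !in_itv/= !andbT => /(_ xk yk).
move=> H; rewrite convRE [X in X `^ _ <= _]convRE /= /unstable.onem in H.
have E (c z : R) : 0 < c -> 0 <= z -> c * (z / c) `^ r = c `^ (1 - r) * z `^ r.
  move=> c0 z0; rewrite powRM ?invr_ge0 ?(ltW c0)// -[c^-1](powR_inv1 (ltW c0)) -powRrM mulN1r.
  have -> : c `^ (1 - r) = c * c `^ (- r).
    by rewrite powRD ?(gt_eqF c0) ?implybT// powRr1// ltW.
  by ring.
rewrite -!E//; apply: le_trans H.
by rewrite [k * _]mulrC divfK ?(gt_eqF k0)// [(1 - k) * _]mulrC divfK ?(gt_eqF k1')// lexx.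
Qed.

Variables (F : R -> R) (a0 b0 D th : R) (L : set R).
Hypotheses (ab : a0 < b0) (D0 : 0 <= D) (th0 : 0 <= th).
Hypotheses (mF : measurable_fun setT F) (LJ : forall t, L t -> a0 < t < b0).
Hypothesis aeL : {ae leb, forall t, a0 < t < b0 -> L t}.
Hypothesis osc : forall s t, L s -> L t -> `|F s - F t| <= D * `|s - t| `^ th.

Let mFq (r : R) (A : set R) : measurable_fun A (fun y => (`|F y| `^ r)%:E).
Proof.
apply/measurable_EFinP; apply: measurable_funTS.
by apply: (measurableT_comp (measurable_powR _)); exact: measurableT_comp.
Qed.

(** Needed when [a = 1], where no bound on the [L^q] norm is given: a Hölder profile is bounded on a
    bounded interval. *)
Lemma integral_powR_bounded q : 0 <= q ->
  exists2 Y, 0 <= Y & (\int[leb]_(t in `]a0, b0[) (`|F t| `^ q)%:E <= Y%:E)%E.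
Proof.
move=> q0; pose M := absinf F L + D * (b0 - a0) `^ th.
exists (M `^ q * (b0 - a0)); first by rewrite mulr_ge0 ?powR_ge0// subr_ge0 ltW.
have mab : measurable (`]a0, b0[%classic : set (measurableTypeR R)) by exact: measurable_itv.
have E : leb `]a0, b0[%classic = (b0 - a0)%:E by rewrite lebesgue_measure_itv/= lte_fin ab EFinB.
rewrite EFinM -[X in (_ <= _ * X)%E]E -(@integral_cst _ _ _ leb _ mab).
apply: (@ae_ge0_le_integral _ _ _ leb _ mab).
- by move=> y _; rewrite lee_fin powR_ge0.
- exact: mFq.
- by move=> y _; rewrite lee_fin powR_ge0.
- exact: measurable_cst.
have [N [mN N0 LN]] := aeL; exists N; split => // y /= H; apply: LN => /= Ly.
apply: H; rewrite in_itv/= => /Ly {}Ly; rewrite lee_fin le_powRl//.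
by have := oscillation_le ab D0 th0 LJ aeL osc Ly; rewrite /M lerBlDl.
Qed.

(** [|F|] is split into its infimum and the deviation; the [tau]-th power of the infimum is at most
    the mean of [|F|^tau] over any subinterval. No order is imposed between the two intervals, so
    the recursion can run in either direction. *)
Lemma adjacent_averages (c e c' e' k tau : R) : 0 < k -> k < 1 -> 1 <= tau ->
  a0 < c -> c < e -> e <= b0 -> a0 < c' -> c' < e' -> e' <= b0 ->
  (\int[leb]_(t in `[c, e[) (`|F t| `^ tau)%:E <=
   (k `^ (1 - tau) * ((e - c) / (e' - c')))%:E * \int[leb]_(t in `[c', e'[) (`|F t| `^ tau)%:E
   + ((1 - k) `^ (1 - tau))%:E *
     \int[leb]_(t in `]a0, b0[) (`| `|F t| - absinf F L | `^ tau)%:E)%E.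
Proof.
move=> k0 k1 tau1 ac ce eb ac' ce' eb'.
have tau0 : 0 < tau by rewrite (lt_le_trans ltr01).
have m0 : 0 <= absinf F L by exact: absinf_ge0 ab aeL.
have mI x y : measurable (`[x, y[%classic : set (measurableTypeR R)) by exact: measurable_itv.
have mab : measurable (`]a0, b0[%classic : set (measurableTypeR R)) by exact: measurable_itv.
have lI x y : x < y -> leb `[x, y[%classic = (y - x)%:E.
  by move=> xy; rewrite lebesgue_measure_itv/= lte_fin xy EFinB.
have sub x y : a0 < x -> y <= b0 -> `[x, y[%classic `<=` (`]a0, b0[%classic : set R).
  move=> ax yb t /=; rewrite !in_itv/= => /andP[xt ty].
  by rewrite (lt_le_trans ax xt) (lt_le_trans ty yb).
have mG (A : set R) : measurable_fun A (fun y => (`| `|F y| - absinf F L | `^ tau)%:E).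
  apply/measurable_EFinP; apply: measurable_funTS.
  apply: (measurableT_comp (measurable_powR _)); apply: measurableT_comp => //.
  by apply: measurable_funB => //; exact: measurableT_comp.
have k1' : 0 < 1 - k by rewrite subr_gt0.
have ae_int x y (h1 h2 : R -> \bar R) : a0 < x -> y <= b0 ->
    measurable_fun (`[x, y[%classic : set R) h1 -> measurable_fun (`[x, y[%classic : set R) h2 ->
    (forall t, 0 <= h1 t)%E -> (forall t, 0 <= h2 t)%E ->
    (forall t, L t -> (h1 t <= h2 t)%E) ->
    (\int[leb]_(t in `[x, y[) h1 t <= \int[leb]_(t in `[x, y[) h2 t)%E.
  move=> ax yb mh1 mh2 h10 h20 Gh; apply: (@ae_ge0_le_integral _ _ _ leb _ (mI _ _)).
  - by move=> t _.
  - exact: mh1.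
  - by move=> t _.
  - exact: mh2.
  - have [N [mN N0 LN]] := aeL; exists N; split => // t /= H; apply: LN => /= Lt.
    by apply: H => /(sub _ _ ax yb); rewrite /= in_itv/= => /Lt/Gh.
have lower : ((absinf F L `^ tau * (e' - c'))%:E <=
    \int[leb]_(t in `[c', e'[) (`|F t| `^ tau)%:E)%E.
  rewrite EFinM -[X in (_ * X <= _)%E](lI _ _ ce') -(@integral_cst _ _ _ leb _ (mI _ _)).
  apply: ae_int => //.
  - by move=> t; rewrite lee_fin powR_ge0.
  - move=> t Lt; rewrite lee_fin le_powRl ?(ltW tau0)//.
    exact: absinf_le ab aeL t Lt.
apply: (@le_trans _ _ (\int[leb]_(t in `[c, e[)
   ((k `^ (1 - tau) * absinf F L `^ tau)%:E +
    ((1 - k) `^ (1 - tau))%:E * (`| `|F t| - absinf F L | `^ tau)%:E))%E).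
  apply: ae_int => //.
  - by apply: emeasurable_funD => //; exact: measurable_funeM.
  - by move=> t; rewrite -EFinM -EFinD lee_fin addr_ge0// mulr_ge0 ?powR_ge0.
  - move=> t Lt; rewrite -EFinM -EFinD lee_fin.
    have mt : 0 <= `|F t| - absinf F L by rewrite subr_ge0; exact: absinf_le ab aeL t Lt.
    have := powRD_le m0 mt k0 k1 tau1.
    by rewrite [absinf F L + _]addrC subrK (ger0_norm mt).
rewrite (@ge0_integralD _ _ _ leb _ (mI _ _))//; last 3 first.
- by move=> t _; rewrite lee_fin mulr_ge0 ?powR_ge0.
- by move=> t _; rewrite -EFinM lee_fin mulr_ge0 ?powR_ge0.
- by apply: measurable_funeM; exact: mG.
rewrite (@integral_cst _ _ _ leb _ (mI _ _)) (@ge0_integralZl_EFin _ _ _ leb _ (mI _ _))//; last 2 first.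
- exact: mG.
- exact: powR_ge0.
apply: leeD.
  rewrite [X in (_ * X <= _)%E](lI _ _ ce).
  apply: le_trans (lee_wpmul2l _ lower); last first.
    by rewrite lee_fin mulr_ge0 ?powR_ge0// divr_ge0// subr_ge0 ltW.
  rewrite -!EFinM lee_fin le_eqVlt; apply/orP; left; apply/eqP.
  by field; rewrite subr_eq0 gt_eqF.
apply: lee_wpmul2l; first by rewrite lee_fin powR_ge0.
apply: (@ge0_subset_integral _ _ _ leb _ _ (mI _ _) mab _ (mG _) _ (sub _ _ ac eb)) => t _.
by rewrite lee_fin powR_ge0.
Qed.

End adjacent_averages.

(** * Dyadic shells *)

Section profile_holder.
Context {R : realType} {d : nat}.
Local Notation E := 'rV[R]_d.
Local Notation mu := (@lebesgue_rV R d).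
Local Notation leb := (@lebesgue_measure R).
Local Notation cb := (@vball R d).
Hypothesis d0 : (0 < d)%N.

Lemma enorm_powR (x : E) s : enorm x `^ s = rho x `^ (s / d%:R).
Proof.
rewrite /rho -powR_mulrn ?enorm_ge0// -powRrM; congr (_ `^ _).
by rewrite mulrC divfK// pnatr_eq0 -lt0n.
Qed.

Lemma mu_annulus a b : 0 < a -> a <= b -> mu (annulus a b) = (cb * (b - a))%:E.
Proof.
move=> a0 ab; rewrite /annulus (mu_rho_preimage d0).
- have E : leb `[a, b]%classic = (b - a)%:E.
    rewrite lebesgue_measure_itv/= lte_fin -EFinB; case: ltP => // ba.
    by congr EFin; apply/esym/eqP; rewrite subr_eq0 eq_le ba.
  by rewrite [X in (_ * X)%E]E.
- exact: measurable_itv.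
- by move=> t /=; rewrite !in_itv/= andbT => /andP[/(le_trans (ltW a0))].
Qed.

Variables (u : E -> R) (g : E -> E) (F : R -> R).
Hypotheses (lu : Lp_loc 1 (punctured d) u) (ug : is_distr_gradient (punctured d) u g).
Hypotheses (mF : measurable_fun setT F) (uF : {ae mu, forall x, u x = F (rho x)}).

(** [power_mean] with exponent 1 on the annulus between [s] and [t], of volume proportional to
    [t - s], produces the exponent [1 - 1/p]. The factor [|x| / rho x] is a nonpositive power of
    [rho x], hence largest at the inner radius [a0]. *)
Lemma profile_holder a0 b0 p X : 0 < a0 -> 1 <= p -> 0 <= X ->
  (\int[mu]_(x in annulus a0 b0) (enorm (g x) `^ p)%:E <= X%:E)%E ->
  exists L : set R, [/\ (forall t, L t -> a0 < t < b0),
    {ae leb, forall t, a0 < t < b0 -> L t} &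
    forall s t, L s -> L t ->
      `|F s - F t| <= cb `^ (- p^-1) * a0 `^ (d%:R^-1 - 1) * X `^ p^-1 * `|s - t| `^ (1 - p^-1)].
Proof.
move=> a00 p1 X0 hX; have [aeL osc] := profile_oscillation d0 lu ug mF uF b0 a00.
have v0 : 0 < cb := vball_gt0 d0.
have p0 : 0 < p by rewrite (lt_le_trans ltr01).
exists [set t | a0 < t < b0 /\ lebesgue_pt (F \_ `[a0, b0]) t]; split.
- by move=> t [].
- have [N [mN N0 sN]] := aeL; exists N; split => // t /= H; apply: sN => /= lt;
  by apply: H => tab; split => //; exact: lt.
have main s t : lebesgue_pt (F \_ `[a0, b0]) s -> lebesgue_pt (F \_ `[a0, b0]) t ->
    a0 < s -> s < t -> t < b0 ->
    `|F s - F t| <= cb `^ (- p^-1) * a0 `^ (d%:R^-1 - 1) * X `^ p^-1 * `|s - t| `^ (1 - p^-1).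
  move=> ps pt as_ st tb; have H := osc s t ps pt as_ st tb.
  have s0 : 0 < s by exact: lt_trans as_.
  have mA := @measurable_annulus R d s t.
  have sub : @annulus R d s t `<=` annulus a0 b0.
    move=> x; rewrite !annulusE/= => /andP[h1 h2].
    by rewrite (le_trans (ltW as_) h1) (le_trans h2 (ltW tb)).
  have mg := measurable_enorm_gradient d0 ug s0 (b := t).
  have mgr (A : set E) (r : R) : measurable_fun A (fun x => enorm (g x)) ->
      measurable_fun A (fun x => (enorm (g x) `^ r)%:E).
    by move=> h; apply/measurable_EFinP; exact: (measurableT_comp (measurable_powR _)).
  have l0 : 0 < cb * (t - s) by rewrite mulr_gt0// subr_gt0.
  have hX' : (\int[mu]_(x in annulus s t) (enorm (g x) `^ p)%:E <= X%:E)%E.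
    apply: le_trans hX; apply: ge0_subset_integral => //.
    - exact: measurable_annulus.
    - apply: mgr; exact: (measurable_enorm_gradient d0 ug a00).
    - by move=> x _; rewrite lee_fin powR_ge0.
  have := @power_mean _ _ _ mu _ (fun x => enorm (g x)) 1 p _ X mA mg
     (fun _ _ => enorm_ge0 _) ltr01 p1 l0 X0.
  have mE : (mu (annulus s t) <= (cb * (t - s))%:E)%E by rewrite (mu_annulus s0 (ltW st)).
  move=> /(_ mE hX'); rewrite div1r.
  set lam := a0 `^ (d%:R^-1 - 1) => PM.
  have PM' : ((cb * `|F s - F t|)%:E <= lam%:E *
      ((cb * (t - s)) `^ (1 - p^-1) * X `^ p^-1)%:E)%E.
    apply: le_trans H _; apply: le_trans (lee_wpmul2l _ PM); last by rewrite lee_fin powR_ge0.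
    rewrite -(@ge0_integralZl_EFin _ _ _ mu _ mA); last 3 first.
    - by move=> x _; rewrite lee_fin powR_ge0.
    - exact: mgr.
    - exact: powR_ge0.
    apply: ge0_le_integral => //.
    - by move=> x _; rewrite lee_fin !mulr_ge0 ?enorm_ge0 ?invr_ge0 ?rho_ge0.
    - apply/measurable_EFinP; apply: measurable_funM => //; apply: measurable_funM.
        by apply: measurable_funTS; exact: measurable_enorm.
      by apply: measurable_funTS; exact: measurable_rhoV.
    - by apply: measurable_funeM; exact: mgr.
    move=> x; rewrite annulusE/= => /andP[sx xt].
    rewrite -EFinM lee_fin powRr1 ?enorm_ge0// mulrC ler_wpM2r ?enorm_ge0//.
    have rx : 0 < rho x by exact: lt_le_trans sx.
    have -> : enorm x / rho x = rho x `^ (d%:R^-1 - 1).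
      rewrite -{1}(powRr1 (enorm_ge0 x)) enorm_powR div1r powRB ?(gt_eqF rx) ?implybT//.
      by rewrite powRr1 ?ltW.
    have -> : d%:R^-1 - 1 = - (1 - d%:R^-1) :> R by ring.
    rewrite /lam [leRHS](_ : _ = a0 `^ - (1 - d%:R^-1)); last by congr (_ `^ _); ring.
    rewrite !powRN lef_pV2 ?posrE ?powR_gt0//.
    apply: le_powRl; [|exact: ltW|exact: le_trans (ltW as_) sx].
    by rewrite subr_ge0 invf_le1 ?ltr0n// ler1n.
  have st0 : 0 < t - s by rewrite subr_gt0.
  move: PM'; rewrite -EFinM lee_fin -ler_pdivlMl// => /le_trans; apply.
  rewrite (distrC s t) (gtr0_norm st0) powRM ?(ltW v0) ?(ltW st0)//.
  have -> : cb `^ (- p^-1) = cb^-1 * cb `^ (1 - p^-1).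
    by rewrite -(powR_inv1 (ltW v0)) -powRD ?(gt_eqF v0) ?implybT//; congr (_ `^ _); ring.
  by rewrite le_eqVlt; apply/orP; left; apply/eqP; ring.
move=> s t [/andP[as_ sb] ps] [/andP[at_ tb] pt].
have [st|ts|->] := ltgtP s t.
- exact: main.
- by rewrite distrC (distrC s); exact: main.
- by rewrite subrr normr0 !mulr_ge0 ?powR_ge0.
Qed.

End profile_holder.

Section dyadic_step.
Context {R : realType} {d : nat}.
Local Notation E := 'rV[R]_d.
Local Notation mu := (@lebesgue_rV R d).
Local Notation leb := (@lebesgue_measure R).
Local Notation cb := (@vball R d).
Hypothesis d0 : (0 < d)%N.

Lemma powR_window (e lam t : R) : 0 < lam -> lam / 2 <= t -> t <= 4 * lam ->
  t `^ e <= 4 `^ `|e| * lam `^ e.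
Proof.
move=> l0 lt tl.
have t0 : 0 < t by rewrite (lt_le_trans _ lt)// divr_gt0.
have -> : t `^ e = (t / lam) `^ e * lam `^ e.
  by rewrite -powRM ?divr_ge0 ?(ltW t0) ?(ltW l0)// divfK// gt_eqF.
rewrite ler_wpM2r ?powR_ge0//; have [e0|e0] := leP 0 e.
  rewrite (ger0_norm e0); apply: le_powRl => //; last by rewrite ler_pdivrMr.
  by rewrite divr_ge0// ltW.
have -> : (t / lam) `^ e = (lam / t) `^ (- e).
  rewrite -[lam / t]invf_div -[(t / lam)^-1]powR_inv1 ?divr_ge0 ?(ltW t0) ?(ltW l0)//.
  by rewrite -powRrM mulN1r opprK.
rewrite (ltr0_norm e0); apply: le_powRl; first by rewrite oppr_ge0 ltW.
  by rewrite divr_ge0// ltW.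
by rewrite ler_pdivrMr//; lra.
Qed.

Lemma scale_affine_le (I I' J : \bar R) (c m n z : R) : 0 <= c -> 0 <= m -> 0 <= n ->
  (0 <= I')%E -> (0 <= J)%E -> (I <= m%:E * I' + n%:E * J)%E -> (c%:E * J <= z%:E)%E ->
  (c%:E * I <= (c * m)%:E * I' + (n * z)%:E)%E.
Proof.
move=> c0 m0 n0 I0 J0 H Jz; apply: (@le_trans _ _ (c%:E * (m%:E * I' + n%:E * J))%E).
  by apply: lee_wpmul2l; rewrite ?lee_fin.
rewrite ge0_muleDr; [|exact: mule_ge0..].
apply: leeD; first by rewrite EFinM muleA.
by rewrite muleCA EFinM; apply: lee_wpmul2l; rewrite ?lee_fin.
Qed.

(** Lets one constant serve both directions of the recursion, with [b] the ratio of the weights of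
    two consecutive shells. *)
Lemma constant_split (b m c z : R) : 0 <= b -> 0 <= m * (c * z) ->
  m * (c * z) <= (1 + b) * m * c * z /\ m * (b * (c * z)) <= (1 + b) * m * c * z.
Proof.
move=> b0 X0; have bX := mulr_ge0 b0 X0.
have -> : m * (b * (c * z)) = b * (m * (c * z)) by ring.
have -> : (1 + b) * m * c * z = m * (c * z) + b * (m * (c * z)) by ring.
by rewrite lerDl lerDr.
Qed.

(** The window from [lam / 2] to [4 lam] holds two consecutive shells and begins strictly before the
    first, as [adjacent_averages] requires. *)
Lemma dyadic_windows (lam : R) : 0 < lam ->
  [/\ lam / 2 < lam, lam / 2 < 2 * lam, lam < 2 * lam, 2 * lam < 2 * (2 * lam) &
      2 * lam <= 4 * lam /\ 2 * (2 * lam) <= 4 * lam].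
Proof. by move=> l0; split; [| | | |split]; lra. Qed.

Definition weighted_power (s p : R) (f : E -> R) (z : E) : \bar R :=
  (`|enorm z `^ s * f z| `^ p)%:E.

Lemma weighted_power_ge0 s p f z : (0 <= weighted_power s p f z)%E.
Proof. by rewrite lee_fin powR_ge0. Qed.

Lemma measurable_weighted_power s p f D : measurable_fun D f ->
  measurable_fun D (weighted_power s p f).
Proof.
move=> mf; apply/measurable_EFinP; apply: (measurableT_comp (measurable_powR _)).
apply: measurableT_comp => //; apply: measurable_funM => //.
apply: measurable_funTS; apply: (measurableT_comp (measurable_powR _)).
exact: measurable_enorm.
Qed.

Lemma integral_unweight (s p lam x : R) (f : E -> R) : 0 < lam ->
  measurable_fun (annulus (lam / 2) (4 * lam)) f ->
  (\int[mu]_(z in annulus (lam / 2) (4 * lam)) weighted_power s p f z <= x%:E)%E ->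
  (\int[mu]_(z in annulus (lam / 2) (4 * lam)) (`|f z| `^ p)%:E <=
    (4 `^ `|s * p / d%:R| * lam `^ (- (s * p / d%:R)) * x)%:E)%E.
Proof.
move=> l0 mf hx; have mA := @measurable_annulus R d (lam / 2) (4 * lam).
set K := 4 `^ _ * _.
have K0 : 0 <= K by rewrite mulr_ge0 ?powR_ge0.
apply: (@le_trans _ _ (\int[mu]_(z in annulus (lam / 2) (4 * lam)) (K%:E * weighted_power s p f z))%E).
  apply: ge0_le_integral => //.
  - apply/measurable_EFinP; apply: (measurableT_comp (measurable_powR _)).
    exact: measurableT_comp.
  - by apply: measurable_funeM; exact: measurable_weighted_power.
  move=> z; rewrite annulusE /= => /andP[lz zl].
  rewrite /weighted_power -EFinM lee_fin normrM (ger0_norm (powR_ge0 _ _)).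
  have z0 : 0 < rho z by rewrite (lt_le_trans _ lz)// divr_gt0.
  rewrite powRM ?powR_ge0// -powRrM enorm_powR// mulrA -[leLHS]mul1r ler_wpM2r ?powR_ge0//.
  have := powR_window (- (s * p / d%:R)) l0 lz zl; rewrite normrN -/K => H.
  apply: (le_trans _ (ler_wpM2r (powR_ge0 _ _) H)).
  by rewrite powRN mulVf ?gt_eqF ?powR_gt0.
rewrite ge0_integralZl_EFin//; last 2 first.
- by move=> z _; exact: weighted_power_ge0.
- exact: measurable_weighted_power.
by rewrite [leRHS]EFinM; apply: lee_wpmul2l.
Qed.

(** The weight is frozen at the left end of the shell, so that consecutive masses compare by exact
    powers of 2. *)
Definition dyadic_mass (e tau : R) (F : R -> R) (lam : R) : \bar R :=
  ((lam `^ e)%:E * \int[leb]_(t in `[lam, (2 * lam)%R[) (`|F t| `^ tau)%:E)%E.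

Variables p q tau a alpha beta gamma k : R.
Hypotheses (p1 : 1 <= p) (q1 : 1 <= q) (tau1 : 1 <= tau) (a0 : 0 < a) (a1 : a <= 1).
Hypotheses (k0 : 0 < k) (k1 : k < 1).
Hypothesis hbalance : tau^-1 + gamma / d%:R =
  a * (p^-1 + (alpha - 1) / d%:R) + (1 - a) * (q^-1 + beta / d%:R).
Hypothesis hlocal : tau * (1 - a - a * q * (1 - p^-1)) <= q.
Let T := tau^-1 + gamma / d%:R.

Lemma dyadic_step : exists2 C, 0 < C & forall (u : E -> R) g F lam x y,
  Lp_loc 1 (punctured d) u -> is_distr_gradient (punctured d) u g ->
  measurable_fun setT F -> {ae mu, forall z, u z = F (rho z)} ->
  0 < lam -> 0 <= x -> 0 <= y ->
  (\int[mu]_(z in annulus (lam / 2) (4 * lam)) weighted_power alpha p (enorm \o g) z <= x%:E)%E ->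
  (a < 1 -> (\int[mu]_(z in annulus (lam / 2) (4 * lam)) weighted_power beta q u z <= y%:E)%E) ->
  (dyadic_mass (gamma * tau / d%:R) tau F lam <=
    (k `^ (1 - tau) * 2 `^ (- (T * tau)))%:E * dyadic_mass (gamma * tau / d%:R) tau F (2 * lam) +
    (C * (x `^ (a * tau / p) * y `^ ((1 - a) * tau / q)))%:E /\
   dyadic_mass (gamma * tau / d%:R) tau F (2 * lam) <=
    (k `^ (1 - tau) * 2 `^ (T * tau))%:E * dyadic_mass (gamma * tau / d%:R) tau F lam +
    (C * (x `^ (a * tau / p) * y `^ ((1 - a) * tau / q)))%:E)%E.
Proof.
have v0 : 0 < cb := vball_gt0 d0.
have p0 : 0 < p by rewrite (lt_le_trans ltr01).
have q0 : 0 < q by rewrite (lt_le_trans ltr01).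
have tau0 : 0 < tau by rewrite (lt_le_trans ltr01).
have dR : 0 < d%:R :> R by rewrite ltr0n.
pose A := alpha * p / d%:R; pose B := beta * q / d%:R.
(* [e1] is the exponent of the interval length in [local_interpolation]; [D1] and [e2] give the
   Hölder constant on the window as a multiple of a power of [lam]; [KB] turns the weighted norm of
   [u] into the [L^q] mass of the profile. In [C0], [7 / 2] is the length of the window divided by
   [lam]. *)
pose e1 := 1 + a * (1 - p^-1) * tau - (1 - a) * tau / q.
pose D1 := cb `^ (- p^-1) * 2^-1 `^ (d%:R^-1 - 1) * (4 `^ `|A|) `^ p^-1.
pose e2 := d%:R^-1 - 1 - A / p.
pose KB := 4 `^ `|B| / cb.
pose r := (1 - a) * tau / q.
pose C0 := 2 `^ tau * (7 / 2) `^ e1 * D1 `^ (a * tau) * KB `^ r.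
pose G := gamma * tau / d%:R.
have D10 : 0 < D1 by rewrite !mulr_gt0 ?powR_gt0.
have KB0 : 0 < KB by rewrite divr_gt0 ?powR_gt0.
have C00 : 0 < C0 by rewrite !mulr_gt0 ?powR_gt0// divr_gt0.
exists ((1 + 2 `^ G) * (1 - k) `^ (1 - tau) * C0).
  by rewrite !mulr_gt0 ?powR_gt0 ?subr_gt0// addr_gt0 ?powR_gt0.
move=> u g F lam x y lu ug mF uF l0 x0 y0 hx hy; rewrite -/G -/r.
have mu_ (D : set E) : measurable_fun D u -> measurable_fun D (fun z => (`|u z| `^ q)%:E).
  move=> mu_; apply/measurable_EFinP; apply: (measurableT_comp (measurable_powR _)).
  exact: measurableT_comp.
have l20 : 0 < lam / 2 by rewrite divr_gt0.
have hX := integral_unweight l0 (measurable_enorm_gradient d0 ug l20) hx.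
rewrite -/A in hX.
have X0 : 0 <= 4 `^ `|A| * lam `^ (- A) * x by rewrite !mulr_ge0 ?powR_ge0.
have hX' : (\int[mu]_(z in annulus (lam / 2) (4 * lam)) (enorm (g z) `^ p)%:E <=
    (4 `^ `|A| * lam `^ (- A) * x)%:E)%E.
  apply: le_trans hX; under [leRHS]eq_integral do rewrite ger0_norm ?enorm_ge0//.
  exact: lexx.
have [L [LJ aeL osc]] := profile_holder d0 lu ug mF uF l20 p1 X0 hX'.
pose D := D1 * lam `^ e2 * x `^ p^-1.
have oscD s t : L s -> L t -> `|F s - F t| <= D * `|s - t| `^ (1 - p^-1).
  move=> Ls Lt; apply: le_trans (osc s t Ls Lt) _; rewrite ler_wpM2r ?powR_ge0//.
  rewrite /D /D1 /e2 !powRM ?mulr_ge0 ?powR_ge0 ?(ltW l0) ?invr_ge0// -[(lam `^ _) `^ _]powRrM.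
  rewrite [lam `^ (_ - _ - _)]powRD ?(gt_eqF l0) ?implybT// mulNr.
  by rewrite le_eqVlt; apply/orP; left; apply/eqP; ring.
have D0 : 0 <= D by rewrite !mulr_ge0 ?powR_ge0// ltW.
have th0 : 0 <= 1 - p^-1 by rewrite subr_ge0 invf_le1.
have ab : lam / 2 < 4 * lam by lra.
have [Y Y0 [hY Yr]] : exists2 Y, 0 <= Y &
    (\int[leb]_(t in `](lam / 2)%R, (4 * lam)%R[) (`|F t| `^ q)%:E <= Y%:E)%E /\
    Y `^ r <= KB `^ r * lam `^ (- B * r) * y `^ r.
  have [a1'|a1'] := ltP a 1; last first.
    (* For [a = 1] any finite [Y] will do, since its exponent [r] is 0. *)
    have [Y Y0 hY] := integral_powR_bounded ab D0 th0 mF LJ aeL oscD (ltW q0).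
    exists Y => //; split => //.
    have -> : r = 0 by rewrite /r (_ : a = 1) ?subrr ?mul0r//; apply/eqP; rewrite eq_le a1.
    by rewrite !mulr0 !powRr0 !mulr1.
  exists (KB * lam `^ (- B) * y).
    exact: mulr_ge0 (mulr_ge0 (ltW KB0) (powR_ge0 _ _)) y0.
  have KB0' := ltW KB0; split; last first.
    by rewrite (powRM _ (mulr_ge0 KB0' (powR_ge0 _ _)) y0) (powRM _ KB0' (powR_ge0 _ _)) -powRrM.
  have mul_ : measurable_fun (annulus (lam / 2) (4 * lam)) u.
    by apply: measurable_funS lu.1; [exact: measurable_punctured|exact: annulus_punctured].
  have := integral_unweight l0 mul_ (hy a1'); rewrite -/B.
  have mJ : measurable (`[(lam / 2)%R, (4 * lam)%R]%classic : set (measurableTypeR R)) by exact: measurable_itv.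
  have mJo : measurable (`](lam / 2)%R, (4 * lam)%R[%classic : set (measurableTypeR R)) by exact: measurable_itv.
  have J0 : (`[(lam / 2)%R, (4 * lam)%R]%classic : set R) `<=` `[0, +oo[%classic.
    by move=> t /=; rewrite !in_itv/= andbT => /andP[/(le_trans (ltW l20))].
  have mFq (S : set R) : measurable_fun S (fun t => (`|F t| `^ q)%:E).
    apply/measurable_EFinP; apply: measurable_funTS.
    by apply: (measurableT_comp (measurable_powR _)); exact: measurableT_comp.
  have := ge0_integral_rho d0 mJ J0 (mFq _) (fun t _ => powR_ge0 _ _ : (0 <= (`|F t| `^ q)%:E)%E).
  rewrite [LHS](_ : _ = \int[mu]_(z in annulus (lam / 2) (4 * lam)) (`|u z| `^ q)%:E)%E; last first.
    apply: ae_eq_integral.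
    - exact: measurable_annulus.
    - have := measurable_comp mJ _ (mFq _) (@measurable_funTS _ _ _ _ (@rho R d @^-1` `[(lam / 2)%R, (4 * lam)%R]%classic) _ measurable_rho).
      by apply; move=> _ /= [z zD <-].
    - exact: mu_.
    - by apply: filterS uF => z -> _.
  move=> -> H.
  have sJ : `](lam / 2)%R, (4 * lam)%R[%classic `<=` (`[(lam / 2)%R, (4 * lam)%R]%classic : set R).
    exact: subset_itv_oo_cc.
  apply: le_trans (@ge0_subset_integral _ _ _ leb _ _ mJo mJ _ (mFq _) _ sJ) _.
    by move=> t _; rewrite lee_fin powR_ge0.
  rewrite -lee_pdivlMl ?lte_fin// -EFinM in H.
  apply: le_trans H _; rewrite lee_fin /KB.
  by rewrite le_eqVlt; apply/orP; left; apply/eqP; ring.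
have LI := local_interpolation ab D0 th0 q1 Y0 mF LJ aeL oscD hY a0 a1 tau1 hlocal.
set EG := (\int[leb]_(t in _) _)%E in LI.
have EGle : ((lam `^ G)%:E * EG <= (C0 * (x `^ (a * tau / p) * y `^ r))%:E)%E.
  apply: le_trans (lee_wpmul2l _ LI) _; first by rewrite lee_fin powR_ge0.
  rewrite -EFinM lee_fin.
  rewrite (_ : 4 * lam - lam / 2 = 7 / 2 * lam); last by field.
  have h72 : 0 <= 7 / 2 :> R by rewrite divr_ge0.
  rewrite -/e1 -/r (powRM _ h72 (ltW l0)).
  have -> : D `^ (a * tau) = D1 `^ (a * tau) * lam `^ (e2 * (a * tau)) * x `^ (a * tau / p).
    rewrite /D (powRM _ (mulr_ge0 (ltW D10) (powR_ge0 _ _)) (powR_ge0 _ _)).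
    by rewrite (powRM _ (ltW D10) (powR_ge0 _ _)) -2!powRrM [p^-1 * _]mulrC.
  (* All powers of [lam] cancel: this is where the balance condition enters, as invariance under
     dilation. *)
  have lE : lam `^ G * (lam `^ e1 * lam `^ (e2 * (a * tau)) * lam `^ (- B * r)) = 1.
    rewrite -!powRD ?(gt_eqF l0) ?implybT//.
    rewrite [X in lam `^ X](_ : _ = 0) ?powRr0//.
    have -> : G = tau * (a * (p^-1 + (alpha - 1) / d%:R) + (1 - a) * (q^-1 + beta / d%:R)) - 1.
      by rewrite -hbalance /G; field; rewrite !gt_eqF.
    by rewrite /e1 /e2 /A /B /r; field; rewrite !gt_eqF.
  apply: (@le_trans _ _ (lam `^ G * (2 `^ tau * ((7 / 2) `^ e1 * lam `^ e1) *
    (D1 `^ (a * tau) * lam `^ (e2 * (a * tau)) * x `^ (a * tau / p)) *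
    (KB `^ r * lam `^ (- B * r) * y `^ r)))).
    by rewrite !ler_wpM2l ?mulr_ge0 ?powR_ge0.
  rewrite [leLHS](_ : _ = (lam `^ G * (lam `^ e1 * lam `^ (e2 * (a * tau)) * lam `^ (- B * r))) *
     (C0 * (x `^ (a * tau / p) * y `^ r))); last by rewrite /C0; ring.
  by rewrite lE mul1r.
(* Doubling [lam] doubles the length and multiplies the weight by [2^G], together [2^(T tau)]. *)
have Tt : T * tau = 1 + G by rewrite /T /G; field; rewrite !gt_eqF.
have EG0 : (0 <= EG)%E by apply: integral_ge0 => t _; rewrite lee_fin powR_ge0.
have [aL aL2 L2 L4 [Lb Lb2]] := dyadic_windows l0.
have z0 : 0 <= x `^ (a * tau / p) * y `^ r by rewrite mulr_ge0 ?powR_ge0.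
have G2 : 0 < 2 `^ G :> R by rewrite powR_gt0.
have k1' : 0 <= (1 - k) `^ (1 - tau) by rewrite powR_ge0.
set z := x `^ _ * _ in EGle z0 *.
have I0 c e : (0 <= \int[leb]_(t in `[c, e[) (`|F t| `^ tau)%:E)%E.
  by apply: integral_ge0 => t _; rewrite lee_fin powR_ge0.
have n20 : 2 != 0 :> R by rewrite pnatr_eq0.
have h2p : 2 `^ (T * tau) = 2 * 2 `^ G by rewrite Tt powRD ?n20 ?implybT// powRr1.
have h2m : 2 `^ (- (T * tau)) = 2^-1 * (2 `^ G)^-1 by rewrite powRN h2p invfM.
have ratio1 : 2 * lam - lam = lam by ring.
have ratio2 : 2 * (2 * lam) - 2 * lam = 2 * lam by ring.
have lG0 : 0 <= lam `^ G by exact: powR_ge0.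
have lG2 : (2 * lam) `^ G = 2 `^ G * lam `^ G by rewrite powRM// ltW.
have Ck : 0 <= (1 - k) `^ (1 - tau) * (C0 * z) by rewrite mulr_ge0// mulr_ge0// ltW.
have l20' : 0 < 2 * lam by exact: mulr_gt0.
split.
  have H := adjacent_averages ab mF aeL k0 k1 tau1 aL L2 Lb aL2 L4 Lb2.
  rewrite -/EG ratio1 ratio2 in H.
  have m0 : 0 <= k `^ (1 - tau) * (lam / (2 * lam)).
    by rewrite mulr_ge0 ?powR_ge0// divr_ge0 ?(ltW l0) ?(ltW l20').
  apply: le_trans (scale_affine_le lG0 m0 k1' (I0 _ _) EG0 H EGle) _.
  rewrite /dyadic_mass muleA -EFinM; apply: leeD; last first.
    by rewrite lee_fin; exact: (constant_split (ltW G2) Ck).1.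
  apply: lee_wpmul2r; first exact: I0.
  rewrite lee_fin h2m lG2 le_eqVlt; apply/orP; left; apply/eqP.
  by field; rewrite ?gt_eqF.
have H := adjacent_averages ab mF aeL k0 k1 tau1 aL2 L4 Lb2 aL L2 Lb.
rewrite -/EG ratio1 ratio2 in H.
have m0 : 0 <= k `^ (1 - tau) * (2 * lam / lam).
  by rewrite mulr_ge0 ?powR_ge0// divr_ge0 ?(ltW l0) ?(ltW l20').
have EGle2 : (((2 * lam) `^ G)%:E * EG <= (2 `^ G * (C0 * z))%:E)%E.
  by rewrite lG2 !EFinM -muleA; apply: lee_wpmul2l; rewrite ?lee_fin ?powR_ge0// -EFinM.
apply: le_trans (scale_affine_le (powR_ge0 _ _) m0 k1' (I0 _ _) EG0 H EGle2) _.
rewrite /dyadic_mass muleA -EFinM; apply: leeD; last first.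
  by rewrite lee_fin; exact: (constant_split (ltW G2) Ck).2.
apply: lee_wpmul2r; first exact: I0.
rewrite lee_fin h2p lG2 le_eqVlt; apply/orP; left; apply/eqP.
by field; rewrite gt_eqF.
Qed.

End dyadic_step.

(** * Summing over shells with bounded overlap *)

Section dyadic_sums.
Context {R : realType} {d : nat}.
Local Notation E := 'rV[R]_d.
Local Notation mu := (@lebesgue_rV R d).
Local Notation leb := (@lebesgue_measure R).

Lemma recursion_sum (w : nat -> \bar R) (z : nat -> R) (k C : R) : 0 <= k -> k < 1 ->
  w 0%N = 0%E -> (forall i, 0 <= w i)%E -> (forall i, w i.+1 <= k%:E * w i + (C * z i)%:E)%E ->
  forall n, (\sum_(i < n.+1) w i <= (C / (1 - k) * \sum_(i < n) z i)%:E)%E.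
Proof.
move=> k0 k1 w0 wge0 wS n.
have k1' : 0 < 1 - k by rewrite subr_gt0.
(* Finiteness starts from the zero mass and propagates through the recursion; the absorption below
   takes place in the reals. *)
have fw i : w i \is a fin_num.
  elim: i => [|i ih]; first by rewrite w0.
  rewrite ge0_fin_numE//; apply: le_lt_trans (wS i) _.
  by rewrite -(fineK ih) -EFinM -EFinD ltry.
pose v i := fine (w i); have vE i : w i = (v i)%:E by rewrite /v fineK.
have v0 : v 0%N = 0 by rewrite /v w0.
have vge0 i : 0 <= v i by rewrite /v fine_ge0.
have vS i : v i.+1 <= k * v i + C * z i by rewrite -lee_fin -vE (le_trans (wS i))// vE EFinD EFinM.
under eq_bigr do rewrite vE; rewrite sumEFin lee_fin.
(* The extra term absorbs the contraction in the inductive step. *)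
suff : (\sum_(i < n.+1) v i) + k / (1 - k) * v n <= C / (1 - k) * \sum_(i < n) z i.
  by apply: le_trans; rewrite lerDl mulr_ge0// divr_ge0// ltW.
elim: n => [|n ih]; first by rewrite big_ord_recl !big_ord0 v0 !mulr0 !addr0.
rewrite big_ord_recr /= [in leRHS]big_ord_recr /= mulrDr.
have H : (1 - k)^-1 * v n.+1 <= (1 - k)^-1 * (k * v n + C * z n).
  by rewrite ler_wpM2l ?invr_ge0// ltW.
set S := \sum_(i < _) v i in ih *; set Z := C / (1 - k) * \sum_(i < n) z i in ih *.
have E1 : v n.+1 + k / (1 - k) * v n.+1 = (1 - k)^-1 * v n.+1 by field; rewrite gt_eqF.
have E2 : (1 - k)^-1 * (k * v n + C * z n) = k / (1 - k) * v n + C / (1 - k) * z n by ring.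
by rewrite -addrA E1 (le_trans (lerD (lexx _) H))// E2 addrA lerD.
Qed.

(** Stated through ratios, so that it covers shells growing to infinity and shells shrinking to 0
    alike. *)
Definition separated (lam : nat -> R) :=
  forall i j, i != j -> 2 * lam i <= lam j \/ 2 * lam j <= lam i.

Lemma trivIset_separated (lam : nat -> R) D : separated lam ->
  trivIset D (fun i => `[lam i, (2 * lam i)%R[%classic : set R).
Proof.
move=> sep; apply/trivIsetP => i j _ _ ij; rewrite -subset0 => t /= [].
rewrite !in_itv/= => /andP[it ti] /andP[jt tj].
case: (sep i j ij) => H.
  by have := lt_le_trans ti (le_trans H jt); rewrite ltxx.
by have := lt_le_trans tj (le_trans H it); rewrite ltxx.
Qed.

(** Half-open, unlike [annulus], so that consecutive shells are disjoint. *)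
Definition shell (a b : R) : set E := @rho R d @^-1` `[a, b[%classic.

Lemma measurable_shell a b : measurable (shell a b).
Proof. by apply: measurable_rho_preimage; exact: measurable_itv. Qed.

Lemma trivIset_shell (lam : nat -> R) D : separated lam ->
  trivIset D (fun i => shell (lam i) (2 * lam i)).
Proof.
move=> sep; apply/trivIsetP => i j Di Dj ij; rewrite -subset0 => z [zi zj].
have /trivIsetP/(_ i j Di Dj ij) := @trivIset_separated lam D sep.
by rewrite -subset0 => /(_ (rho z)); apply.
Qed.

Variable h : E -> \bar R.
Hypotheses (d0 : (0 < d)%N) (mh : measurable_fun (punctured d) h).
Hypothesis h0 : forall z, (0 <= h z)%E.

Lemma shell_punctured a b : 0 < a -> shell a b `<=` punctured d.
Proof.
move=> a0 z; rewrite /shell /= in_itv/= => /andP[az _].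
by rewrite /punctured /= -rho_gt0// (lt_le_trans a0).
Qed.

Lemma sum_shell (lam : nat -> R) (n : nat) : (forall i, 0 < lam i) -> separated lam ->
  (\sum_(i < n) \int[mu]_(z in shell (lam i) (2 * lam i)) h z =
   \int[mu]_(z in \big[setU/set0]_(i < n) shell (lam i) (2 * lam i)) h z)%E.
Proof.
move=> l0 sep; rewrite -!(big_mkord xpredT (fun i => \int[mu]_(z in shell (lam i) (2 * lam i)) h z)%E).
rewrite -!(big_mkord xpredT (fun i => shell (lam i) (2 * lam i))).
rewrite ge0_integral_bigsetU//.
- by move=> i; exact: measurable_shell.
- exact: iota_uniq.
- exact: trivIset_shell.
- apply: measurable_funS mh; first exact: measurable_punctured.
  elim/big_ind : _ => [|A B Ap Bp|i _]; [exact: sub0set|by rewrite subUset|exact: shell_punctured].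
Qed.

Lemma bigsetU_shell_punctured (lam : nat -> R) (n : nat) : (forall i, 0 < lam i) ->
  \big[setU/set0]_(i < n) shell (lam i) (2 * lam i) `<=` punctured d.
Proof.
move=> l0; elim/big_ind : _ => [|A B Ap Bp|i _]; [exact: sub0set|by rewrite subUset|].
exact: shell_punctured.
Qed.

Lemma sum_shell_le (lam : nat -> R) (n : nat) : (forall i, 0 < lam i) -> separated lam ->
  (\sum_(i < n) \int[mu]_(z in shell (lam i) (2 * lam i)) h z <=
   \int[mu]_(z in punctured d) h z)%E.
Proof.
move=> l0 sep; rewrite sum_shell//; apply: ge0_subset_integral => //.
- by apply: bigsetU_measurable => i _; exact: measurable_shell.
- exact: measurable_punctured.
- exact: bigsetU_shell_punctured.
Qed.

Lemma separated_scale (lam : nat -> R) c : 0 < c -> separated lam ->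
  separated (fun i => c * lam i).
Proof.
by move=> c0 sep i j /sep[H|H]; [left|right]; rewrite mulrCA ler_pM2l.
Qed.

Lemma separated_double (c : R) : 0 < c -> separated (fun j => 2 ^+ j * c).
Proof.
move=> c0; have H (i j : nat) : (i < j)%N -> 2 * (2 ^+ i * c) <= 2 ^+ j * c.
  by move=> ij; rewrite mulrA -exprS ler_pM2r// ler_weXn2l// ler1n.
by move=> i j; rewrite neq_ltn => /orP[/H|/H]; [left|right].
Qed.

(** The shells starting at 1/2, 1, 2 and 4 times [nu i] cover the closed window, the last one
    serving only its outer boundary. For each of the four multiples the shells are disjoint in [i],
    hence the factor 4. *)
Lemma sum_annulus_le (nu : nat -> R) (n : nat) : (forall i, 0 < nu i) -> separated nu ->
  (\sum_(i < n) \int[mu]_(z in annulus (nu i / 2) (4 * nu i)) h z <=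
   4%:R%:E * \int[mu]_(z in punctured d) h z)%E.
Proof.
move=> n0 sep.
have half i : 0 < nu i / 2 by rewrite divr_gt0.
apply: (@le_trans _ _ (\sum_(i < n) \sum_(j < 4)
   \int[mu]_(z in shell (2 ^+ j * (nu i / 2)) (2 * (2 ^+ j * (nu i / 2)))) h z)%E).
  apply: lee_sum => i _.
  have p0 j : 0 < 2 ^+ j * (nu i / 2) by rewrite mulr_gt0// exprn_gt0.
  rewrite (sum_shell 4 p0 (separated_double (half i))).
  apply: ge0_subset_integral => //.
  - exact: measurable_annulus.
  - by apply: bigsetU_measurable => j _; exact: measurable_shell.
  - apply: measurable_funS mh; first exact: measurable_punctured.
    exact: (@bigsetU_shell_punctured (fun j => 2 ^+ j * (nu i / 2)) 4 p0).
  - move=> z; rewrite annulusE /= => /andP[lz zl].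
    rewrite -(bigcup_mkord 4 (fun k => shell (2 ^+ k * (nu i / 2)) (2 * (2 ^+ k * (nu i / 2))))).
    have mem (j : nat) : (j < 4)%N -> 2 ^+ j * (nu i / 2) <= rho z -> rho z < 2 * (2 ^+ j * (nu i / 2)) ->
        (\bigcup_(k in `I_4) shell (2 ^+ k * (nu i / 2)) (2 * (2 ^+ k * (nu i / 2)))) z.
      by move=> j4 h1 h2; exists j => //; rewrite /shell /= in_itv/= h1 h2.
    have n00 := n0 i.
    have [h1|h1] := ltP (rho z) (nu i); first by apply: (mem 0%N) => //; lra.
    have [h2|h2] := ltP (rho z) (2 * nu i); first by apply: (mem 1%N) => //; lra.
    have [h3|h3] := ltP (rho z) (4 * nu i); first by apply: (mem 2%N) => //; lra.
    by apply: (mem 3%N) => //; lra.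
rewrite exchange_big /=.
apply: (@le_trans _ _ (\sum_(j < 4) \int[mu]_(z in punctured d) h z)%E).
  apply: lee_sum => j _.
  apply: (sum_shell_le n (lam := fun i => 2 ^+ j * (nu i / 2))).
    by move=> i; rewrite mulr_gt0// exprn_gt0.
  under [fun _ => _]eq_fun do rewrite (mulrC (nu _)) mulrA.
  by apply: separated_scale => //; rewrite mulr_gt0 ?exprn_gt0 ?invr_gt0.
by rewrite sumr_const card_ord mule_natl.
Qed.

End dyadic_sums.

Section dyadic_summation.
Context {R : realType} {d : nat}.
Local Notation E := 'rV[R]_d.
Local Notation mu := (@lebesgue_rV R d).
Local Notation leb := (@lebesgue_measure R).
Hypothesis d0 : (0 < d)%N.

Lemma dyadic_mass_ge0 e tau F (lam : R) : (0 <= dyadic_mass e tau F lam)%E.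
Proof.
rewrite mule_ge0 ?lee_fin ?powR_ge0//.
by apply: integral_ge0 => t _; rewrite lee_fin powR_ge0.
Qed.

Lemma sum_fine_annulus_le (h : E -> \bar R) (nu : nat -> R) n X :
  measurable_fun (punctured d) h -> (forall z, 0 <= h z)%E ->
  (forall i, 0 < nu i) -> separated nu -> (\int[mu]_(z in punctured d) h z <= X%:E)%E ->
  (forall i, (\int[mu]_(z in annulus (nu i / 2) (4 * nu i)) h z)%E \is a fin_num) /\
  \sum_(i < n) fine (\int[mu]_(z in annulus (nu i / 2) (4 * nu i)) h z)%E <= 4 * X.
Proof.
move=> mh h0 n0 sep hX.
have fin i : (\int[mu]_(z in annulus (nu i / 2) (4 * nu i)) h z)%E \is a fin_num.
  rewrite ge0_fin_numE ?integral_ge0//; apply: (@le_lt_trans _ _ X%:E); last exact: ltry.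
  apply: le_trans hX; apply: ge0_subset_integral => //.
  - exact: measurable_annulus.
  - exact: measurable_punctured.
  - by apply: annulus_punctured => //; rewrite divr_gt0.
split=> //; rewrite -lee_fin -sumEFin; under eq_bigr do rewrite fineK//.
apply: le_trans (sum_annulus_le d0 mh h0 n n0 sep) _.
by rewrite EFinM; apply: lee_wpmul2l.
Qed.

(** [nu i] is the base of the window shared by shells [i] and [i.+1], the smaller of [lam i] and
    [lam i.+1]; keeping it apart from [lam] treats both directions at once. The factor [4^(s + r)]
    is the overlap of the windows, and the condition on [h2] is asked only for [r > 0] because for
    [a = 1] the norm of [u] may be infinite. *)
Lemma dyadic_recursion_bound (G tau s r k C X Y : R) (F : R -> R) (h1 h2 : E -> \bar R)
    (lam nu : nat -> R) : 0 < s -> 0 <= r -> 1 <= s + r -> 0 <= k -> k < 1 -> 0 <= C ->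
  measurable_fun (punctured d) h1 -> (forall z, 0 <= h1 z)%E ->
  measurable_fun (punctured d) h2 -> (forall z, 0 <= h2 z)%E ->
  (forall i, 0 < nu i) -> separated nu ->
  dyadic_mass G tau F (lam 0%N) = 0%E ->
  (forall i x y, 0 <= x -> 0 <= y ->
    (\int[mu]_(z in annulus (nu i / 2) (4 * nu i)) h1 z <= x%:E)%E ->
    (0 < r -> (\int[mu]_(z in annulus (nu i / 2) (4 * nu i)) h2 z <= y%:E)%E) ->
    (dyadic_mass G tau F (lam i.+1) <=
      k%:E * dyadic_mass G tau F (lam i) + (C * (x `^ s * y `^ r))%:E)%E) ->
  (\int[mu]_(z in punctured d) h1 z <= X%:E)%E ->
  (0 < r -> (\int[mu]_(z in punctured d) h2 z <= Y%:E)%E) ->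
  forall n, (\sum_(i < n) dyadic_mass G tau F (lam i) <=
    (C / (1 - k) * 4 `^ (s + r) * (X `^ s * Y `^ r))%:E)%E.
Proof.
move=> s0 r0 sr k0 k1 C0 mh1 h10 mh2 h20 n0 sep w0 step hX hY n.
have k1' : 0 <= C / (1 - k) by rewrite divr_ge0// subr_ge0 ltW.
case: n => [|n].
  rewrite big_ord0 lee_fin.
  exact: mulr_ge0 (mulr_ge0 k1' (powR_ge0 _ _)) (mulr_ge0 (powR_ge0 _ _) (powR_ge0 _ _)).
pose x i := fine (\int[mu]_(z in annulus (nu i / 2) (4 * nu i)) h1 z)%E.
(* [fine] sends an infinite integral to 0; this can happen only for [r = 0], where the power is 1
   anyway. *)
pose y i := fine (\int[mu]_(z in annulus (nu i / 2) (4 * nu i)) h2 z)%E.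
have x0 i : 0 <= x i by rewrite fine_ge0// integral_ge0.
have y0 i : 0 <= y i by rewrite fine_ge0// integral_ge0.
have [fx Xn] := sum_fine_annulus_le n mh1 h10 n0 sep hX.
have Y4 : (\sum_(i < n) y i) `^ r <= 4 `^ r * Y `^ r.
  have [<-|rn] := eqVneq 0 r; first by rewrite !powRr0 mulr1.
  have rp : 0 < r by rewrite lt0r eq_sym rn.
  have [fy Yn] := sum_fine_annulus_le n mh2 h20 n0 sep (hY rp).
  have Y0 : 0 <= Y.
    by rewrite -lee_fin; apply: le_trans (hY rp); exact: integral_ge0.
  by rewrite -powRM// le_powRl// sumr_ge0.
have X0 : 0 <= X by rewrite -lee_fin; apply: le_trans hX; exact: integral_ge0.
have step' i : (dyadic_mass G tau F (lam i.+1) <=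
    k%:E * dyadic_mass G tau F (lam i) + (C * (x i `^ s * y i `^ r))%:E)%E.
  apply: step => // [|rp]; first by rewrite fineK.
  by rewrite fineK//; exact: (sum_fine_annulus_le 0 mh2 h20 n0 sep (hY rp)).1.
have := recursion_sum (z := fun i => x i `^ s * y i `^ r) k0 k1 w0
   (fun i => dyadic_mass_ge0 _ _ _ _) step' n.
move=> /le_trans; apply; rewrite lee_fin -[X in _ <= X]mulrA ler_wpM2l//.
apply: le_trans (sum_powRM_le n x0 y0 s0 r0 sr) _.
apply: (@le_trans _ _ ((4 `^ s * X `^ s) * (4 `^ r * Y `^ r))).
  apply: ler_pM; rewrite ?powR_ge0//.
  by rewrite -powRM// le_powRl ?sumr_ge0// ltW.
by rewrite mulrACA -powRD// pnatr_eq0 implybT.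
Qed.

Lemma integral_dyadic_mass (G tau : R) (F : R -> R) (lam : nat -> R) (B : R) : 0 < tau ->
  measurable_fun setT F -> (forall i, 0 < lam i) -> separated lam ->
  {ae leb, forall t, 0 < t -> (forall i, ~~ (lam i <= t < 2 * lam i)) -> F t = 0} ->
  (forall n, (\sum_(i < n) dyadic_mass G tau F (lam i) <= B%:E)%E) ->
  (\int[leb]_(t in `]0%R, +oo[) (t `^ G * `|F t| `^ tau)%:E <= (4 `^ `|G| * B)%:E)%E.
Proof.
move=> tau0 mF l0 sep aeF hB.
pose S i : set R := `[lam i, (2 * lam i)%R[%classic.
have mS i : measurable (S i : set (measurableTypeR R)) by exact: measurable_itv.
have m0 : measurable (`]0%R, +oo[%classic : set (measurableTypeR R)) by exact: measurable_itv.
have mU : measurable (\bigcup_i S i : set (measurableTypeR R)) by exact: bigcupT_measurable.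
have mp (A : set R) : measurable_fun A (fun t => (`|F t| `^ tau)%:E).
  apply/measurable_EFinP; apply: measurable_funTS.
  by apply: (measurableT_comp (measurable_powR _)); exact: measurableT_comp.
have mh (A : set R) : measurable_fun A (fun t => (t `^ G * `|F t| `^ tau)%:E).
  apply/measurable_EFinP; apply: measurable_funTS; apply: measurable_funM.
    exact: measurable_powR.
  by apply: (measurableT_comp (measurable_powR _)); exact: measurableT_comp.
have h0 t : (0 <= (t `^ G * `|F t| `^ tau)%:E)%E by rewrite lee_fin mulr_ge0 ?powR_ge0.
rewrite [X in (X <= _)%E](_ : _ =
   \int[leb]_(t in \bigcup_i S i) (t `^ G * `|F t| `^ tau)%:E)%E; last first.
  rewrite [LHS]integral_mkcond [RHS]integral_mkcond; apply: ae_eq_integral => //.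
  - exact: (measurable_restrictT _ m0).1 (mh _).
  - exact: (measurable_restrictT _ mU).1 (mh _).
  - have [N [mN N0 sN]] := aeF; exists N; split => // t /= H; apply: sN => /= Ft; apply: H => _.
    have [t0|t0] := ltP 0 t.
      have t0' : (`]0%R, +oo[%classic : set R) t by rewrite /= in_itv/= t0.
      rewrite patchT ?mem_set//; have [Ut|nUt] := pselect ((\bigcup_i S i) t).
        by rewrite patchT ?mem_set.
      rewrite patchC ?mem_set// Ft// ?normr0 ?powR0 ?gt_eqF// ?mulr0// => i; apply/negP => it.
      by apply: nUt; exists i => //; rewrite /S /= in_itv.
    rewrite !patchC ?mem_set//= => [[i _]|]; last by rewrite in_itv/= andbT ltNge t0.
    by rewrite /S /= in_itv/= => /andP[it _]; have := lt_le_trans (l0 i) it; rewrite ltNge t0.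
rewrite (@ge0_integral_bigcup _ _ _ leb S _ mS)//; last 2 first.
- exact: mh.
- exact: trivIset_separated.
apply: lime_le.
  by apply: is_cvg_nneseries => i _ _; exact: integral_ge0.
apply: nearW => n; rewrite big_mkord.
apply: (@le_trans _ _ (\sum_(i < n) (4 `^ `|G|)%:E * dyadic_mass G tau F (lam i))%E); last first.
  by rewrite -ge0_sume_distrr//; [rewrite EFinM; apply: lee_wpmul2l; rewrite ?lee_fin ?powR_ge0|
     move=> i _; exact: dyadic_mass_ge0].
apply: lee_sum => i _; rewrite /dyadic_mass muleA -EFinM.
rewrite -(@ge0_integralZl_EFin _ _ _ leb _ (mS i))//; last 2 first.
- exact: mp.
- by rewrite mulr_ge0 ?powR_ge0.
apply: (@ge0_le_integral _ _ _ leb _ (mS i)) => //.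
- exact: mh.
- by apply: measurable_funeM; exact: mp.
move=> t; rewrite /S /= in_itv/= => /andP[lt tl].
rewrite -EFinM lee_fin ler_wpM2r ?powR_ge0//.
have li := l0 i.
apply: powR_window => //; last by lra.
by apply: le_trans lt; rewrite ler_pdivrMr//; lra.
Qed.

End dyadic_summation.

(** * The weighted integral inequality for a radial function *)

Section radial_interpolation.
Context {R : realType} {d : nat}.
Local Notation E := 'rV[R]_d.
Local Notation mu := (@lebesgue_rV R d).
Local Notation leb := (@lebesgue_measure R).
Hypothesis d0 : (0 < d)%N.

Lemma dyadic_mass_eq0 (G tau lam : R) (F : R -> R) : 0 < tau -> measurable_fun setT F ->
  {ae leb, forall t, lam <= t < 2 * lam -> F t = 0} -> dyadic_mass G tau F lam = 0%E.
Proof.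
move=> tau0 mF F0; rewrite /dyadic_mass.
rewrite [X in (_ * X)%E](_ : _ = 0%E) ?mule0//.
have mS : measurable (`[lam, (2 * lam)%R[%classic : set (measurableTypeR R)) by exact: measurable_itv.
rewrite [LHS](_ : _ = \int[leb]_(t in `[lam, (2 * lam)%R[) (cst 0%E t))%E; last first.
  apply: (@ae_eq_integral _ _ _ leb _ _ _ mS).
  - apply/measurable_EFinP; apply: measurable_funTS.
    by apply: (measurableT_comp (measurable_powR _)); exact: measurableT_comp.
  - exact: measurable_cst.
  - have [N [mN N0 sN]] := F0; exists N; split => // t /= H; apply: sN => /= Ft.
    by apply: H; rewrite in_itv/= => /Ft ->; rewrite normr0 powR0// gt_eqF.
by rewrite integral0.
Qed.

Lemma half_exprS (c : R) i : 2 * (c / 2 ^+ i.+1) = c / 2 ^+ i.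
Proof. by rewrite mulrCA exprS invfM mulVKf// pnatr_eq0. Qed.

Lemma separated_halve (c : R) : 0 < c -> separated (fun j => c / 2 ^+ j).
Proof.
move=> c0; have H (i j : nat) : (i < j)%N -> 2 * (c / 2 ^+ j) <= c / 2 ^+ i.
  move=> ij; rewrite mulrCA ler_pM2l//.
  have -> : 2 / 2 ^+ j = (2 ^+ j.-1)^-1 :> R.
    by case: j ij => // j _; rewrite -[_^-1]mul1r half_exprS mul1r.
  rewrite lef_pV2 ?posrE ?exprn_gt0// ler_weXn2l ?ler1n//.
  by case: j ij.
by move=> i j; rewrite neq_ltn => /orP[/H|/H]; [right|left].
Qed.

Lemma halving_cover (c t : R) : 0 < c -> 0 < t -> t < c ->
  exists i, c / 2 ^+ i <= t < 2 * (c / 2 ^+ i).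
Proof.
move=> c0 t0 tc.
have ex : exists i, c / 2 ^+ i <= t.
  exists (Num.bound (c / t)); rewrite ler_pdivrMr ?exprn_gt0// mulrC -ler_pdivrMr//.
  exact/ltW/upper_nthrootP.
case: (ex_minnP ex) => -[|i] ci mi.
  by move: ci; rewrite expr0 divr1 leNgt tc.
exists i.+1; rewrite ci /=.
rewrite half_exprS.
by rewrite ltNge; apply/negP => /mi; rewrite ltnn.
Qed.

Lemma doubling_cover (c t : R) : 0 < c -> 2 * c <= t ->
  exists i, 2 ^+ i * c <= t < 2 * (2 ^+ i * c).
Proof.
move=> c0 ct.
have ex : exists i, t < 2 * (2 ^+ i * c).
  exists (Num.bound (t / c)); rewrite mulrA -ltr_pdivrMr//.
  apply: (@lt_le_trans _ _ (2 ^+ Num.bound (t / c))); first exact: upper_nthrootP.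
  by rewrite ler_peMl ?exprn_ge0// ler1n.
case: (ex_minnP ex) => -[|i] ci mi.
  by move: ci; rewrite expr0 mul1r ltNge ct.
exists i.+1; rewrite ci andbT.
by rewrite exprS -mulrA leNgt; apply/negP => /mi; rewrite ltnn.
Qed.

Lemma measurable_enorm_punctured (u : E -> R) (g : E -> E) :
  is_distr_gradient (punctured d) u g -> measurable_fun (punctured d) (enorm \o g).
Proof.
move=> [lg _].
rewrite (_ : _ \o _ = Num.sqrt \o (fun x : E => \sum_i g x ord0 i ^+ 2))//.
have ms : measurable_fun (punctured d) (fun x : E => \sum_i g x ord0 i ^+ 2).
  apply: measurable_sum => i; apply: measurable_funX; exact: (lg i).1.
apply: measurableT_comp ms.
by apply: continuous_measurable_fun; exact: sqrt_continuous.
Qed.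

Variables p q tau a alpha beta gamma : R.
Hypotheses (p1 : 1 <= p) (q1 : 1 <= q) (tau1 : 1 <= tau) (a0 : 0 < a) (a1 : a <= 1).
Hypothesis hbalance : tau^-1 + gamma / d%:R =
  a * (p^-1 + (alpha - 1) / d%:R) + (1 - a) * (q^-1 + beta / d%:R).
Hypothesis hlocal : tau * (1 - a - a * q * (1 - p^-1)) <= q.
Hypothesis hsum : 1 <= a * tau / p + (1 - a) * tau / q.
Let T := tau^-1 + gamma / d%:R.

Lemma radial_interpolation : T != 0 ->
  exists2 K, 0 < K & forall (u : E -> R) g F lam0 X Y,
  Lp_loc 1 (punctured d) u -> is_distr_gradient (punctured d) u g ->
  measurable_fun setT F -> {ae mu, forall z, u z = F (rho z)} -> 0 < lam0 ->
  (0 < T /\ {ae leb, forall t, lam0 <= t -> F t = 0} \/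
   T < 0 /\ {ae leb, forall t, 0 < t < lam0 -> F t = 0}) ->
  (\int[mu]_(z in punctured d) weighted_power alpha p (enorm \o g) z <= X%:E)%E ->
  (a < 1 -> (\int[mu]_(z in punctured d) weighted_power beta q u z <= Y%:E)%E) ->
  (\int[mu]_(z in punctured d) weighted_power gamma tau u z <=
    (K * (X `^ (a * tau / p) * Y `^ ((1 - a) * tau / q)))%:E)%E.
Proof.
move=> T0.
have v0 : 0 < @vball R d := vball_gt0 d0.
have p0 : 0 < p by rewrite (lt_le_trans ltr01).
have q0 : 0 < q by rewrite (lt_le_trans ltr01).
have tau0 : 0 < tau by rewrite (lt_le_trans ltr01).
(* Serves both as convexity weight and as contraction factor: [k^(1 - tau)] times [2^(-|T| tau)] is
   again [k], and [T != 0] makes it less than 1. *)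
pose k := 2 `^ (- `|T|) : R.
have k0 : 0 < k by rewrite powR_gt0.
have k1 : k < 1.
  rewrite /k powRN invf_lt1 ?powR_gt0//.
  have : 1 `^ `|T| < 2 `^ `|T| :> R by apply: gt0_ltr_powR; rewrite ?normr_gt0 ?nnegrE ?ltr1n.
  by rewrite powR1.
have [C C0 step] := dyadic_step d0 p1 q1 tau1 a0 a1 k0 k1 hbalance hlocal.
set G := gamma * tau / d%:R in step.
set s := a * tau / p in step *; set r := (1 - a) * tau / q in step *.
have s0 : 0 < s by rewrite divr_gt0// mulr_gt0.
have r0 : 0 <= r by rewrite divr_ge0 ?(ltW q0)// mulr_ge0 ?(ltW tau0)// subr_ge0.
have ra : 0 < r -> a < 1.
  by move=> rp; rewrite lt_neqAle a1 andbT; apply: contraTneq rp => ae; rewrite /r ae subrr !mul0r ltxx.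
have ar : a < 1 -> 0 < r by move=> a1'; rewrite divr_gt0// mulr_gt0// subr_gt0.
have k1' : 0 < 1 - k by rewrite subr_gt0.
pose B := C / (1 - k) * 4 `^ (s + r).
have B0 : 0 < B by rewrite mulr_gt0 ?powR_gt0// divr_gt0.
exists (@vball R d * (4 `^ `|G| * B)).
  by apply: (mulr_gt0 v0); apply: mulr_gt0 B0; exact: powR_gt0.
move=> u g F lam0 X Y lu ug mF uF l00 cases hX hY.
have mu_ := lu.1.
have mg := measurable_enorm_punctured ug.
have mh1 := measurable_weighted_power alpha p mg.
have mh2 := measurable_weighted_power beta q mu_.
have hY' : 0 < r -> (\int[mu]_(z in punctured d) weighted_power beta q u z <= Y%:E)%E.
  by move=> /ra/hY.
have mI : measurable (`]0%R, +oo[%classic : set (measurableTypeR R)) by exact: measurable_itv.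
have I0 : `]0%R, +oo[%classic `<=` (`[0, +oo[%classic : set R).
  by move=> t /=; rewrite !in_itv/= !andbT => /ltW.
have mw (A : set R) : measurable_fun A (fun t => (t `^ G * `|F t| `^ tau)%:E).
  apply/measurable_EFinP; apply: measurable_funTS; apply: measurable_funM.
    exact: measurable_powR.
  by apply: (measurableT_comp (measurable_powR _)); exact: measurableT_comp.
have w0 t : (`]0%R, +oo[%classic : set R) t -> (0 <= (t `^ G * `|F t| `^ tau)%:E)%E.
  by move=> _; rewrite lee_fin mulr_ge0 ?powR_ge0.
have pE : @rho R d @^-1` `]0%R, +oo[%classic = punctured d.
  by apply/seteqP; split => z; rewrite /= in_itv/= andbT rho_gt0.
have -> : (\int[mu]_(z in punctured d) weighted_power gamma tau u z =
    (@vball R d)%:E * \int[leb]_(t in `]0%R, +oo[) (t `^ G * `|F t| `^ tau)%:E)%E.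
  rewrite -(ge0_integral_rho d0 mI I0 (mw _) w0) pE.
  apply: ae_eq_integral.
  - exact: measurable_punctured.
  - exact: measurable_weighted_power.
  - have := measurable_comp mI _ (mw _) (@measurable_funTS _ _ _ _ (@rho R d @^-1` `]0%R, +oo[%classic) _ measurable_rho).
    by rewrite pE; apply; move=> _ /= [z zD <-]; rewrite /= in_itv/= andbT rho_gt0.
  - apply: filterS uF => z uz _; rewrite /weighted_power uz normrM ger0_norm ?powR_ge0//.
    rewrite powRM ?powR_ge0// -powRrM enorm_powR//.
suff H : (\int[leb]_(t in `]0%R, +oo[) (t `^ G * `|F t| `^ tau)%:E <=
    (4 `^ `|G| * (B * (X `^ s * Y `^ r)))%:E)%E.
  rewrite -(mulrA (@vball R d)) -(mulrA (4 `^ `|G|)) [in leRHS]EFinM.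
  apply: lee_wpmul2l; first by rewrite lee_fin ltW.
  exact: H.
case: cases => [[Tp F0]|[Tn F0]].
  (* Inward recursion. Shell 0 runs from [lam0] to [2 lam0], where [F] vanishes, so the initial mass
     is 0. *)
  pose lam i := lam0 / 2 ^+ i.
  have lamS i : 2 * lam i.+1 = lam i.
    exact: half_exprS.
  have l0 i : 0 < lam i by rewrite divr_gt0// exprn_gt0.
  have sep : separated lam by exact: separated_halve.
  have kE : k `^ (1 - tau) * 2 `^ (- (T * tau)) = k.
    rewrite /k -powRrM -powRD ?pnatr_eq0 ?implybT// gtr0_norm//; congr (_ `^ _); ring.
  apply: (integral_dyadic_mass (lam := lam)) => //.
    have [N [mN N0 sN]] := F0; exists N; split => // t /= H; apply: sN => /= Ft; apply: H => t0 nt.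
    apply: Ft; rewrite leNgt; apply/negP => tl.
    by have [i it] := halving_cover l00 t0 tl; have := nt i; rewrite it.
  (* The shells shrink, so the window shared by shells [i] and [i.+1] is based at [lam i.+1]. *)
  apply: (dyadic_recursion_bound d0 (nu := fun i => lam i.+1) s0 r0 hsum (ltW k0) k1 (ltW C0) mh1 _ mh2) => //.
  - exact: weighted_power_ge0.
  - exact: weighted_power_ge0.
  - by move=> i j ij; apply: sep; rewrite eqSS.
  - apply: dyadic_mass_eq0 => //; have [N [mN N0 sN]] := F0; exists N; split => // t /= H; apply: sN => /= Ft.
    by apply: H; rewrite /lam expr0 divr1 => /andP[/Ft].
  - move=> i x y x0 y0 hx hy.
    have [+ _] := step u g F (lam i.+1) x y lu ug mF uF (l0 _) x0 y0 hx (fun h => hy (ar h)).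
    by rewrite kE lamS.
(* Outward recursion. Starting at [lam0 / 2] makes shell 0 end at [lam0], so that it lies where [F]
   vanishes. *)
pose lam i := 2 ^+ i * (lam0 / 2).
have lam00 : 0 < lam0 / 2 by rewrite divr_gt0.
have lamS i : lam i.+1 = 2 * lam i by rewrite /lam exprS -mulrA.
have l0 i : 0 < lam i by rewrite mulr_gt0// exprn_gt0.
have sep : separated lam by exact: separated_double.
have kE : k `^ (1 - tau) * 2 `^ (T * tau) = k.
  rewrite /k -powRrM -powRD ?pnatr_eq0 ?implybT// ltr0_norm//; congr (_ `^ _); ring.
have lam0E : 2 * (lam0 / 2) = lam0 by rewrite mulrC divfK// pnatr_eq0.
apply: (integral_dyadic_mass (lam := lam)) => //.
  have [N [mN N0 sN]] := F0; exists N; split => // t /= H; apply: sN => /= Ft; apply: H => t0 nt.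
  apply: Ft; rewrite t0 ltNge; apply/negP => tl; rewrite -lam0E in tl.
  by have [i it] := doubling_cover lam00 tl; have := nt i; rewrite it.
apply: (dyadic_recursion_bound d0 (nu := lam) s0 r0 hsum (ltW k0) k1 (ltW C0) mh1 _ mh2) => //.
- exact: weighted_power_ge0.
- exact: weighted_power_ge0.
- apply: dyadic_mass_eq0 => //; have [N [mN N0 sN]] := F0; exists N; split => // t /= H; apply: sN => /= Ft.
  apply: H; rewrite /lam expr0 mul1r lam0E => /andP[lt tl]; apply: Ft.
  by rewrite tl (lt_le_trans lam00).
- move=> i x y x0 y0 hx hy.
  have [_ +] := step u g F (lam i) x y lu ug mF uF (l0 _) x0 y0 hx (fun h => hy (ar h)).
  by rewrite kE -lamS.
Qed.

End radial_interpolation.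

(** * Weighted norms *)

Section vanishing.
Context {R : realType} {d : nat}.
Local Notation E := 'rV[R]_d.
Local Notation mu := (@lebesgue_rV R d).
Local Notation leb := (@lebesgue_measure R).
Hypothesis d0 : (0 < d)%N.

(** A set of radii with null preimage is null because the volume of the unit ball is positive. *)
Lemma ae_profile (u : E -> R) (F : R -> R) (P : set R) :
  measurable_fun setT F -> {ae mu, forall x, u x = F (rho x)} ->
  measurable (P : set (measurableTypeR R)) -> P `<=` `[0, +oo[%classic ->
  {ae mu, forall x, P (rho x) -> u x = 0} -> {ae leb, forall t, P t -> F t = 0}.
Proof.
move=> mF uF mP P0 u0; pose N : set (measurableTypeR R) := P `&` F @^-1` [set~ 0].
have mN : measurable N.
  apply: measurableI => //; rewrite -[X in measurable X]setTI; apply: mF => //.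
  exact: measurableC.
have N0 : mu (@rho R d @^-1` N) = 0%E.
  have : {ae mu, forall x, ~ (@rho R d @^-1` N) x}.
    by apply: filterS2 uF u0 => x ux u0x [Px]; apply; rewrite -ux u0x.
  move=> [A [mA A0 sA]]; apply: (@subset_measure0 _ _ _ mu _ A) => //.
  - exact: measurable_rho_preimage.
  - by move=> x Nx; apply: sA => /=; apply.
exists N; split => //; last first.
  by move=> t /= /not_implyP[Pt Ft].
have N1 : N `<=` `[0, +oo[%classic by move=> t [/P0].
have := mu_rho_preimage d0 mN N1; rewrite N0 => /esym/eqP.
by rewrite mule_eq0 eqe gt_eqF ?vball_gt0//= => /eqP.
Qed.

(** Each point has its own exceptional null set; compactness leaves finitely many of them. *)
Lemma ae_zero_compact (u : E -> R) (K : set E) : compact K ->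
  (forall x, K x -> exists U, [/\ open U, U x & {ae mu, forall y, U y -> u y = 0}]) ->
  {ae mu, forall y, K y -> u y = 0}.
Proof.
move=> cK hU; have /choice[f fP] : forall x, exists U : set E, K x -> [/\ open U, U x & {ae mu, forall y, U y -> u y = 0}].
  by move=> x; have [/hU[U ?]|nK] := pselect (K x); [exists U|exists set0].
rewrite compact_cover in cK.
have [| |D' sD KD] := cK E K f.
- by move=> x /fP[].
- by move=> x Kx; exists x => //; have [] := fP x Kx.
have : {ae mu, forall y, forall x, x \in finmap.enum_fset D' -> f x y -> u y = 0}.
  have : forall x, x \in finmap.enum_fset D' -> K x.
    by move=> x xD; have := sD x xD; rewrite inE.
  elim: (finmap.enum_fset D') => [|x s ih] sK.
    by apply: filterE.
  have [_ _ aex] := fP x (sK x (mem_head _ _)).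
  have {}ih := ih (fun z zs => sK z (mem_behead (s := x :: s) zs)).
  apply: filterS2 aex ih => y h1 h2 z; rewrite inE => /predU1P[->//|]; exact: h2.
by apply: filterS => y h Ky; have [x /= xD fxy] := KD y Ky; exact: (h x xD fxy).
Qed.

(** The exterior of a ball containing the support is exhausted by countably many compact annuli, and
    [u] vanishes almost everywhere on each. *)
Lemma compact_ess_support_ae (u : E -> R) : compact (ess_support u) ->
  exists2 lam, 0 < lam & {ae mu, forall x, lam <= rho x -> u x = 0}.
Proof.
move=> cS.
have : compact (@rho R d @` ess_support u).
  by apply: continuous_compact => //; apply: continuous_subspaceT; exact: continuous_rho.
move=> /compact_bounded/pinfty_ex_gt0[M M0 bM].
exists (M + 1); first by rewrite addr_gt0.
have aen n : {ae mu, forall x, (M + 1 <= rho x <= n%:R) -> u x = 0}.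
  apply: ae_zero_compact; first exact: compact_annulus.
  move=> x /= /andP[Mx _].
  have : ~ ess_support u x.
    move=> ux; have := bM (rho x) (ex_intro2 _ _ x ux erefl).
    rewrite /= ger0_norm ?rho_ge0// => xM; have := le_trans Mx xM.
    by rewrite gerDl ler10.
  by move=> /existsNP[U /not_implyP[oU /not_implyP[Ux /contrapT aeU]]]; exists U.
have := ae_foralln aen; apply: filterS => x h Mx; apply: (h (Num.bound (rho x))).
by rewrite Mx /= ltW// archi_boundP// rho_ge0.
Qed.

Lemma vanishes_near0_ae (u : E -> R) : vanishes_near0 u ->
  exists2 lam, 0 < lam & {ae mu, forall x, rho x < lam -> u x = 0}.
Proof.
move=> [U /nbhs_ballP[e /= e0 eU] aeU]; exists (e ^+ d); first by rewrite exprn_gt0.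
apply: filterS aeU => x h xe; apply: h; apply: eU.
have xe' : enorm x < e by move: xe; rewrite /rho ltr_pXn2r ?nnegrE ?enorm_ge0// ltW.
split=> // i j; rewrite (ord1 i) /ball /= mxE sub0r normrN.
exact: le_lt_trans (ler_enorm _ _) xe'.
Qed.

Lemma measurable_rV_punctured (u : E -> R) : measurable_fun (punctured d) u -> measurable_fun setT u.
Proof.
move=> mu_.
have mp := @measurable_punctured R d d0.
have E1 : [set 0] = ~` punctured d :> set E.
  by apply/seteqP; split => x; rewrite /punctured /=; [move=> ->; rewrite eqxx|move=> /negP/negPn/eqP].
have m0 : measurable ([set 0] : set E) by rewrite E1; exact: measurableC.
have -> : setT = punctured d `|` [set 0] :> set E by rewrite E1 setUv.
by apply/(measurable_funU _ mp m0); split => //; exact: measurable_fun_set1.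
Qed.

Lemma integral_weighted_powerT s p (u : E -> R) : measurable_fun (punctured d) u ->
  (\int[mu]_(z in setT) weighted_power s p u z = \int[mu]_(z in punctured d) weighted_power s p u z)%E.
Proof.
move=> mu_; have mT := measurable_rV_punctured mu_.
have mp := @measurable_punctured R d d0.
rewrite [RHS]integral_mkcond; apply: ae_eq_integral => //.
- exact: measurable_weighted_power.
- by apply: (measurable_restrictT _ mp).1; exact: measurable_weighted_power.
- have : {ae mu, forall z, punctured d z -> weighted_power s p u z = (weighted_power s p u \_ (punctured d)) z}.
    by apply: filterE => z pz; rewrite patchT ?mem_set.
  by move/(punctured_ae d0); apply: filterS.
Qed.

Lemma weighted_normE s p D (u : E -> R) : 0 < p ->
  (weighted_norm s p D u = (\int[mu]_(z in D) weighted_power s p u z) `^ p^-1)%E.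
Proof.
move=> p0; rewrite /weighted_norm unlock /=; congr (_ `^ _)%E.
rewrite [RHS]integral_mkcond; apply: eq_integral => z _.
rewrite /= /patch; case: ifPn => // _.
by rewrite /= normr0 powR0// gt_eqF.
Qed.

Lemma weighted_power_eq0 s p (u : E -> R) : 0 < p -> measurable_fun (punctured d) u ->
  (\int[mu]_(z in punctured d) weighted_power s p u z = 0)%E <->
  {ae mu, forall z, punctured d z -> u z = 0}.
Proof.
move=> p0 mu_.
have mp := @measurable_punctured R d d0.
have mw := measurable_weighted_power s p mu_.
have H := ae_eq_integral_abs mu mp mw.
have absE : (\int[mu]_(z in punctured d) `|weighted_power s p u z| =
    \int[mu]_(z in punctured d) weighted_power s p u z)%E.
  by apply: eq_integral => z _; rewrite gee0_abs// weighted_power_ge0.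
rewrite absE in H; apply: (iff_trans H); split; apply: filterS => z h pz.
  have := h pz => /= -[] /powR_eq0_eq0/eqP; rewrite normr_eq0 mulf_eq0.
  have ez : 0 < enorm z by rewrite lt0r enorm_ge0 enorm_eq0 pz.
  by rewrite gt_eqF ?powR_gt0//= => /eqP.
by rewrite /= /weighted_power h// mulr0 normr0 powR0// gt_eqF.
Qed.

End vanishing.

Section interpolation_inequality.
Context {R : realType} {d : nat}.
Local Notation E := 'rV[R]_d.
Local Notation mu := (@lebesgue_rV R d).
Local Notation leb := (@lebesgue_measure R).
Hypothesis d0 : (0 < d)%N.
Variables p q tau a alpha beta gamma : R.
Hypotheses (p1 : 1 <= p) (q1 : 1 <= q) (tau1 : 1 <= tau) (a0 : 0 < a) (a1 : a <= 1).
Hypothesis hbalance : tau^-1 + gamma / d%:R =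
  a * (p^-1 + (alpha - 1) / d%:R) + (1 - a) * (q^-1 + beta / d%:R).
Hypothesis hlocal : tau * (1 - a - a * q * (1 - p^-1)) <= q.
Hypothesis hsum : 1 <= a * tau / p + (1 - a) * tau / q.
Let T := tau^-1 + gamma / d%:R.
Hypothesis T0 : T != 0.

Definition vanishing_profile (F : R -> R) (lam : R) : Prop :=
  0 < T /\ {ae leb, forall t, lam <= t -> F t = 0} \/
  T < 0 /\ {ae leb, forall t, 0 < t < lam -> F t = 0}.

(* The case [a = 1], [tau = p] with the exponent of the gradient weight chosen so that
   [T] is unchanged: no weighted norm of [u] is needed. *)
Lemma zero_gradient (u : E -> R) g F lam :
  Lp_loc 1 (punctured d) u -> is_distr_gradient (punctured d) u g ->
  measurable_fun setT F -> {ae mu, forall z, u z = F (rho z)} -> 0 < lam ->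
  vanishing_profile F lam ->
  (\int[mu]_(z in punctured d) weighted_power alpha p (enorm \o g) z = 0)%E ->
  {ae mu, forall z, punctured d z -> u z = 0}.
Proof.
move=> lu ug mF uF l0 vF X0.
have dR : 0 < d%:R :> R by rewrite ltr0n.
have p0 : 0 < p by rewrite (lt_le_trans ltr01).
pose gamma' := d%:R * (T - p^-1).
have TE : p^-1 + gamma' / d%:R = T by rewrite /gamma'; field; rewrite !gt_eqF.
have hb : p^-1 + gamma' / d%:R =
    1 * (p^-1 + (gamma' + 1 - 1) / d%:R) + (1 - 1) * (q^-1 + 0 / d%:R).
  by rewrite subrr mul0r addr0 mul1r addrK.
have hl : p * (1 - 1 - 1 * q * (1 - p^-1)) <= q.
  apply: (@le_trans _ _ 0); last exact: le_trans ler01 q1.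
  rewrite subrr sub0r mulrN oppr_le0 mulr_ge0 ?(ltW p0)// mul1r mulr_ge0//.
    exact: le_trans ler01 q1.
  by rewrite subr_ge0 invf_le1.
have hs : 1 <= 1 * p / p + (1 - 1) * p / q by rewrite subrr !mul0r addr0 mul1r mulfV ?gt_eqF.
have T0' : p^-1 + gamma' / d%:R != 0 by rewrite TE.
have [K K0 HK] := radial_interpolation d0 p1 q1 p1 ltr01 (lexx _) hb hl hs T0'.
have mg := measurable_enorm_punctured ug.
(* Changing the weight is harmless: a vanishing integral means that [g] is 0 almost everywhere,
   whatever the exponent. *)
have X0' : (\int[mu]_(z in punctured d) weighted_power (gamma' + 1) p (enorm \o g) z <= 0%:E)%E.
  rewrite le_eqVlt; apply/orP; left; apply/eqP.
  exact: (weighted_power_eq0 d0 (gamma' + 1) p0 mg).2 ((weighted_power_eq0 d0 alpha p0 mg).1 X0).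
apply/(weighted_power_eq0 d0 gamma' p0 lu.1)/eqP; rewrite eq_le integral_ge0 ?andbT; last first.
  by move=> z _; exact: weighted_power_ge0.
have vF' : 0 < p^-1 + gamma' / d%:R /\ {ae leb, forall t, lam <= t -> F t = 0} \/
    p^-1 + gamma' / d%:R < 0 /\ {ae leb, forall t, 0 < t < lam -> F t = 0} by rewrite TE.
have noY : (1 : R) < 1 -> (\int[mu]_(z in punctured d) weighted_power 0 q u z <= 0%:E)%E by rewrite ltxx.
apply: le_trans (HK u g F lam 0 0 lu ug mF uF l0 vF' X0' noY) _.
by rewrite lee_fin powR0 ?mul0r ?mulr0// gt_eqF// divr_gt0// mul1r.
Qed.

(** For finite norms this is [radial_interpolation] after a [tau]-th root. The remaining work
    concerns the values 0 and infinity, where the right-hand side can collapse to 0 and [u] itself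
    must be shown to vanish. *)
Lemma interpolation_inequality : exists2 C, 0 < C & forall (u : E -> R) F lam,
  Lp_loc 1 (punctured d) u -> measurable_fun setT F ->
  {ae mu, forall z, u z = F (rho z)} -> 0 < lam -> vanishing_profile F lam ->
  (weighted_norm gamma tau [set: E] u <=
    C%:E * (weighted_grad_norm alpha p u `^ a * weighted_norm beta q [set: E] u `^ (1 - a)))%E.
Proof.
have p0 : 0 < p by rewrite (lt_le_trans ltr01).
have q0 : 0 < q by rewrite (lt_le_trans ltr01).
have tau0 : 0 < tau by rewrite (lt_le_trans ltr01).
have [K K0 HK] := radial_interpolation d0 p1 q1 tau1 a0 a1 hbalance hlocal hsum T0.
exists (K `^ tau^-1); first by rewrite powR_gt0.
move=> u F lam lu mF uF l0 vF.
set C := K `^ tau^-1; have C0 : 0 < C by rewrite powR_gt0.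
have int_ge0 s r (f : E -> R) : (0 <= \int[mu]_(z in punctured d) weighted_power s r f z)%E.
  by apply: integral_ge0 => z _; exact: weighted_power_ge0.
set N := weighted_norm gamma _ _ _; set M := weighted_norm beta _ _ _.
have NE : N = ((\int[mu]_(z in punctured d) weighted_power gamma tau u z) `^ tau^-1)%E.
  by rewrite /N weighted_normE// integral_weighted_powerT//; exact: lu.1.
have ME : M = ((\int[mu]_(z in punctured d) weighted_power beta q u z) `^ q^-1)%E.
  by rewrite /M weighted_normE// integral_weighted_powerT//; exact: lu.1.
have M0 : (0 <= M)%E by rewrite ME poweR_ge0.
have zero : {ae mu, forall z, punctured d z -> u z = 0} -> forall G, (0 <= G)%E -> (N <= G)%E.
  move=> /(weighted_power_eq0 d0 gamma tau0 lu.1) Nz G G0.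
  by rewrite NE Nz poweR0r// gt_eqF// invr_gt0.
have rhs0 (G : \bar R) : (0 <= C%:E * (G `^ a * M `^ (1 - a)))%E.
  by rewrite mule_ge0 ?mule_ge0 ?poweR_ge0// lee_fin ltW.
(* With an infinite gradient norm the right-hand side is infinite unless [a < 1] and [M = 0], and
   then [u] is 0 almost everywhere. *)
have infinite : (N <= C%:E * (+oo `^ a * M `^ (1 - a)))%E.
  rewrite poweRyr ?gt_eqF//.
  have [a1'|a1'] := ltP a 1; last first.
    have -> : a = 1 by apply/eqP; rewrite eq_le a1.
    by rewrite subrr poweRe0 mule1 gt0_muley ?lte_fin// leey.
  have [Mz|Mn] := eqVneq M 0%E.
    apply: zero; last by rewrite mule_ge0 ?mule_ge0 ?poweR_ge0// lee_fin ltW.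
    apply/(weighted_power_eq0 d0 beta q0 lu.1).
    by apply: (poweR_eq0_eq0 (r := q^-1) (int_ge0 _ _ _)); rewrite -ME.
  have Mp : (0 < M `^ (1 - a))%E by rewrite poweR_gt0// lt0e Mn.
  by rewrite gt0_mulye// gt0_muley ?lte_fin// leey.
rewrite /weighted_grad_norm; case: pselect => [gradu|_]; last exact: infinite.
set g := sval (cid gradu).
have ug : is_distr_gradient (punctured d) u g := (svalP (cid gradu)).1.
rewrite weighted_normE//.
set X := (\int[mu]_(z in punctured d) weighted_power alpha p (enorm \o g) z)%E.
have X0 : (0 <= X)%E := int_ge0 _ _ _.
have [Xoo|Xn] := eqVneq X +oo%E.
  by rewrite Xoo [(+oo `^ p^-1)%E]poweRyr ?gt_eqF ?invr_gt0.
have fX : X \is a fin_num by rewrite ge0_fin_numE// ltey.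
set x := fine X; have XE : X = x%:E by rewrite fineK.
have x0 : 0 <= x by rewrite fine_ge0.
(* The free [y] covers two cases: the integral itself when it is finite, and an arbitrary value when
   [a = 1], where [y] carries the exponent 0. *)
have key y : 0 <= y ->
    (a < 1 -> (\int[mu]_(z in punctured d) weighted_power beta q u z <= y%:E)%E) ->
    (M `^ (1 - a) = (y `^ ((1 - a) / q))%:E)%E ->
    (N <= C%:E * ((X `^ p^-1) `^ a * M `^ (1 - a)))%E.
  move=> y0 hy My.
  have Xx : (X <= x%:E)%E by rewrite XE.
  have H := HK u g F lam x y lu ug mF uF l0 vF Xx hy.
  rewrite My XE NE -poweRrM poweR_EFin -!EFinM.
  apply: (@le_trans _ _ ((K * (x `^ (a * tau / p) * y `^ ((1 - a) * tau / q)))%:E `^ tau^-1)%E).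
    apply: gt0_ler_poweR => //; rewrite ?in_itv/= ?andbT ?leey ?int_ge0//.
      by rewrite invr_ge0 ltW.
    by rewrite lee_fin !mulr_ge0 ?powR_ge0// ltW.
  rewrite poweR_EFin lee_fin powRM ?mulr_ge0 ?powR_ge0 ?(ltW K0)// powRM ?powR_ge0//.
  rewrite -!powRrM (_ : a * tau / p / tau = p^-1 * a); last by field; rewrite !gt_eqF.
  by rewrite (_ : (1 - a) * tau / q / tau = (1 - a) / q)//; field; rewrite !gt_eqF.
have [a1'|a1'] := ltP a 1; last first.
  have ae : a = 1 by apply/eqP; rewrite eq_le a1.
  apply: (key 0) => //; first by rewrite ltNge a1'.
  by rewrite ae subrr mul0r powRr0 poweRe0.
set Y := (\int[mu]_(z in punctured d) weighted_power beta q u z)%E in ME key.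
have Y0 : (0 <= Y)%E := int_ge0 _ _ _.
have [Yoo|Yn] := eqVneq Y +oo%E; last first.
  have fY : Y \is a fin_num by rewrite ge0_fin_numE// ltey.
  have YfY : (Y <= (fine Y)%:E)%E by rewrite fineK.
  apply: (key (fine Y) (fine_ge0 Y0) (fun=> YfY)).
  by rewrite ME -poweRrM -[in LHS](fineK fY) poweR_EFin mulrC.
(* Zero gradient with infinite [L^q] norm: the right-hand side is 0 by convention, so the inequality
   forces [u] to vanish. *)
have [xe|xn] := eqVneq x 0.
  apply: zero => //; apply: (zero_gradient lu ug mF uF l0 vF).
  by rewrite -/X XE xe.
rewrite ME Yoo [(+oo `^ q^-1)%E]poweRyr ?gt_eqF ?invr_gt0// poweRyr ?gt_eqF ?subr_gt0//.
have Xp0 : (0 < X)%E by rewrite XE lte_fin lt0r xn.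
have Xp : (0 < (X `^ p^-1) `^ a)%E by exact: poweR_gt0 (poweR_gt0 _ Xp0).
by rewrite gt0_muley// gt0_muley ?lte_fin// leey.
Qed.

End interpolation_inequality.

(** * Conditions on the exponents and the two support hypotheses *)

Unset Implicit Arguments.

Theorem theorem4p3 (R : realType) (d : nat)
    (p q tau a alpha beta gamma sigma : R)
    (hd : (2 <= d)%N) (hp : 1 <= p) (hq : 1 <= q) (htau : 1 <= tau)
    (ha0 : 0 < a) (ha1 : a <= 1)
    (hsigma : gamma = a * sigma + (1 - a) * beta)
    (hbalance : tau^-1 + gamma / d%:R =
      a * (p^-1 + (alpha - 1) / d%:R) + (1 - a) * (q^-1 + beta / d%:R))
    (hlow : - (d%:R - 1) <= alpha - sigma) (hupp : alpha - sigma < 0) :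
  exists C : R, 0 < C /\
    let inequality (u : 'rV[R]_d -> R) :=
      (weighted_norm gamma tau [set: 'rV[R]_d] u <=
        C%:E * (weighted_grad_norm alpha p u `^ a *
                weighted_norm beta q [set: 'rV[R]_d] u `^ (1 - a)))%E in
    (0 < tau^-1 + gamma / d%:R ->
      forall u : 'rV[R]_d -> R, Lp_loc 1 (punctured d) u -> radial u ->
        compact (ess_support u) -> inequality u) /\
    (tau^-1 + gamma / d%:R < 0 ->
      forall u : 'rV[R]_d -> R, Lp_loc 1 (punctured d) u -> radial u ->
        vanishes_near0 u -> inequality u).
Proof.
have d0 : (0 < d)%N by exact: leq_trans hd.
have dR : 0 < d%:R :> R by rewrite ltr0n.
have p0 : 0 < p by rewrite (lt_le_trans ltr01).
have q0 : 0 < q by rewrite (lt_le_trans ltr01).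
have tau0 : 0 < tau by rewrite (lt_le_trans ltr01).
(* Substituting [sigma] cancels the [beta] terms; the bounds on [alpha - sigma] then place the last
   fraction in [[-1, 0]]. *)
have tauE : tau^-1 = a / p + (1 - a) / q + a * ((alpha - sigma - 1) / d%:R).
  have -> : tau^-1 = (tau^-1 + gamma / d%:R) - gamma / d%:R by rewrite addrK.
  by rewrite hbalance hsigma; field; rewrite !gt_eqF.
have low : -1 <= (alpha - sigma - 1) / d%:R by rewrite ler_pdivlMr//; lra.
have upp : (alpha - sigma - 1) / d%:R <= 0 by rewrite ler_pdivrMr//; lra.
have tauK : tau * tau^-1 = 1 by rewrite mulfV// gt_eqF.
(* Equivalent to [a/p + (1-a)/q - a <= 1/tau], which is the lower end of that range. *)
have hlocal : tau * (1 - a - a * q * (1 - p^-1)) <= q.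
  have E : 1 - a - a * q * (1 - p^-1) = q * (a / p + (1 - a) / q - a).
    by field; rewrite !gt_eqF.
  have H : a / p + (1 - a) / q - a <= tau^-1.
    by have := ler_wpM2l (ltW ha0) low; rewrite tauE mulrN1; lra.
  rewrite E mulrCA -[leRHS]mulr1 ler_pM2l//.
  by apply: le_trans (ler_wpM2l (ltW tau0) H) _; rewrite tauK.
(* Equivalent to [1/tau <= a/p + (1-a)/q], which is the upper end. *)
have hsum : 1 <= a * tau / p + (1 - a) * tau / q.
  have -> : a * tau / p + (1 - a) * tau / q = tau * (a / p + (1 - a) / q).
    by field; rewrite !gt_eqF.
  rewrite -[leLHS]tauK ler_pM2l// tauE gerDl.
  by have := ler_wpM2l (ltW ha0) upp; rewrite mulr0.
have [Tz|T0] := eqVneq (tau^-1 + gamma / d%:R) 0.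
  (* Both cases of the claim are then vacuous, and any constant will do. *)
  by exists 1; split => //=; rewrite Tz ltxx; split.
have [C C0 H] := interpolation_inequality d0 hp hq htau ha0 ha1 hbalance hlocal hsum T0.
exists C; split => // ineq; split => hT u lu ru.
- move=> /(compact_ess_support_ae d0)[lam l0 u0].
  have [F [mF uF]] := radial_profile d0 lu.1 ru.
  apply: (H u F lam lu mF uF l0); left; split => //.
  have := @ae_profile _ _ d0 u F (`[lam, +oo[%classic) mF uF (measurable_itv _).
  have sub : (`[lam, +oo[%classic : set R) `<=` `[0, +oo[%classic.
    by move=> t /=; rewrite !in_itv/= !andbT; exact: le_trans (ltW l0).
  move=> /(_ sub) [].
    by apply: filterS u0 => x h /=; rewrite in_itv/= andbT; exact: h.
  move=> N [mN N0 sN]; exists N; split => // t /= nt; apply: sN => /= h; apply: nt => lt.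
  by apply: h; rewrite in_itv/= lt.
- move=> /(vanishes_near0_ae d0)[lam l0 u0].
  have [F [mF uF]] := radial_profile d0 lu.1 ru.
  apply: (H u F lam lu mF uF l0); right; split => //.
  have := @ae_profile _ _ d0 u F (`]0, lam[%classic) mF uF (measurable_itv _).
  have sub : (`]0, lam[%classic : set R) `<=` `[0, +oo[%classic.
    by move=> t /=; rewrite !in_itv/= !andbT => /andP[/ltW].
  move=> /(_ sub) [].
    by apply: filterS u0 => x h /=; rewrite in_itv/= => /andP[_]; exact: h.
  move=> N [mN N0 sN]; exists N; split => // t /= nt; by apply: sN => /= h; apply: nt.
Qed.
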